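(* Let $-\infty<\alpha<\infty$, $0\le\beta\le 1$, and let $f\in U(\mathbb D)$ or $f(z)=a_0+a_nz^n$ with $n\in\mathbb N$. Then $r\mapsto\mathsf{L}_{\alpha,\beta}(f,r)$ is strictly increasing on $(0,1)$ unless $f$ is constant (when $\beta<1$), respectively unless $f$ is a linear map (when $\beta=1$). Consequently: (i) $\lim_{r\to 0}\mathsf{L}_{\alpha,\beta}(f,r)=0$ when $\beta<1$, and $\lim_{r\to 0}\mathsf{L}_{\alpha,\beta}(f,r)=|f'(0)|$ when $\beta=1$. (ii) Put $\Phi_{L,\beta}(f,0):=\lim_{r\to 0}\Phi_{L,\beta}(f,r)$ and suppose $\Phi_{L,\beta}(f,1):=\lim_{r\to 1}\Phi_{L,\beta}(f,r)<\infty$. Then for all $0<r<s<1$, $$0\le \frac{\mathsf{L}_{\alpha,\beta}(f,s)-\mathsf{L}_{\alpha,\beta}(f,r)}{\log\nu_\alpha(s)-\log\nu_\alpha(r)}\leq \Phi_{L,\beta}(f,s)-\Phi_{L,\beta}(f,0),$$ with equality (in either inequality) if and only if $f$ is constant (when $\beta<1$), respectively $f$ is a linear map (when $\beta=1$). In particular, $t\mapsto \mathsf{L}_{\alpha,\beta}(f,t)$ is Lipschitz with respect to $\log\nu_\alpha(t)$ for $t\in (0,1)$, i.e. there is a constant $C$ with $|\mathsf{L}_{\alpha,\beta}(f,s)-\mathsf{L}_{\alpha,\beta}(f,r)|\le C\,|\log\nu_\alpha(s)-\log\nu_\alpha(r)|$ for all $r,s\in(0,1)$.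
   Context: $\mathbb D$ is the open unit disk in $\mathbb C$, $r\mathbb D=\{z:|z|<r\}$, $H(\mathbb D)$ is the space of holomorphic maps $f:\mathbb D\to\mathbb C$, $U(\mathbb D)$ is the set of univalent (injective) functions in $H(\mathbb D)$, and $\mathbb N=\{1,2,3,\dots\}$. For $f\in H(\mathbb D)$ and $r\in(0,1)$, $L(f,r)$ is the Euclidean length of the boundary $\partial f(r\mathbb D)$ of the image set $f(r\mathbb D)\subset\mathbb C$ (the projection of the Riemannian image, not counting multiplicity). For real $\alpha$, $d\mu_\alpha(t)=(1-t^2)^\alpha\,dt^2=(1-t^2)^\alpha\,2t\,dt$ on $(0,1)$ and $\nu_\alpha(r)=\int_0^r d\mu_\alpha(t)$. For $0\le\beta\le1$, $$\Phi_{L,\beta}(f,t)=\frac{L(f,t)}{(2\pi t)^\beta},\qquad \mathsf{L}_{\alpha,\beta}(f,r)=\frac{\int_0^r\Phi_{L,\beta}(f,t)\,d\mu_\alpha(t)}{\int_0^r d\mu_\alpha(t)}.$$ A linear map is a map $f(z)=a_0+a_1z$ with $a_0,a_1\in\mathbb C$ (constants included). *)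

(* Defs.v *)
From Stdlib Require Import Reals.
From Coquelicot Require Import Coquelicot.

Open Scope R_scope.

Definition disk (r : R) (z : C) : Prop := Cmod z < r.

(* A map on the unit disk is given by a total function on C of which only the
   values on [disk 1] matter; [disk 1] being open, differentiability at its
   points does not depend on the values outside. *)
Definition holomorphic (f : C -> C) : Prop :=
  forall z : C, disk 1 z -> ex_derive (K := C_AbsRing) (V := C_NormedModule) f z.

Definition univalent (f : C -> C) : Prop :=
  holomorphic f /\
  forall z w : C, disk 1 z -> disk 1 w -> f z = f w -> z = w.

Definition monomial_map (f : C -> C) : Prop :=
  exists (a0 an : C) (n : nat),
    (1 <= n)%nat /\ forall z : C, disk 1 z -> f z = (a0 + an * Cpow z n)%C.

Definition constant_map (f : C -> C) : Prop :=
  exists a0 : C, forall z : C, disk 1 z -> f z = a0.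

Definition linear_map (f : C -> C) : Prop :=
  exists a0 a1 : C, forall z : C, disk 1 z -> f z = (a0 + a1 * z)%C.

Definition image (f : C -> C) (A : C -> Prop) (w : C) : Prop :=
  exists z : C, A z /\ f z = w.

(* Closure minus interior. *)
Definition boundary (A : C -> Prop) (z : C) : Prop :=
  (forall V : C -> Prop, locally z V -> exists w : C, V w /\ A w) /\
  ~ locally z A.

(* The alternative [d = 0] gives the empty set diameter 0. *)
Definition diameter (A : C -> Prop) : Rbar :=
  Lub_Rbar (fun d : R =>
    d = 0 \/ exists z w : C, A z /\ A w /\ d = Cmod (z - w)%C).

(* Covers are indexed by nat, finite ones being padded with empty sets. Every
   diameter is at most [delta], so [real] loses nothing; covers with an
   infinite sum of diameters are irrelevant to the infimum, which is
   [p_infty] when there is no other cover. *)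
Definition hausdorff1_pre (delta : R) (A : C -> Prop) : Rbar :=
  Glb_Rbar (fun s : R =>
    exists U : nat -> C -> Prop,
      (forall z : C, A z -> exists i : nat, U i z) /\
      (forall i : nat, Rbar_le (diameter (U i)) delta) /\
      is_series (fun i : nat => real (diameter (U i))) s).

(* One-dimensional Hausdorff measure, normalized by the diameter so that it is
   the Euclidean length on rectifiable Jordan curves. *)
Definition hausdorff1 (A : C -> Prop) : Rbar :=
  Rbar_lub (fun x : Rbar =>
    exists delta : R, 0 < delta /\ x = hausdorff1_pre delta A).

(* For f holomorphic and 0 < r < 1 the boundary of f(rD) is contained in the
   rectifiable curve f(|z| = r), so its length is finite and [real] is
   harmless. *)
Definition L (f : C -> C) (r : R) : R :=
  real (hausdorff1 (boundary (image f (disk r)))).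

(* d mu_alpha(t) = (1 - t^2)^alpha d(t^2). *)
Definition mu_density (alpha t : R) : R := Rpower (1 - t ^ 2) alpha * (2 * t).

Definition nu (alpha r : R) : R := RInt (mu_density alpha) 0 r.

Definition Phi_L (beta : R) (f : C -> C) (t : R) : R :=
  L f t / Rpower (2 * PI * t) beta.

(* [Phi_L] is meant for t > 0; its value at the endpoint t = 0 does not affect
   the Riemann integral. *)
Definition L_mean (alpha beta : R) (f : C -> C) (r : R) : R :=
  RInt (fun t : R => Phi_L beta f t * mu_density alpha t) 0 r / nu alpha r.

Definition exceptional (beta : R) (f : C -> C) : Prop :=
  (beta < 1 /\ constant_map f) \/ (beta = 1 /\ linear_map f).

(* Main.v *)
(** For univalent [f] the boundary of [f (r D)] is the simple closed curve
    [f (|z| = r)], so [L f r = r * int |f' (r e^(it))| dt]; for a monomial it is a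
    circle of radius [|a_n| r^n]. Hence [L f r = 2 pi r m(r)] with [m] nondecreasing,
    and strictly so unless [f] is linear: the circle means of [|f'|] form a radial
    function with the sub-mean value property, which obeys the maximum principle,
    and equality forces [f'] to have locally constant argument, hence to be constant.
    So [Phi_L] is strictly increasing outside the exceptional case, and the theorem
    follows from [d L_mean / d (log nu) = Phi_L - L_mean]. *)

(* [L] is the Hausdorff measure of a topological boundary, so the formula for it is itself a
   theorem: openness of [f] and compactness identify the boundary with the image circle, fine
   partitions bound the measure above, and a covering estimate on an interval bounds it below. The
   sub-mean value property of the radial function is Fubini: the inequality for |f'| on circles of
   radius r about t e^(ia) is integrated over a, and exchanging the two angles leaves the radial
   mean at the distances |t + r e^(ip)|. All contour integrals are taken in the angle along circles.
   Under exp(x + iy) concentric circles become vertical sides of a rectangle, so Goursat on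
   rectangles is the only contour theorem. A monomial of degree n > 1 is not injective; at each
   radius it is traded for a linear map, depending on the radius, with the same image. The bounds in
   (ii) come from a mean value theorem: the quotient equals psi c - mean c at some c in [r, s],
   where psi is [Phi_L] continued by its limit at 0. Outside the exceptional case psi 0 < mean c <
   psi c <= psi s, which makes both inequalities strict at once. *)
Require Import Defs.
From Stdlib Require Import Reals.
From Coquelicot Require Import Coquelicot.
From Stdlib Require Import Psatz Classical ClassicalEpsilon.
From Stdlib Require Import FunctionalExtensionality PropExtensionality.
Open Scope R_scope.

(** The balls of [CU] are [Cmod] balls; those of the default uniform structure on
    [C] are squares. *)
Local Notation CU := (AbsRing_UniformSpace C_AbsRing).
Local Notation CN := (AbsRing_NormedModule C_AbsRing).
Local Notation ccont f x := (continuous (U := CU) f x).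
Local Notation ccontC f z := (continuous (T := CU) (U := CU) f (z : C)).
Local Notation cderiv f z d := (is_derive (K := C_AbsRing) (V := CN) f (z : C) (d : C)).

(** * Complex continuity and differentiability *)

Lemma ccont_eps {U : UniformSpace} (f : U -> C) (x : U) :
  ccont f x <-> forall eps : posreal, locally x (fun y => Cmod (f y - f x)%C < eps).
Proof.
  split.
  - intros H eps. apply (proj1 (filterlim_locally (U := CU) f (f x)) H eps).
  - intros H. apply (proj2 (filterlim_locally (U := CU) f (f x))). exact H.
Qed.

Lemma cderiv_eps (f : C -> C) (z d : C) :
  cderiv f z d <->
  forall eps : posreal, exists del : posreal, forall w : C, Cmod (w - z)%C < del ->
    Cmod (f w - f z - d * (w - z))%C <= eps * Cmod (w - z)%C.
Proof.
  split.
  - intros [_ H] eps.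
    destruct (H z (fun P HP => HP) eps) as [del Hd].
    exists del. intros w Hw. specialize (Hd w Hw).
    replace (f w - f z - d * (w - z))%C with (minus (G:=CN) (minus (G:=CN) (f w) (f z)) (scal (V:=CN) (minus (G:=CN) w z) d)).
    exact Hd. unfold minus, scal; simpl. unfold mult, plus, opp; simpl. ring.
  - intros H. split. apply is_linear_scal_l.
    intros x Hx. assert (z = x) as <- by exact (is_filter_lim_locally_unique (K:=C_AbsRing) (V:=CN) z x Hx). clear Hx.
    intros eps. destruct (H eps) as [del Hd].
    exists del. intros w Hw. specialize (Hd w Hw).
    replace (f w - f z - d * (w - z))%C with (minus (G:=CN) (minus (G:=CN) (f w) (f z)) (scal (V:=CN) (minus (G:=CN) w z) d)) in Hd.
    exact Hd. unfold minus, scal; simpl. unfold mult, plus, opp; simpl. ring.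
Qed.

Lemma cderiv_of_is_derive (f : C -> C) (z d : C) :
  is_derive (K := C_AbsRing) (V := C_NormedModule) f z d -> cderiv f z d.
Proof.
  intros [_ H]. split. apply is_linear_scal_l. exact H.
Qed.
Lemma is_derive_of_cderiv (f : C -> C) (z d : C) :
  cderiv f z d -> is_derive (K := C_AbsRing) (V := C_NormedModule) f z d.
Proof.
  intros [_ H]. split. apply is_linear_scal_l. exact H.
Qed.

Section CContinuity.
Context {U : UniformSpace}.
Implicit Types (f g : U -> C) (x : U).

Lemma ccont_ext f g x : (forall y, f y = g y) -> ccont f x -> ccont g x.
Proof. apply (@continuous_ext U CU). Qed.
Lemma ccont_const (c : C) x : ccont (fun _ : U => c) x.
Proof. apply continuous_const. Qed.
Lemma ccont_plus f g x : ccont f x -> ccont g x -> ccont (fun y => (f y + g y)%C) x.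
Proof. apply (continuous_plus (V := CN)). Qed.
Lemma ccont_minus f g x : ccont f x -> ccont g x -> ccont (fun y => (f y - g y)%C) x.
Proof. apply (continuous_minus (V := CN)). Qed.
Lemma ccont_mult f g x : ccont f x -> ccont g x -> ccont (fun y => (f y * g y)%C) x.
Proof. apply (continuous_mult (K := C_AbsRing)). Qed.
Lemma ccont_Cmod f x : ccont f x -> continuous (fun y => Cmod (f y)) x.
Proof.
  intros H. apply (continuous_comp (V := CU) f (Cmod : CU -> R)); [exact H|].
  apply (filterlim_norm (V := CN)).
Qed.
Lemma ccont_R f (u : U -> R) x : continuous u x -> (forall y, f y = RtoC (u y)) -> ccont f x.
Proof.
  intros H E. apply ccont_eps. intros eps.
  generalize (proj1 (filterlim_locally _ _) H eps). apply filter_imp.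
  intros y Hy. rewrite !E, <- RtoC_minus, Cmod_R. exact Hy.
Qed.
Lemma ccont_RtoC (u : U -> R) x : continuous u x -> ccont (fun y => RtoC (u y)) x.
Proof. intros H. now apply ccont_R with u. Qed.
Lemma ccont_pair (u v : U -> R) x :
  continuous u x -> continuous v x -> ccont (fun y => (u y, v y)) x.
Proof.
  intros Hu Hv. apply (ccont_ext (fun y => (u y + Ci * v y)%C)).
  { intros y. apply injective_projections; simpl; ring. }
  apply ccont_plus; [|apply ccont_mult]; [|apply ccont_const|]; now apply ccont_RtoC.
Qed.
Lemma ccont_Re f x : ccont f x -> continuous (fun y => Re (f y)) x.
Proof.
  intros H. apply (filterlim_locally (U := R_UniformSpace)). intros eps.
  generalize (proj1 (ccont_eps f x) H eps). apply filter_imp. intros y Hy.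
  change (Rabs (Re (f y) - Re (f x)) < eps).
  eapply Rle_lt_trans; [|exact Hy].
  replace (Re (f y) - Re (f x)) with (Re (f y - f x)%C) by reflexivity. apply re_le_Cmod.
Qed.
Lemma ccont_comp (g : C -> C) f x : ccont f x -> continuous (T := CU) (U := CU) g (f x) ->
  ccont (fun y => g (f y)) x.
Proof. intros Hf Hg. exact (@continuous_comp U CU CU f g x Hf Hg). Qed.
(** The two uniform structures have different balls but the same neighbourhoods. The bridge is
    needed because real-variable integrals and derivatives with values in [C] use the product
    structure, while the estimates use [Cmod] balls. *)
Lemma ccont_C_UniformSpace f x : ccont f x <-> continuous (U := C_UniformSpace) f x.
Proof.
  split; intros H P HP; apply H; now apply locally_C.
Qed.
End CContinuity.

Lemma cderiv_cont (f : C -> C) (z d : C) : cderiv f z d -> continuous (T := CU) (U := CU) f z.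
Proof. intros H. apply (ex_derive_continuous (K := C_AbsRing) (V := CN)). now exists d. Qed.

(** Only disks about 0 are considered; another centre is reached by translating the function. *)
Definition holomorphic_in (f : C -> C) (b : R) : Prop :=
  forall z, Cmod z < b -> exists d, cderiv f z d.
Lemma holomorphic_in_continuous f b : holomorphic_in f b -> forall z, Cmod z < b -> ccontC f z.
Proof. intros Hf z Hz. destruct (Hf z Hz) as [d Hd]. now apply cderiv_cont with d. Qed.

Lemma Cmod_minus_sym (z w : C) : Cmod (z - w)%C = Cmod (w - z)%C.
Proof. rewrite <- Cmod_opp. f_equal. ring. Qed.
Lemma Cmod_triangle_rev (z w : C) : Cmod z - Cmod w <= Cmod (z - w)%C.
Proof.
  assert (H := Cmod_triangle (z - w) w). replace (z - w + w)%C with z in H by ring. lra.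
Qed.

Lemma cderiv_inv (z : C) : z <> 0%C -> cderiv Cinv z (- / (z * z))%C.
Proof.
  intros Hz. apply cderiv_eps. intros eps.
  assert (Hp := proj1 (Cmod_gt_0 z) Hz). assert (He := cond_pos eps).
  set (m := Cmod z) in *.
  assert (Hm2 : 0 < m ^ 3) by now apply pow_lt.
  (* The error is (w - z)^2 / (w z^2). The first bound keeps |w| > m/2, so the denominator exceeds
     m^3/2; the second then makes the error at most eps |w - z|. *)
  assert (Hd : 0 < Rmin (m / 2) (eps * m ^ 3 / 2)).
  { apply Rmin_pos; [lra|]. apply Rmult_lt_0_compat; [|lra]. now apply Rmult_lt_0_compat. }
  exists (mkposreal _ Hd). intros w Hw. change (Cmod (w - z)%C < Rmin (m / 2) (eps * m ^ 3 / 2)) in Hw.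
  assert (H1 := Rlt_le_trans _ _ _ Hw (Rmin_l _ _)).
  assert (H2 := Rlt_le_trans _ _ _ Hw (Rmin_r _ _)).
  assert (Hwm : m / 2 < Cmod w).
  { assert (H := Cmod_triangle_rev z w). rewrite Cmod_minus_sym in H. fold m in H. lra. }
  assert (Hw0 : w <> 0%C). { apply Cmod_gt_0. lra. }
  replace (/ w - / z - - / (z * z) * (w - z))%C with ((w - z) * ((w - z) / (w * (z * z))))%C by (field; auto).
  rewrite Rmult_comm, Cmod_mult. apply Rmult_le_compat_l. apply Cmod_ge_0.
  rewrite Cmod_div, !Cmod_mult by (repeat apply Cmult_neq_0; auto).
  fold m. apply Rle_div_l. apply Rlt_gt. repeat apply Rmult_lt_0_compat; lra.
  apply Rlt_le, Rlt_le_trans with (1 := H2).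
  replace (eps * m^3/2) with (eps * (m / 2 * (m * m))) by field.
  apply Rmult_le_compat_l; [lra|]. apply Rmult_le_compat_r; nra.
Qed.

Lemma cderiv_const (c z : C) : cderiv (fun _ => c) z 0%C.
Proof. apply (is_derive_const (K := C_AbsRing) (V := CN)). Qed.
Lemma cderiv_id (z : C) : cderiv (fun w => w) z 1%C.
Proof. apply (is_derive_id (K := C_AbsRing)). Qed.
Lemma cderiv_plus (f g : C -> C) (z df dg : C) : cderiv f z df -> cderiv g z dg ->
  cderiv (fun w => f w + g w)%C z (df + dg)%C.
Proof. apply (is_derive_plus (K := C_AbsRing) (V := CN)). Qed.
Lemma cderiv_minus (f g : C -> C) (z df dg : C) : cderiv f z df -> cderiv g z dg ->
  cderiv (fun w => f w - g w)%C z (df - dg)%C.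
Proof. apply (is_derive_minus (K := C_AbsRing) (V := CN)). Qed.
Lemma cderiv_mult (f g : C -> C) (z df dg : C) : cderiv f z df -> cderiv g z dg ->
  cderiv (fun w => f w * g w)%C z (df * g z + f z * dg)%C.
Proof.
  intros Hf Hg. apply (is_derive_mult (K := C_AbsRing) f g z df dg Hf Hg).
  intros n m. apply Cmult_comm.
Qed.
Lemma cderiv_comp (f g : C -> C) (z df dg : C) : cderiv f (g z) df -> cderiv g z dg ->
  cderiv (fun w => f (g w))%C z (df * dg)%C.
Proof.
  intros Hf Hg. rewrite Cmult_comm. apply (is_derive_comp (K := C_AbsRing) (V := CN) f g z df dg Hf Hg).
Qed.
Lemma cderiv_ext_loc (f g : C -> C) (z d : C) : (exists del : posreal, forall w, Cmod (w - z)%C < del -> f w = g w) ->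
  cderiv f z d -> cderiv g z d.
Proof.
  intros [del H]. apply (is_derive_ext_loc (K := C_AbsRing) (V := CN)).
  exists del. exact H.
Qed.
Lemma cderiv_eq (f : C -> C) (z d e : C) : cderiv f z d -> d = e -> cderiv f z e.
Proof. now intros H <-. Qed.
Lemma cderiv_div (f g : C -> C) (z df dg : C) : cderiv f z df -> cderiv g z dg -> g z <> 0%C ->
  cderiv (fun w => f w / g w)%C z (df / g z - f z * dg / (g z * g z))%C.
Proof.
  intros Hf Hg H0. apply (cderiv_eq _ _ (df * / g z + f z * (- / (g z * g z) * dg))%C).
  - apply (cderiv_mult f (fun w => / g w)%C); [exact Hf|].
    apply (cderiv_comp Cinv g); [now apply cderiv_inv|exact Hg].
  - field. exact H0.
Qed.
Lemma cderiv_affine (a b z : C) : cderiv (fun w => a + b * w)%C z b.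
Proof.
  apply (cderiv_eq _ _ (0 + (0 * z + b * 1))%C); [|ring].
  apply cderiv_plus; [apply cderiv_const|].
  apply cderiv_mult; [apply cderiv_const|apply cderiv_id].
Qed.

(** * Integrals of complex-valued functions *)

Definition CInt (f : R -> C) (a b : R) : C := RInt (V := C_R_CompleteNormedModule) f a b.
Definition ccont_on (f : R -> C) (a b : R) : Prop := forall x, a <= x <= b -> ccont f x.
Local Notation CRN := C_R_CompleteNormedModule.

Lemma ccont_on_sub f a b a' b' : ccont_on f a b -> a <= a' -> b' <= b -> ccont_on f a' b'.
Proof. intros H Ha Hb x Hx. apply H. lra. Qed.
Lemma ccont_on_Cmod f a b : ccont_on f a b -> forall x, a <= x <= b -> continuous (fun t => Cmod (f t)) x.
Proof. intros H x Hx. apply ccont_Cmod, H, Hx. Qed.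

Lemma ex_RInt_cont (f : R -> R) (a b : R) : a <= b -> (forall x, a <= x <= b -> continuous f x) ->
  ex_RInt f a b.
Proof.
  intros Hab H. apply (ex_RInt_continuous (V := R_CompleteNormedModule)).
  rewrite Rmin_left, Rmax_right by lra. exact H.
Qed.

Section CInt_theory.
Variables (a b : R) (Hab : a <= b).
Implicit Types f g : R -> C.

Lemma ex_CInt f : ccont_on f a b -> ex_RInt (V := CRN) f a b.
Proof.
  intros H. apply (ex_RInt_continuous (V := CRN)).
  rewrite Rmin_left, Rmax_right by lra. intros x Hx. apply ccont_C_UniformSpace. now apply H.
Qed.
Lemma is_CInt f : ccont_on f a b -> is_RInt (V := CRN) f a b (CInt f a b).
Proof. intros H. apply (RInt_correct (V := CRN)). now apply ex_CInt. Qed.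
Lemma CInt_ext f g : (forall x, a <= x <= b -> f x = g x) -> CInt f a b = CInt g a b.
Proof.
  intros H. apply (RInt_ext (V := CRN)). rewrite Rmin_left, Rmax_right by lra. intros x Hx. apply H. lra.
Qed.
Lemma CInt_plus f g : ccont_on f a b -> ccont_on g a b ->
  CInt (fun x => f x + g x)%C a b = (CInt f a b + CInt g a b)%C.
Proof. intros Hf Hg. apply (RInt_plus (V := CRN)); now apply ex_CInt. Qed.
Lemma CInt_minus f g : ccont_on f a b -> ccont_on g a b ->
  CInt (fun x => f x - g x)%C a b = (CInt f a b - CInt g a b)%C.
Proof. intros Hf Hg. apply (RInt_minus (V := CRN)); now apply ex_CInt. Qed.
Lemma CInt_Re f : ccont_on f a b -> Re (CInt f a b) = RInt (fun x => Re (f x)) a b.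
Proof.
  intros H. symmetry. apply is_RInt_unique.
  exact (is_RInt_fct_extend_fst (U := R_NormedModule) (V := R_NormedModule) f a b _ (is_CInt f H)).
Qed.
(** Multiplication by a complex constant is not the scalar action of the real module in which the
    integral lives, hence the passage through real and imaginary parts. *)
Lemma CInt_mult (c : C) f : ccont_on f a b -> CInt (fun x => c * f x)%C a b = (c * CInt f a b)%C.
Proof.
  intros H. apply (is_RInt_unique (V := CRN)).
  assert (H1 := is_RInt_fct_extend_fst (U := R_NormedModule) (V := R_NormedModule) f a b _ (is_CInt f H)).
  assert (H2 := is_RInt_fct_extend_snd (U := R_NormedModule) (V := R_NormedModule) f a b _ (is_CInt f H)).
  apply (is_RInt_fct_extend_pair (U := R_NormedModule) (V := R_NormedModule)).
  - apply (is_RInt_minus (V := R_NormedModule)); apply (is_RInt_scal (V := R_NormedModule)); assumption.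
  - apply (is_RInt_plus (V := R_NormedModule)); apply (is_RInt_scal (V := R_NormedModule)); assumption.
Qed.
Lemma CInt_const (c : C) : CInt (fun _ => c) a b = (RtoC (b - a) * c)%C.
Proof. unfold CInt. rewrite RInt_const. apply scal_R_Cmult. Qed.
Lemma CInt_norm f : ccont_on f a b -> Cmod (CInt f a b) <= RInt (fun x => Cmod (f x)) a b.
Proof.
  intros H. rewrite Cmod_norm.
  apply (norm_RInt_le (V := CRN) f (fun x => Cmod (f x)) a b); auto.
  - intros x Hx. rewrite Cmod_norm. apply Rle_refl.
  - now apply is_CInt.
  - apply (RInt_correct (V := R_CompleteNormedModule)), ex_RInt_cont; [lra|]. now apply ccont_on_Cmod.
Qed.
Lemma CInt_bound f (M : R) : ccont_on f a b -> (forall x, a <= x <= b -> Cmod (f x) <= M) ->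
  Cmod (CInt f a b) <= (b - a) * M.
Proof.
  intros H HM. eapply Rle_trans. now apply CInt_norm.
  rewrite <- (RInt_const (V := R_CompleteNormedModule) a b M : RInt (fun _ => M) a b = (b - a) * M).
  apply RInt_le; auto.
  - apply ex_RInt_cont; [lra|]. now apply ccont_on_Cmod.
  - apply ex_RInt_const.
  - intros x Hx. apply HM. lra.
Qed.
End CInt_theory.

Lemma CInt_Chasles f a b c : a <= b <= c -> ccont_on f a c ->
  (CInt f a b + CInt f b c)%C = CInt f a c.
Proof.
  intros H Hf. apply (RInt_Chasles (V := CRN)); apply ex_CInt; try lra.
  apply ccont_on_sub with a c; auto; lra. apply ccont_on_sub with a c; auto; lra.
Qed.
Lemma CInt_shift f u a b : a <= b -> ccont_on f (a + u) (b + u) ->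
  CInt (fun x => f (x + u)) a b = CInt f (a + u) (b + u).
Proof.
  intros H Hf. unfold CInt.
  replace (a + u) with (1 * a + u) by ring. replace (b + u) with (1 * b + u) by ring.
  rewrite <- (RInt_comp_lin (V := CRN)).
  - apply (RInt_ext (V := CRN)). intros x _. rewrite Rmult_1_l. symmetry. apply (scal_one (K := R_Ring)).
  - rewrite !Rmult_1_l. apply ex_CInt; auto. lra.
Qed.
Lemma CInt_period f p u : 0 <= p -> (forall x, ccont f x) -> (forall x, f (x + p) = f x) ->
  CInt f u (u + p) = CInt f 0 p.
Proof.
  intros Hp Hf Hper.
  assert (con' : forall a b, ccont_on f a b) by (intros a b x _; apply Hf).
  (* [u] may have either sign, so the splitting uses oriented integrals. The last piece is a
     translate by one period of the integral from 0 to [u], which cancels the first piece. *)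
  assert (E : CInt f u (u + p) = (CInt f u 0 + CInt f 0 p + CInt f p (u + p))%C).
  { unfold CInt.
    assert (Hex : forall a b, ex_RInt (V := CRN) f a b).
    { intros a b. apply (ex_RInt_continuous (V := CRN)). intros x _. apply ccont_C_UniformSpace, Hf. }
    rewrite <- (RInt_Chasles (V := CRN) f u p (u + p)) by auto.
    rewrite <- (RInt_Chasles (V := CRN) f u 0 p) by auto. reflexivity. }
  rewrite E.
  replace (CInt f p (u + p)) with (CInt f 0 u).
  - unfold CInt. rewrite <- (opp_RInt_swap (V := CRN) f u 0).
    change (CInt f u 0 + CInt f 0 p + - CInt f u 0 = CInt f 0 p)%C. ring.
    apply (ex_RInt_continuous (V := CRN)). intros x _. apply ccont_C_UniformSpace, Hf.
  - unfold CInt. replace (u + p) with (1 * u + p) by ring. replace p with (1 * 0 + p) at 1 by ring.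
    rewrite <- (RInt_comp_lin (V := CRN)).
    + apply (RInt_ext (V := CRN)). intros x _. rewrite Rmult_1_l, Hper. symmetry. apply (scal_one (K := R_Ring)).
    + apply (ex_RInt_continuous (V := CRN)). intros x _. apply ccont_C_UniformSpace, Hf.
Qed.

(** * Compactness of segments and integrals depending on a parameter *)

(** Heine-Borel in the form used throughout: a positive tolerance that exists locally and may be
    shrunk can be chosen uniformly. The supremum of the points up to which one tolerance works
    cannot lie before [b], since the local tolerance there, combined with an earlier one, reaches
    further. *)
Lemma segment_compactness (P : R -> R -> Prop) (a b : R) :
  (forall d d' y, 0 < d' <= d -> P d y -> P d' y) ->
  (forall y, a <= y <= b -> exists d, 0 < d /\ forall y', a <= y' <= b -> Rabs (y' - y) < d -> P d y') ->
  exists d, 0 < d /\ forall y, a <= y <= b -> P d y.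
Proof.
  intros Hanti Hloc.
  destruct (Rle_or_lt a b) as [Hab|Hab]; [|exists 1; split; [lra|intros y Hy; lra]].
  set (E := fun t => a <= t <= b /\ exists d, 0 < d /\ forall y, a <= y <= t -> P d y).
  assert (Ha : E a).
  { split; [lra|]. destruct (Hloc a) as [d [Hd H]]; [lra|]. exists d. split; auto.
    intros y Hy. apply H; [lra|]. replace (y - a) with 0 by lra. now rewrite Rabs_R0. }
  destruct (completeness E) as [m [Hub Hlub]].
  { exists b. intros t [Ht _]. lra. }
  { now exists a. }
  assert (Ham : a <= m) by now apply Hub.
  assert (Hmb : m <= b) by (apply Hlub; intros t [Ht _]; lra).
  destruct (Hloc m) as [d [Hd H]]; [lra|].
  assert (Hex : exists t, E t /\ m - d < t).
  { apply NNPP. intros Hn. assert (m <= m - d); [|lra]. apply Hlub. intros t Et.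
    apply Rnot_lt_le. intros Hlt. apply Hn. now exists t. }
  destruct Hex as [t [[Htab [d1 [Hd1 H1]]] Htm]].
  assert (Hm2 : forall u, a <= u <= b -> u < m + d -> E u).
  { intros u Hu Hum. split; auto. exists (Rmin d d1). split; [now apply Rmin_pos|].
    assert (L1 := Rmin_l d d1). assert (L2 := Rmin_r d d1). assert (L3 := Rmin_pos d d1 Hd Hd1).
    intros y Hy. destruct (Rle_or_lt y t) as [Hyt|Hyt].
    - apply Hanti with d1; [lra|]. apply H1. lra.
    - apply Hanti with d; [lra|]. apply H; [lra|].
      apply Rabs_def1; lra. }
  assert (Hmb2 : b < m + d).
  { destruct (Rlt_or_le b (m + d)) as [|Hle]; auto. exfalso.
    assert (E (m + d / 2)) by (apply Hm2; lra). assert (m + d / 2 <= m) by now apply Hub. lra. }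
  destruct (Hm2 b) as [_ Hres]; [lra|lra|exact Hres].
Qed.

Definition cont2 (F : R -> R -> C) (x y : R) : Prop :=
  forall eps, 0 < eps -> exists d, 0 < d /\ forall x' y', Rabs (x' - x) < d -> Rabs (y' - y) < d ->
    Cmod (F x' y' - F x y)%C < eps.

Lemma cont2_ccont F x y : cont2 F x y -> ccont (F x) y.
Proof.
  intros H. apply ccont_eps. intros eps. destruct (H eps (cond_pos eps)) as [d [Hd H']].
  exists (mkposreal d Hd). intros y' Hy'. apply H'; [|exact Hy'].
  now rewrite Rminus_diag, Rabs_R0.
Qed.
Lemma cont2_ccont1 F x y : cont2 F x y -> ccont (fun t => F t y) x.
Proof.
  intros H. apply ccont_eps. intros eps. destruct (H eps (cond_pos eps)) as [d [Hd H']].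
  exists (mkposreal d Hd). intros y' Hy'. apply H'; [exact Hy'|].
  now rewrite Rminus_diag, Rabs_R0.
Qed.

Lemma cont2_unif F x c d : (forall y, c <= y <= d -> cont2 F x y) -> forall eps, 0 < eps ->
  exists del, 0 < del /\ forall y, c <= y <= d -> forall x', Rabs (x' - x) < del ->
    Cmod (F x' y - F x y)%C < eps.
Proof.
  intros H eps Heps.
  apply (segment_compactness (fun del y => forall x', Rabs (x' - x) < del -> Cmod (F x' y - F x y)%C < eps)).
  - intros e e' y He Hy x' Hx'. apply Hy. lra.
  - intros y Hy. destruct (H y Hy (eps / 2)) as [del [Hdel H']]; [lra|].
    exists del. split; auto. intros y' _ Hyy x' Hx'.
    assert (H1 := H' x' y' Hx' Hyy).
    assert (H2 : Cmod (F x y' - F x y)%C < eps / 2).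
    { apply H'; auto. now rewrite Rminus_diag, Rabs_R0. }
    replace (F x' y' - F x y')%C with ((F x' y' - F x y) - (F x y' - F x y))%C by ring.
    eapply Rle_lt_trans. apply Cmod_triangle. rewrite Cmod_opp. lra.
Qed.

Lemma CInt_param_cont F x c d : c <= d ->
  (exists del, 0 < del /\ forall x', Rabs (x' - x) < del -> forall y, c <= y <= d -> cont2 F x' y) ->
  ccont (fun x' => CInt (F x') c d) x.
Proof.
  intros Hcd [e [He H]]. apply ccont_eps. intros eps.
  (* Adding 1 to the length covers the degenerate segment, and the factor 2 leaves room for the
     strict inequality. *)
  assert (Hp : 0 < eps / (2 * (d - c + 1))) by (apply Rdiv_lt_0_compat; [apply cond_pos|lra]).
  destruct (cont2_unif F x c d) with (eps := eps / (2 * (d - c + 1))) as [del [Hdel H']]; auto.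
  { intros y Hy. apply H; auto. now rewrite Rminus_diag, Rabs_R0. }
  assert (Hm := Rmin_pos _ _ He Hdel).
  exists (mkposreal _ Hm). intros x' Hx'. change (Rabs (x' - x) < Rmin e del) in Hx'.
  assert (H1 := Rlt_le_trans _ _ _ Hx' (Rmin_l _ _)).
  assert (H2 := Rlt_le_trans _ _ _ Hx' (Rmin_r _ _)).
  assert (C1 : ccont_on (F x') c d) by (intros y Hy; now apply cont2_ccont, H).
  assert (C2 : ccont_on (F x) c d).
  { intros y Hy. apply cont2_ccont, H; auto. now rewrite Rminus_diag, Rabs_R0. }
  rewrite <- CInt_minus by auto.
  eapply Rle_lt_trans. apply CInt_bound with (M := eps / (2 * (d - c + 1))); auto.
  - intros y Hy. now apply ccont_minus; [apply C1|apply C2].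
  - intros y Hy. apply Rlt_le. now apply H'.
  - assert (He' := cond_pos eps). apply Rle_lt_trans with (eps / 2); [|lra].
    replace (eps / 2) with ((d - c + 1) * (eps / (2 * (d - c + 1)))) by (field; lra).
    apply Rmult_le_compat_r; lra.
Qed.

(** * Goursat's theorem on rectangles *)

Definition quarter_additive (P : R -> R -> R -> R -> Prop) (a b c d : R) : Prop :=
  forall a' b' c' d', a <= a' <= b' -> b' <= b -> c <= c' <= d' -> d' <= d ->
  let m := (a' + b') / 2 in let n := (c' + d') / 2 in
  P a' m c' n -> P m b' c' n -> P a' m n d' -> P m b' n d' -> P a' b' c' d'.

(** If the property failed, one of four quarters would fail again and again; the nested failing
    rectangles shrink to a point, where the local hypothesis forbids failure. *)
Lemma rectangle_bisection (P : R -> R -> R -> R -> Prop) (a b c d : R) : a <= b -> c <= d ->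
  quarter_additive P a b c d ->
  (forall x y, a <= x <= b -> c <= y <= d -> exists del, 0 < del /\
    forall a' b' c' d', a <= a' <= x -> x <= b' <= b -> c <= c' <= y -> y <= d' <= d ->
      b' - a' < del -> d' - c' < del -> P a' b' c' d') ->
  P a b c d.
Proof.
  intros Hab Hcd Hq Hloc. apply NNPP. intros Hn.
  set (w := b - a). set (h := d - c).
  (* A stage-[n] rectangle is stored as its lower left corner only, since its sides are the original
     ones divided by 2^n. *)
  set (bad := fun n (p : R * R) => a <= fst p /\ fst p + w / 2 ^ n <= b /\ c <= snd p /\ snd p + h / 2 ^ n <= d /\
    ~ P (fst p) (fst p + w / 2 ^ n) (snd p) (snd p + h / 2 ^ n)).
  assert (Hw : 0 <= w) by (unfold w; lra). assert (Hh : 0 <= h) by (unfold h; lra).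
  assert (P2 : forall n, 0 < 2 ^ n) by (intros n; apply pow_lt; lra).
  assert (Hstep : forall n p, bad n p -> exists q, bad (S n) q /\ fst p <= fst q /\ snd p <= snd q /\
     fst q + w / 2 ^ (S n) <= fst p + w / 2 ^ n /\ snd q + h / 2 ^ (S n) <= snd p + h / 2 ^ n).
  { intros n [x y] (H1 & H2 & H3 & H4 & H5). simpl in H1, H2, H3, H4, H5.
    assert (Ew : w / 2 ^ (S n) = w / 2 ^ n / 2) by (simpl; field; specialize (P2 n); lra).
    assert (Eh : h / 2 ^ (S n) = h / 2 ^ n / 2) by (simpl; field; specialize (P2 n); lra).
    assert (Hwn : 0 <= w / 2 ^ n) by (apply Rdiv_le_0_compat; auto).
    assert (Hhn : 0 <= h / 2 ^ n) by (apply Rdiv_le_0_compat; auto).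
    unfold bad. rewrite Ew, Eh. set (u := w / 2 ^ n) in *. set (v := h / 2 ^ n) in *.
    apply NNPP. intros Hno. apply H5.
    apply Hq; try lra.
    all: replace ((x + (x + u)) / 2) with (x + u / 2) by field; replace ((y + (y + v)) / 2) with (y + v / 2) by field.
    - apply NNPP. intros Hx. apply Hno. exists (x, y). simpl. repeat split; try lra; auto.
    - apply NNPP. intros Hx. apply Hno. exists (x + u / 2, y). simpl. repeat split; try lra.
      replace (x + u / 2 + u / 2) with (x + u) by field. auto.
    - apply NNPP. intros Hx. apply Hno. exists (x, y + v / 2). simpl. repeat split; try lra.
      replace (y + v / 2 + v / 2) with (y + v) by field. auto.
    - apply NNPP. intros Hx. apply Hno. exists (x + u / 2, y + v / 2). simpl. repeat split; try lra.
      replace (x + u / 2 + u / 2) with (x + u) by field.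
      replace (y + v / 2 + v / 2) with (y + v) by field. auto. }
  assert (H0 : bad O (a, c)).
  { unfold bad. simpl. unfold w, h. rewrite !Rdiv_1_r.
    replace (a + (b - a)) with b by ring. replace (c + (d - c)) with d by ring. repeat split; auto; lra. }
  (* The premise [bad n p] makes the relation satisfiable for every [p], so [epsilon] can drive a
     recursion on plain pairs, without carrying proofs. *)
  set (Q := fun n p q => bad n p -> bad (S n) q /\ fst p <= fst q /\ snd p <= snd q /\
     fst q + w / 2 ^ (S n) <= fst p + w / 2 ^ n /\ snd q + h / 2 ^ (S n) <= snd p + h / 2 ^ n).
  set (s := fix s n := match n with O => (a, c) | S k => epsilon (inhabits (a, c)) (Q k (s k)) end).
  assert (Hnext : forall n, Q n (s n) (s (S n))).
  { intros n. simpl (s (S n)). apply epsilon_spec.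
    destruct (classic (bad n (s n))) as [Hb|Hb].
    - destruct (Hstep n (s n) Hb) as [q Hqq]. now exists q.
    - exists (a, c). intros Hb'. contradiction. }
  assert (Hbad : forall n, bad n (s n)).
  { induction n; [exact H0|]. now apply Hnext. }
  assert (Hmon : forall n k, fst (s n) <= fst (s (n + k)%nat) /\ snd (s n) <= snd (s (n + k)%nat) /\
     fst (s (n + k)%nat) + w / 2 ^ (n + k) <= fst (s n) + w / 2 ^ n /\ snd (s (n + k)%nat) + h / 2 ^ (n + k) <= snd (s n) + h / 2 ^ n).
  { intros n. induction k. rewrite Nat.add_0_r. lra. rewrite Nat.add_succ_r.
    destruct (Hnext (n + k)%nat (Hbad _)) as (_ & Q1 & Q2 & Q3 & Q4). lra. }
  assert (Hpos : forall n, 0 <= w / 2 ^ n /\ 0 <= h / 2 ^ n).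
  { intros n. split; apply Rdiv_le_0_compat; auto. }
  assert (Hcmp : forall n k, fst (s n) <= fst (s k) + w / 2 ^ k /\ snd (s n) <= snd (s k) + h / 2 ^ k).
  { intros n k. destruct (Nat.le_ge_cases n k) as [Hle|Hle].
    - destruct (Hmon n (k - n)%nat) as (Q1 & Q2 & _). replace (n + (k - n))%nat with k in * by lia.
      destruct (Hpos k). lra.
    - destruct (Hmon k (n - k)%nat) as (_ & _ & Q1 & Q2). replace (k + (n - k))%nat with n in * by lia.
      destruct (Hpos n). lra. }
  assert (Hlim : forall g : nat -> R, forall l : nat -> R, (forall n k, g n <= g k + l k) ->
     exists x, forall n, g n <= x <= g n + l n).
  { intros g l Hgl. destruct (completeness (fun t => exists n, t = g n)) as [x [Hx1 Hx2]].
    - exists (g O + l O). intros t [n ->]. apply Hgl.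
    - exists (g O). now exists O.
    - exists x. intros n. split. apply Hx1. now exists n. apply Hx2. intros t [k ->]. apply Hgl. }
  destruct (Hlim (fun n => fst (s n)) (fun n => w / 2 ^ n)) as [x Hx]. { intros n k. apply Hcmp. }
  destruct (Hlim (fun n => snd (s n)) (fun n => h / 2 ^ n)) as [y Hy]. { intros n k. apply Hcmp. }
  assert (Hxin : a <= x <= b). { specialize (Hx O). destruct (Hbad O) as (Q1 & Q2 & _). lra. }
  assert (Hyin : c <= y <= d). { specialize (Hy O). destruct (Hbad O) as (_ & _ & Q1 & Q2 & _). lra. }
  destruct (Hloc x y Hxin Hyin) as [del [Hdel Hgood]].
  (* Dividing by w + h + 1 makes both sides of the stage-[N] rectangle shorter than [del], whichever
     of them is longer or zero. *)
  destruct (pow_lt_1_zero (/ 2)) with (y := del / (w + h + 1)) as [N HN].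
  { rewrite Rabs_pos_eq; lra. }
  { apply Rdiv_lt_0_compat; lra. }
  specialize (HN N (Nat.le_refl _)).
  assert (Hsm : / 2 ^ N * (w + h + 1) < del).
  { apply Rlt_div_r. lra. rewrite <- pow_inv. eapply Rle_lt_trans. apply Rle_abs. exact HN. }
  assert (HP2 := Rinv_0_lt_compat _ (P2 N)).
  destruct (Hbad N) as (Q1 & Q2 & Q3 & Q4 & Q5). apply Q5.
  specialize (Hx N). specialize (Hy N). simpl in Hx, Hy.
  apply Hgood; try lra; unfold Rdiv; nra.
Qed.

(** The Cauchy-Riemann condition: the real differential at (x, y) is multiplication by [D]. Two real
    coordinates let Goursat apply directly in logarithmic polar coordinates. *)
Definition cdiff2 (h : R -> R -> C) (x y : R) (D : C) : Prop :=
  forall eps, 0 < eps -> exists del, 0 < del /\ forall u v, Rabs (u - x) < del -> Rabs (v - y) < del ->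
    Cmod (h u v - h x y - D * (RtoC (u - x) + Ci * RtoC (v - y)))%C <= eps * (Rabs (u - x) + Rabs (v - y)).

Lemma Cmod_cartesian (u v : R) : Cmod (RtoC u + Ci * RtoC v)%C <= Rabs u + Rabs v.
Proof.
  eapply Rle_trans. apply Cmod_triangle. rewrite Cmod_mult, Cmod_Ci, !Cmod_R. lra.
Qed.

Lemma cdiff2_cont2 h x y D : cdiff2 h x y D -> cont2 h x y.
Proof.
  intros H eps Heps. destruct (H 1 Rlt_0_1) as [del [Hdel Hd]].
  assert (HD := Cmod_ge_0 D).
  assert (Hk : 0 < eps / (2 * (Cmod D + 1))) by (apply Rdiv_lt_0_compat; lra).
  exists (Rmin del (eps / (2 * (Cmod D + 1)))). split; [now apply Rmin_pos|].
  intros u v Hu Hv.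
  assert (U1 := Rlt_le_trans _ _ _ Hu (Rmin_l _ _)). assert (U2 := Rlt_le_trans _ _ _ Hu (Rmin_r _ _)).
  assert (V1 := Rlt_le_trans _ _ _ Hv (Rmin_l _ _)). assert (V2 := Rlt_le_trans _ _ _ Hv (Rmin_r _ _)).
  specialize (Hd u v U1 V1).
  set (q := (D * (RtoC (u - x) + Ci * RtoC (v - y)))%C) in *.
  replace (h u v - h x y)%C with ((h u v - h x y - q) + q)%C by ring.
  eapply Rle_lt_trans. apply Cmod_triangle.
  assert (Hq : Cmod q <= Cmod D * (Rabs (u - x) + Rabs (v - y))).
  { unfold q. rewrite Cmod_mult. apply Rmult_le_compat_l; auto. apply Cmod_cartesian. }
  apply Rle_lt_trans with ((Cmod D + 1) * (Rabs (u - x) + Rabs (v - y))). lra.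
  replace eps with ((Cmod D + 1) * (eps / (2 * (Cmod D + 1)) + eps / (2 * (Cmod D + 1)))) by (field; lra).
  apply Rmult_lt_compat_l; lra.
Qed.

(** The counterclockwise contour integral of h dz: bottom minus top, plus i times right minus
    left. *)
Definition rectangle_int (h : R -> R -> C) (a b c d : R) : C :=
  (CInt (fun u => h u c - h u d) a b + Ci * CInt (fun v => h b v - h a v) c d)%C.

(** The contour integral of an affine function vanishes by direct cancellation, so [h] can be
    replaced by its first-order remainder [k], which is at most [e] on the whole perimeter. *)
Lemma rectangle_int_small h a b c d x y D e : a <= x <= b -> c <= y <= d ->
  (forall u v, a <= u <= b -> c <= v <= d -> cont2 h u v) ->
  (forall u v, a <= u <= b -> c <= v <= d ->
    Cmod (h u v - h x y - D * (RtoC (u - x) + Ci * RtoC (v - y)))%C <= e) ->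
  Cmod (rectangle_int h a b c d) <= 2 * e * ((b - a) + (d - c)).
Proof.
  intros Hx Hy Hc He.
  set (k := fun u v => (h u v - h x y - D * (RtoC (u - x) + Ci * RtoC (v - y)))%C).
  assert (Ch : forall v, c <= v <= d -> ccont_on (fun u => h u v) a b).
  { intros v Hv u Hu. apply (cont2_ccont1 h). auto. }
  assert (Cv : forall u, a <= u <= b -> ccont_on (fun v => h u v) c d).
  { intros u Hu v Hv. apply (cont2_ccont h). auto. }
  assert (Kh : forall v, c <= v <= d -> ccont_on (fun u => k u v) a b).
  { intros v Hv u Hu. unfold k. apply ccont_minus. apply ccont_minus. now apply Ch. apply ccont_const.
    apply ccont_mult. apply ccont_const. apply ccont_plus. apply ccont_RtoC.
    apply (continuous_minus (V := R_NormedModule)). apply continuous_id. apply continuous_const. apply ccont_const. }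
  assert (Kv : forall u, a <= u <= b -> ccont_on (fun v => k u v) c d).
  { intros u Hu v Hv. unfold k. apply ccont_minus. apply ccont_minus. now apply Cv. apply ccont_const.
    apply ccont_mult. apply ccont_const. apply ccont_plus. apply ccont_const. apply ccont_mult. apply ccont_const.
    apply ccont_RtoC. apply (continuous_minus (V := R_NormedModule)). apply continuous_id. apply continuous_const. }
  assert (Hab : a <= b) by lra. assert (Hcd : c <= d) by lra.
  assert (E : rectangle_int h a b c d = (CInt (fun u => k u c - k u d) a b + Ci * CInt (fun v => k b v - k a v) c d)%C).
  { unfold rectangle_int.
    rewrite (CInt_ext a b Hab (fun u => h u c - h u d)%C (fun u => (k u c - k u d) + D * (Ci * RtoC (c - d)))%C).
    2:{ intros u _. unfold k. rewrite !RtoC_minus. ring. }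
    rewrite (CInt_ext c d Hcd (fun v => h b v - h a v)%C (fun v => (k b v - k a v) + D * RtoC (b - a))%C).
    2:{ intros u _. unfold k. rewrite !RtoC_minus. ring. }
    rewrite !CInt_plus, !CInt_const, !RtoC_minus; try lra. ring.
    - intros v Hv. apply ccont_minus; apply Kv; auto; lra.
    - intros v Hv. apply ccont_const.
    - intros v Hv. apply ccont_minus; apply Kh; auto; lra.
    - intros v Hv. apply ccont_const. }
  rewrite E. eapply Rle_trans. apply Cmod_triangle. rewrite Cmod_mult, Cmod_Ci, Rmult_1_l.
  assert (B1 : Cmod (CInt (fun u => k u c - k u d)%C a b) <= (b - a) * (2 * e)).
  { apply CInt_bound; auto. intros u Hu. apply ccont_minus; apply Kh; auto; lra.
    intros u Hu. eapply Rle_trans. apply Cmod_triangle. rewrite Cmod_opp.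
    assert (Cmod (k u c) <= e) by (apply He; lra). assert (Cmod (k u d) <= e) by (apply He; lra). lra. }
  assert (B2 : Cmod (CInt (fun v => k b v - k a v)%C c d) <= (d - c) * (2 * e)).
  { apply CInt_bound; auto. intros u Hu. apply ccont_minus; apply Kv; auto; lra.
    intros u Hu. eapply Rle_trans. apply Cmod_triangle. rewrite Cmod_opp.
    assert (Cmod (k b u) <= e) by (apply He; lra). assert (Cmod (k a u) <= e) by (apply He; lra). lra. }
  lra.
Qed.

(** The bound [2 eps (width + height)^2] is additive under quartering, so it only
    has to be checked on small rectangles. *)
Lemma goursat h a b c d : a <= b -> c <= d ->
  (forall x y, a <= x <= b -> c <= y <= d -> exists D, cdiff2 h x y D) ->
  rectangle_int h a b c d = 0%C.
Proof.
  intros Hab Hcd Hd.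
  assert (Hc : forall x y, a <= x <= b -> c <= y <= d -> cont2 h x y).
  { intros x y Hx Hy. destruct (Hd x y Hx Hy) as [D HD]. now apply cdiff2_cont2 with D. }
  assert (Hsmall : forall eps, 0 < eps -> Cmod (rectangle_int h a b c d) <= 2 * eps * ((b - a) + (d - c)) ^ 2).
  { intros eps Heps.
    apply (rectangle_bisection (fun a b c d => Cmod (rectangle_int h a b c d) <= 2 * eps * ((b - a) + (d - c)) ^ 2)); auto.
    - intros a' b' c' d' Ha Hb Hc' Hd' m n H1 H2 H3 H4.
      assert (Hm : a' <= m <= b') by (unfold m; lra). assert (Hn : c' <= n <= d') by (unfold n; lra).
      assert (Ch : forall v1 v2, c' <= v1 <= d' -> c' <= v2 <= d' -> ccont_on (fun u => h u v1 - h u v2)%C a' b').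
      { intros v1 v2 Hv1 Hv2 u Hu. apply ccont_minus; apply (cont2_ccont1 h); apply Hc; lra. }
      assert (Cv : forall u1 u2, a' <= u1 <= b' -> a' <= u2 <= b' -> ccont_on (fun v => h u1 v - h u2 v)%C c' d').
      { intros u1 u2 Hu1 Hu2 v Hv. apply ccont_minus; apply (cont2_ccont h); apply Hc; lra. }
      assert (E : rectangle_int h a' b' c' d' = ((rectangle_int h a' m c' n + rectangle_int h m b' c' n) + (rectangle_int h a' m n d' + rectangle_int h m b' n d'))%C).
      { unfold rectangle_int.
        rewrite (CInt_ext a' b') with (f := (fun u => h u c' - h u d')%C) (g := (fun u => (h u c' - h u n) + (h u n - h u d'))%C); [|lra|intros; ring].
        rewrite (CInt_ext c' d') with (f := (fun v => h b' v - h a' v)%C) (g := (fun v => (h b' v - h m v) + (h m v - h a' v))%C); [|lra|intros; ring].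
        rewrite !CInt_plus; try lra; try (apply Ch; lra); try (apply Cv; lra).
        rewrite <- (CInt_Chasles (fun u => h u c' - h u n)%C a' m b'), <- (CInt_Chasles (fun u => h u n - h u d')%C a' m b') by (auto; try apply Ch; lra).
        rewrite <- (CInt_Chasles (fun v => h b' v - h m v)%C c' n d'), <- (CInt_Chasles (fun v => h m v - h a' v)%C c' n d') by (auto; try apply Cv; lra).
        ring. }
      rewrite E. eapply Rle_trans. apply Cmod_triangle.
      assert (T1 := Cmod_triangle (rectangle_int h a' m c' n) (rectangle_int h m b' c' n)).
      assert (T2 := Cmod_triangle (rectangle_int h a' m n d') (rectangle_int h m b' n d')).
      unfold m in *; unfold n in *. nra.
    - intros x y Hx Hy. destruct (Hd x y Hx Hy) as [D HD].
      destruct (HD eps Heps) as [del [Hdel HD']]. exists del. split; auto.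
      intros a' b' c' d' Ha Hb Hc' Hd' Hw Hh.
      (* The remainder is at most eps times width plus height, and the perimeter supplies the second
         such factor, giving the square. *)
      eapply Rle_trans. apply (rectangle_int_small h a' b' c' d' x y D (eps * ((b' - a') + (d' - c')))); try lra.
      + intros u v Hu Hv. apply Hc; lra.
      + intros u v Hu Hv.
        assert (Rabs (u - x) <= b' - a') by (apply Rabs_le; lra).
        assert (Rabs (v - y) <= d' - c') by (apply Rabs_le; lra).
        eapply Rle_trans. apply HD'; lra. apply Rmult_le_compat_l; lra.
      + apply Req_le. ring. }
  apply Cmod_eq_0. apply Rle_antisym; [|apply Cmod_ge_0].
  apply le_epsilon. intros e He. rewrite Rplus_0_l.
  set (K := ((b - a) + (d - c)) ^ 2) in *. assert (HK : 0 <= K) by (unfold K; apply pow2_ge_0).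
  eapply Rle_trans. apply (Hsmall (e / (2 * (K + 1)))). apply Rdiv_lt_0_compat; lra.
  replace (2 * (e / (2 * (K + 1))) * K) with (e * (K / (K + 1))) by (field; lra).
  rewrite <- (Rmult_1_r e) at 2. apply Rmult_le_compat_l. lra. apply Rle_div_l; lra.
Qed.

(** * Circle integrals of holomorphic functions *)

Definition cis (t : R) : C := (cos t, sin t).

Lemma Cmod_cis t : Cmod (cis t) = 1.
Proof.
  unfold Cmod, cis. simpl. rewrite !Rmult_1_r.
  replace (cos t * cos t + sin t * sin t) with 1. apply sqrt_1.
  generalize (sin2_cos2 t). unfold Rsqr. lra.
Qed.
Lemma cis_plus s t : cis (s + t) = (cis s * cis t)%C.
Proof. unfold cis, Cmult. simpl. rewrite cos_plus, sin_plus. f_equal. ring. Qed.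
Lemma cis_period t : cis (t + 2 * PI) = cis t.
Proof. unfold cis. rewrite cos_plus, sin_plus, cos_2PI, sin_2PI. f_equal; ring. Qed.
Lemma cis_0 : cis 0 = 1%C.
Proof. unfold cis. now rewrite cos_0, sin_0. Qed.
Lemma cis_neq_0 t : cis t <> 0%C.
Proof. apply Cmod_gt_0. rewrite Cmod_cis. lra. Qed.
Lemma Cmod_polar r t : 0 <= r -> Cmod (RtoC r * cis t)%C = r.
Proof. intros H. rewrite Cmod_mult, Cmod_cis, Cmod_R, Rabs_pos_eq; lra. Qed.

Lemma ccont_cis {U : UniformSpace} (u : U -> R) x : continuous u x -> ccont (fun y => cis (u y)) x.
Proof.
  intros H. apply ccont_pair.
  - apply (continuous_comp u cos); auto. apply continuous_cos.
  - apply (continuous_comp u sin); auto. apply continuous_sin.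
Qed.

Lemma is_derive_eps (g : R -> R) (x l : R) : is_derive g x l -> forall eps, 0 < eps ->
  exists del, 0 < del /\ forall y, Rabs (y - x) < del -> Rabs (g y - g x - l * (y - x)) <= eps * Rabs (y - x).
Proof.
  intros [_ H] eps Heps.
  destruct (H x (fun P HP => HP) (mkposreal eps Heps)) as [del Hd].
  exists del. split. apply cond_pos. intros y Hy. specialize (Hd y Hy).
  replace (g y - g x - l * (y - x)) with (minus (minus (g y) (g x)) (scal (minus y x) l)).
  exact Hd. unfold minus, scal, plus, opp. simpl. unfold mult. simpl. ring.
Qed.

(** The map is exp(x + iy), its own derivative. The addition formulas factor out the base value,
    leaving the derivatives of exp, cos and sin at 0. *)
Lemma cdiff2_polar x y : cdiff2 (fun x y => RtoC (exp x) * cis y)%C x y (RtoC (exp x) * cis y)%C.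
Proof.
  intros eps Heps.
  set (K := Cmod (RtoC (exp x) * cis y)%C).
  assert (HK : 0 <= K) by apply Cmod_ge_0.
  (* With e <= 1 one gets |exp p - 1| <= 2|p| and exp p <= 3; the first-order errors then add up to
     at most 8 e (|p| + |q|), to be multiplied by [K]. *)
  set (e := Rmin 1 (eps / (8 * (K + 1)))).
  assert (He : 0 < e). { apply Rmin_pos. lra. apply Rdiv_lt_0_compat; lra. }
  assert (He1 : e <= 1) by apply Rmin_l.
  assert (He2 : 8 * e * K <= eps).
  { assert (e <= eps / (8 * (K + 1))) by apply Rmin_r.
    assert (e * (8 * (K + 1)) <= eps) by (apply Rle_div_r; lra). nra. }
  destruct (is_derive_eps exp 0 1) with (eps := e) as [d1 [D1 H1]]; auto.
  { generalize (is_derive_exp 0). now rewrite exp_0. }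
  destruct (is_derive_eps cos 0 0) with (eps := e) as [d2 [D2 H2]]; auto.
  { generalize (is_derive_cos 0). now rewrite sin_0, Ropp_0. }
  destruct (is_derive_eps sin 0 1) with (eps := e) as [d3 [D3 H3]]; auto.
  { generalize (is_derive_sin 0). now rewrite cos_0. }
  exists (Rmin (Rmin d1 e) (Rmin d2 d3)). split. { apply Rmin_pos; apply Rmin_pos; auto. }
  intros u v Hu Hv.
  set (p := u - x) in *. set (q := v - y) in *.
  assert (L1 := Rlt_le_trans _ _ _ Hu (Rmin_l _ _)).
  assert (L2 := Rlt_le_trans _ _ _ Hv (Rmin_r _ _)). clear Hu Hv.
  assert (U1 := Rlt_le_trans _ _ _ L1 (Rmin_l _ _)). assert (U2 := Rlt_le_trans _ _ _ L1 (Rmin_r _ _)).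
  assert (V1 := Rlt_le_trans _ _ _ L2 (Rmin_l _ _)). assert (V2 := Rlt_le_trans _ _ _ L2 (Rmin_r _ _)).
  specialize (H1 p). specialize (H2 q). specialize (H3 q).
  rewrite !Rminus_0_r in H1, H2, H3. rewrite exp_0, Rmult_1_l in H1. rewrite cos_0, Rmult_0_l, Rminus_0_r in H2.
  rewrite sin_0, Rmult_1_l, Rminus_0_r in H3.
  specialize (H1 U1). specialize (H2 V1). specialize (H3 V2).
  replace u with (x + p) by (unfold p; ring). replace v with (y + q) by (unfold q; ring).
  rewrite cis_plus, exp_plus, RtoC_mult.
  replace (RtoC (exp x) * RtoC (exp p) * (cis y * cis q) - RtoC (exp x) * cis y - RtoC (exp x) * cis y * (RtoC p + Ci * RtoC q))%C
    with ((RtoC (exp x) * cis y) * (RtoC (exp p) * cis q - 1 - (RtoC p + Ci * RtoC q)))%C by ring.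
  rewrite Cmod_mult. fold K.
  assert (Ep : Rabs (exp p - 1) <= 2 * Rabs p).
  { replace (exp p - 1) with ((exp p - 1 - p) + p) by ring. eapply Rle_trans. apply Rabs_triang.
    assert (0 <= Rabs p) by apply Rabs_pos. nra. }
  assert (Sq : Rabs (sin q) <= 2 * Rabs q).
  { replace (sin q) with ((sin q - q) + q) by ring. eapply Rle_trans. apply Rabs_triang.
    assert (0 <= Rabs q) by apply Rabs_pos. nra. }
  replace (RtoC (exp p) * cis q - 1 - (RtoC p + Ci * RtoC q))%C with
    (RtoC ((exp p - 1 - p) + exp p * (cos q - 1)) + Ci * RtoC ((exp p - 1) * sin q + (sin q - q)))%C.
  2:{ apply injective_projections; simpl; ring. }
  assert (Hp0 := Rabs_pos p). assert (Hq0 := Rabs_pos q).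
  assert (Hexp : 0 < exp p <= 3).
  { split. apply exp_pos. apply Rabs_le_between in Ep. nra. }
  assert (M : Cmod (RtoC ((exp p - 1 - p) + exp p * (cos q - 1)) + Ci * RtoC ((exp p - 1) * sin q + (sin q - q)))%C
     <= 8 * e * (Rabs p + Rabs q)).
  { eapply Rle_trans. apply Cmod_cartesian.
    assert (B1 : Rabs ((exp p - 1 - p) + exp p * (cos q - 1)) <= e * Rabs p + 3 * (e * Rabs q)).
    { eapply Rle_trans. apply Rabs_triang. rewrite Rabs_mult, (Rabs_pos_eq (exp p)) by lra.
      apply Rplus_le_compat; auto. apply Rmult_le_compat; try lra. apply Rabs_pos. }
    assert (B2 : Rabs ((exp p - 1) * sin q + (sin q - q)) <= (2 * e) * (2 * Rabs q) + e * Rabs q).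
    { eapply Rle_trans. apply Rabs_triang. rewrite Rabs_mult.
      apply Rplus_le_compat; auto. apply Rmult_le_compat; try apply Rabs_pos; lra. }
    nra. }
  apply Rle_trans with (K * (8 * e * (Rabs p + Rabs q))).
  - apply Rmult_le_compat_l; auto.
  - replace (K * (8 * e * (Rabs p + Rabs q))) with (8 * e * K * (Rabs p + Rabs q)) by ring.
    apply Rmult_le_compat_r; lra.
Qed.

Lemma cdiff2_comp f h x y D d : cdiff2 h x y D -> cderiv f (h x y) d -> cdiff2 (fun u v => f (h u v)) x y (d * D)%C.
Proof.
  intros Hh Hf eps Heps.
  assert (Hcont := cdiff2_cont2 h x y D Hh).
  assert (HD := Cmod_ge_0 D). assert (Hd := Cmod_ge_0 d).
  (* The error splits into that of [f], at most e2 times the increment of [h], and |d| times that of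
     [h]. The cap at 1 bounds the increment by (|D| + 1) s; each half is then at most eps/2 times
     s. *)
  set (e1 := Rmin 1 (eps / (2 * (Cmod d + 1)))).
  assert (He1 : 0 < e1). { apply Rmin_pos. lra. apply Rdiv_lt_0_compat; lra. }
  assert (He11 : e1 <= 1) by apply Rmin_l.
  assert (He12 : Cmod d * e1 <= eps / 2).
  { assert (e1 <= eps / (2 * (Cmod d + 1))) by apply Rmin_r.
    assert (e1 * (2 * (Cmod d + 1)) <= eps) by (apply Rle_div_r; lra). nra. }
  set (e2 := eps / (2 * (Cmod D + 1))).
  assert (He2 : 0 < e2) by (apply Rdiv_lt_0_compat; lra).
  destruct (Hh e1 He1) as [d1 [D1 H1]].
  destruct (proj1 (cderiv_eps f (h x y) d) Hf (mkposreal e2 He2)) as [d2 H2].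
  destruct (Hcont d2 (cond_pos d2)) as [d3 [D3 H3]].
  exists (Rmin d1 d3). split. now apply Rmin_pos.
  intros u v Hu Hv.
  assert (U1 := Rlt_le_trans _ _ _ Hu (Rmin_l _ _)). assert (U2 := Rlt_le_trans _ _ _ Hu (Rmin_r _ _)).
  assert (V1 := Rlt_le_trans _ _ _ Hv (Rmin_l _ _)). assert (V2 := Rlt_le_trans _ _ _ Hv (Rmin_r _ _)).
  specialize (H1 u v U1 V1). specialize (H3 u v U2 V2). specialize (H2 _ H3). simpl in H2.
  set (s := Rabs (u - x) + Rabs (v - y)) in *.
  assert (Hs : 0 <= s). { assert (A1 := Rabs_pos (u - x)). assert (A2 := Rabs_pos (v - y)). unfold s. lra. }
  set (q := (RtoC (u - x) + Ci * RtoC (v - y))%C) in *.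
  assert (Hq : Cmod q <= s) by apply Cmod_cartesian.
  assert (Hdh : Cmod (h u v - h x y)%C <= (Cmod D + 1) * s).
  { replace (h u v - h x y)%C with ((h u v - h x y - D * q) + D * q)%C by ring.
    eapply Rle_trans. apply Cmod_triangle. rewrite Cmod_mult.
    assert (Cmod D * Cmod q <= Cmod D * s) by (apply Rmult_le_compat_l; auto). nra. }
  replace (f (h u v) - f (h x y) - d * D * q)%C with
   ((f (h u v) - f (h x y) - d * (h u v - h x y)) + d * (h u v - h x y - D * q))%C by ring.
  eapply Rle_trans. apply Cmod_triangle. rewrite Cmod_mult.
  assert (T1 : e2 * Cmod (h u v - h x y)%C <= eps / 2 * s).
  { apply Rle_trans with (e2 * ((Cmod D + 1) * s)). apply Rmult_le_compat_l; lra.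
    apply Req_le. unfold e2. field. lra. }
  assert (T2 : Cmod d * Cmod (h u v - h x y - D * q)%C <= eps / 2 * s).
  { apply Rle_trans with (Cmod d * (e1 * s)). apply Rmult_le_compat_l; lra. nra. }
  lra.
Qed.

Lemma cont2_of_prod (F : R -> R -> C) x y :
  ccont (fun p : R * R => F (fst p) (snd p)) (x, y) -> cont2 F x y.
Proof.
  intros H eps Heps. destruct (proj1 (ccont_eps _ _) H (mkposreal eps Heps)) as [d Hd].
  exists d. split. apply cond_pos. intros u v Hu Hv. apply (Hd (u, v)). now split.
Qed.
Lemma ccont_polar {U : UniformSpace} (u v : U -> R) x : continuous u x -> continuous v x ->
  ccont (fun y => RtoC (u y) * cis (v y))%C x.
Proof. intros Hu Hv. apply ccont_mult. now apply ccont_RtoC. now apply ccont_cis. Qed.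

(** Integral in the angle, not in [dz], and not normalized. *)
Definition circle_int (f : C -> C) (r : R) : C := CInt (fun t => f (RtoC r * cis t)%C) 0 (2 * PI).

Lemma ccontC_const (c z : C) : ccontC (fun _ : C => c) z.
Proof. exact (@continuous_const CU CU c z). Qed.
Lemma ccontC_id (z : C) : ccontC (fun w : C => w) z.
Proof. exact (@continuous_id CU z). Qed.

Lemma ccontC_minus (f g : C -> C) (z : C) : ccontC f z -> ccontC g z -> ccontC (fun w => f w - g w)%C z.
Proof. exact (@ccont_minus CU f g z). Qed.
Lemma ccontC_mult (f g : C -> C) (z : C) : ccontC f z -> ccontC g z -> ccontC (fun w => f w * g w)%C z.
Proof. exact (@ccont_mult CU f g z). Qed.

Lemma cont2_polar f r t : ccontC f (RtoC r * cis t)%C -> cont2 (fun r t => f (RtoC r * cis t)%C) r t.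
Proof.
  intros H. apply (cont2_of_prod (fun r t => f (RtoC r * cis t)%C)).
  apply (ccont_comp f (fun p : R * R => RtoC (fst p) * cis (snd p))%C).
  - apply ccont_polar. apply continuous_fst. apply continuous_snd.
  - exact H.
Qed.
Lemma ccont_on_circle f r : 0 <= r -> (forall z, Cmod z = r -> ccontC f z) ->
  forall t, ccont (fun t => f (RtoC r * cis t)%C) t.
Proof.
  intros Hr H t. apply (cont2_ccont (fun r t => f (RtoC r * cis t)%C)). apply cont2_polar, H.
  now apply Cmod_polar.
Qed.

Lemma twoPI_pos : 0 < 2 * PI.
Proof. assert (H := PI_RGT_0). lra. Qed.

Lemma circle_int_continuous f r del : 0 <= r -> 0 < del -> (forall z, Rabs (Cmod z - r) < del -> ccontC f z) ->
  ccont (circle_int f) r.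
Proof.
  intros Hr Hd H. assert (HPI := twoPI_pos).
  apply (CInt_param_cont (fun r t => f (RtoC r * cis t)%C)). lra.
  exists del. split; auto. intros x' Hx' y Hy. apply cont2_polar, H.
  rewrite Cmod_mult, Cmod_cis, Cmod_R, Rmult_1_r.
  rewrite <- (Rabs_pos_eq r Hr) at 1. eapply Rle_lt_trans. apply Rabs_triang_inv2. exact Hx'.
Qed.

(** In logarithmic coordinates the annulus is a strip, and by periodicity the
    two horizontal sides of the rectangle of height [2 pi] cancel. *)
Lemma circle_int_annulus (f : C -> C) a b : 0 <= a ->
  (forall z, a < Cmod z < b -> exists d, cderiv f z d) ->
  forall r s, a < r -> r <= s -> s < b -> circle_int f r = circle_int f s.
Proof.
  intros Ha Hf r s Hr Hrs Hs. assert (HPI := twoPI_pos).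
  set (h := fun x y => f (RtoC (exp x) * cis y)%C).
  assert (Hln : ln r <= ln s) by (apply ln_le; lra).
  assert (Hdiff : forall x y, ln r <= x <= ln s -> exists D, cdiff2 h x y D).
  { intros x y Hx. destruct (Hf (RtoC (exp x) * cis y)%C) as [d Hd].
    - rewrite Cmod_polar by (apply Rlt_le, exp_pos).
      split. apply Rlt_le_trans with r; auto. rewrite <- (exp_ln r) by lra.
      destruct (Rle_lt_or_eq_dec (ln r) x) as [Hlt| ->]; try lra. now apply Rlt_le, exp_increasing.
      apply Rle_lt_trans with s; auto. rewrite <- (exp_ln s) by lra.
      destruct (Rle_lt_or_eq_dec x (ln s)) as [Hlt| ->]; try lra. now apply Rlt_le, exp_increasing.
    - exists (d * (RtoC (exp x) * cis y))%C.
      apply (cdiff2_comp f (fun x y => RtoC (exp x) * cis y)%C); auto. apply cdiff2_polar. }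
  assert (HG : rectangle_int h (ln r) (ln s) 0 (2 * PI) = 0%C).
  { apply goursat; auto; lra. }
  assert (Hcont : forall x, ln r <= x <= ln s -> ccont_on (h x) 0 (2 * PI)).
  { intros x Hx y Hy. apply (cont2_ccont h). destruct (Hdiff x y Hx) as [D HD]. now apply cdiff2_cont2 with D. }
  unfold rectangle_int in HG.
  rewrite (CInt_ext (ln r) (ln s) Hln _ (fun _ => 0%C)) in HG.
  2:{ intros x Hx. unfold h. rewrite <- (cis_period 0), Rplus_0_l. ring. }
  rewrite CInt_const in HG.
  rewrite CInt_minus in HG; [|lra| |]; try (apply Hcont; lra).
  assert (Er : CInt (h (ln r)) 0 (2 * PI) = circle_int f r).
  { unfold h, circle_int. now rewrite exp_ln by lra. }
  assert (Es : CInt (h (ln s)) 0 (2 * PI) = circle_int f s).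
  { unfold h, circle_int. now rewrite exp_ln by lra. }
  change (CInt (fun v => h (ln s) v)) with (CInt (h (ln s))) in HG.
  change (CInt (fun v => h (ln r) v)) with (CInt (h (ln r))) in HG.
  rewrite Er, Es in HG.
  assert (Z : (circle_int f s - circle_int f r)%C = 0%C).
  { replace (circle_int f s - circle_int f r)%C with (- Ci * (RtoC (ln s - ln r) * 0 + Ci * (circle_int f s - circle_int f r)))%C.
    rewrite HG. ring. replace (- Ci * (RtoC (ln s - ln r) * 0 + Ci * (circle_int f s - circle_int f r)))%C with (- (Ci * Ci) * (circle_int f s - circle_int f r))%C by ring.
    replace (Ci * Ci)%C with (- (1))%C. ring. apply injective_projections; simpl; ring. }
  replace (circle_int f s) with (circle_int f s - circle_int f r + circle_int f r)%C by ring. rewrite Z. ring.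
Qed.

(** Carries the constancy of circle integrals, known on open ranges of radii, to the end of the
    range: to radius 0 and to the radius of a singularity. *)
Lemma limit_right_const (phi : R -> C) x0 k del : 0 < del -> ccont phi x0 ->
  (forall x, x0 < x < x0 + del -> phi x = k) -> phi x0 = k.
Proof.
  intros Hd Hc Hk. apply NNPP. intros Hn.
  assert (Hp : 0 < Cmod (k - phi x0)%C).
  { apply Cmod_gt_0. intros E. apply Hn. replace k with (k - phi x0 + phi x0)%C by ring. rewrite E. ring. }
  destruct (proj1 (ccont_eps _ _) Hc (mkposreal _ Hp)) as [e He].
  assert (Hm := Rmin_pos _ _ Hd (cond_pos e)).
  specialize (He (x0 + Rmin del e / 2)).
  assert (L1 := Rmin_l del e). assert (L2 := Rmin_r del e).
  rewrite Hk in He by lra. simpl in He. apply (Rlt_irrefl (Cmod (k - phi x0)%C)), He.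
  change (Rabs (x0 + Rmin del e / 2 - x0) < e).
  replace (x0 + Rmin del e / 2 - x0) with (Rmin del e / 2) by ring. rewrite Rabs_pos_eq; lra.
Qed.
Lemma limit_left_const (phi : R -> C) x0 k del : 0 < del -> ccont phi x0 ->
  (forall x, x0 - del < x < x0 -> phi x = k) -> phi x0 = k.
Proof.
  intros Hd Hc Hk.
  rewrite <- (Ropp_involutive x0).
  apply (limit_right_const (fun x => phi (- x)) (- x0) k del Hd).
  - apply (@continuous_comp R_UniformSpace R_UniformSpace CU Ropp phi).
    + apply (continuous_opp (V := R_NormedModule) (fun x => x)). apply continuous_id.
    + now rewrite Ropp_involutive.
  - intros x Hx. apply Hk. lra.
Qed.

Lemma circle_int_0 (f : C -> C) : circle_int f 0 = (RtoC (2 * PI) * f 0)%C.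
Proof.
  assert (HPI := twoPI_pos). unfold circle_int.
  rewrite (CInt_ext 0 (2 * PI)) with (g := fun _ => f 0%C); [|lra|].
  - now rewrite CInt_const, Rminus_0_r.
  - intros x _. now rewrite Cmult_0_l.
Qed.

(** The annulus argument needs positive radii because of the logarithm; continuity in the radius
    then reaches 0, where the integrand is constant. *)
Lemma mean_value (f : C -> C) b : holomorphic_in f b ->
  forall r, 0 <= r < b -> circle_int f r = (RtoC (2 * PI) * f 0)%C.
Proof.
  intros Hf r Hr. rewrite <- circle_int_0.
  destruct (Req_dec r 0) as [->|Hr0]; [reflexivity|]. symmetry.
  apply (limit_right_const (circle_int f) 0 (circle_int f r) r); [lra| |].
  - apply circle_int_continuous with r; try lra. intros z Hz. destruct (Hf z) as [d Hd].
    + rewrite Rminus_0_r, Rabs_pos_eq in Hz by apply Cmod_ge_0. lra.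
    + now apply cderiv_cont with d.
  - intros x Hx. apply circle_int_annulus with (a := 0) (b := b); try lra. intros z Hz. apply Hf. lra.
Qed.

Lemma Cminus_neq (z w : C) : z <> w -> (z - w)%C <> 0%C.
Proof. intros H E. apply H. replace z with (z - w + w)%C by ring. rewrite E. ring. Qed.
Lemma Cmod_neq (z w : C) : Cmod z <> Cmod w -> z <> w.
Proof. intros H E. now rewrite E in H. Qed.

(** Since dz = i z dt on a circle about 0, z / (z - w) is the Cauchy kernel with respect to the
    angle. *)
Lemma cderiv_kernel (w z : C) : z <> w -> exists d, cderiv (fun z => z / (z - w))%C z d.
Proof.
  intros H. eexists. apply cderiv_div.
  - apply cderiv_id.
  - apply cderiv_minus. apply cderiv_id. apply cderiv_const.
  - now apply Cminus_neq.
Qed.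

Lemma circle_int_ext (f g : C -> C) r : 0 <= r -> (forall z, Cmod z = r -> f z = g z) -> circle_int f r = circle_int g r.
Proof.
  intros Hr H. unfold circle_int. apply CInt_ext. generalize twoPI_pos; lra. intros t _. apply H. now apply Cmod_polar.
Qed.
Lemma circle_ccont_on (f : C -> C) r a b : 0 <= r -> (forall z, Cmod z = r -> ccontC f z) ->
  ccont_on (fun t => f (RtoC r * cis t)%C) a b.
Proof. intros Hr H t _. now apply ccont_on_circle. Qed.
Lemma circle_int_minus (f g : C -> C) r : 0 <= r -> (forall z, Cmod z = r -> ccontC f z) ->
  (forall z, Cmod z = r -> ccontC g z) -> circle_int (fun z => f z - g z)%C r = (circle_int f r - circle_int g r)%C.
Proof.
  intros Hr Hf Hg. assert (HPI := twoPI_pos).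
  unfold circle_int. rewrite <- CInt_minus; try (now apply circle_ccont_on). reflexivity. lra.
Qed.
Lemma circle_int_plus (f g : C -> C) r : 0 <= r -> (forall z, Cmod z = r -> ccontC f z) ->
  (forall z, Cmod z = r -> ccontC g z) -> circle_int (fun z => f z + g z)%C r = (circle_int f r + circle_int g r)%C.
Proof.
  intros Hr Hf Hg. assert (HPI := twoPI_pos).
  unfold circle_int. rewrite <- CInt_plus; try (now apply circle_ccont_on). reflexivity. lra.
Qed.
Lemma circle_int_mult (c : C) (f : C -> C) r : 0 <= r -> (forall z, Cmod z = r -> ccontC f z) ->
  circle_int (fun z => c * f z)%C r = (c * circle_int f r)%C.
Proof.
  intros Hr Hf. assert (HPI := twoPI_pos).
  unfold circle_int. rewrite <- CInt_mult; try (now apply circle_ccont_on). reflexivity. lra.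
Qed.
Lemma circle_int_const (c : C) r : circle_int (fun _ => c) r = (RtoC (2 * PI) * c)%C.
Proof. unfold circle_int. now rewrite CInt_const, Rminus_0_r. Qed.
Lemma circle_int_bound (f : C -> C) r M : 0 <= r -> (forall z, Cmod z = r -> ccontC f z) ->
  (forall z, Cmod z = r -> Cmod (f z) <= M) -> Cmod (circle_int f r) <= 2 * PI * M.
Proof.
  intros Hr Hf HM. assert (HPI := twoPI_pos).
  unfold circle_int. rewrite <- (Rminus_0_r (2 * PI)) at 2. apply CInt_bound. lra. now apply circle_ccont_on.
  intros t _. apply HM. now apply Cmod_polar.
Qed.

Lemma Cmod_le_0 (z : C) : (forall eps, 0 < eps -> Cmod z <= eps) -> z = 0%C.
Proof.
  intros H. apply Cmod_eq_0, Rle_antisym; [|apply Cmod_ge_0].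
  apply le_epsilon. intros e He. rewrite Rplus_0_l. now apply H.
Qed.

(** The integral does not depend on the radius beyond |w|, and on large circles the kernel differs
    from 1 by w / (z - w), which tends to 0. *)
Lemma circle_int_kernel (w : C) r : Cmod w < r -> circle_int (fun z => z / (z - w))%C r = RtoC (2 * PI).
Proof.
  intros Hw. assert (HPI := twoPI_pos). assert (Hw0 := Cmod_ge_0 w).
  assert (Hne : forall z, Cmod w < Cmod z -> z <> w) by (intros z Hz; apply Cmod_neq; lra).
  replace (circle_int (fun z => z / (z - w))%C r) with (circle_int (fun z => z / (z - w))%C r - RtoC (2 * PI) * 1 + RtoC (2 * PI))%C by ring.
  replace (circle_int (fun z => z / (z - w))%C r - RtoC (2 * PI) * 1)%C with (RtoC 0). ring.
  symmetry. apply Cmod_le_0. intros eps Heps.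
  (* Large enough for 2 pi |w| / (s - |w|) <= eps. *)
  set (s := r + 2 * PI * Cmod w / eps).
  assert (Hs : r <= s). { unfold s. assert (0 <= 2 * PI * Cmod w / eps) by (apply Rdiv_le_0_compat; nra). lra. }
  rewrite (circle_int_annulus (fun z => z / (z - w))%C (Cmod w) (s + 1) Hw0) with (s := s); try lra.
  2:{ intros z Hz. apply cderiv_kernel, Hne. lra. }
  assert (Hc : forall z, Cmod z = s -> ccontC (fun z => z / (z - w))%C z).
  { intros z Hz. destruct (cderiv_kernel w z) as [d Hd]. apply Hne; lra. now apply cderiv_cont with d. }
  rewrite <- (circle_int_const 1 s), <- circle_int_minus; auto; try lra.
  2:{ intros z _. apply ccontC_const. }
  eapply Rle_trans. apply circle_int_bound with (M := Cmod w / (s - Cmod w)). lra.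
  { intros z Hz. apply ccontC_minus. now apply Hc. apply ccontC_const. }
  { intros z Hz. assert (z <> w) by (apply Hne; lra).
    replace (z / (z - w) - 1)%C with (w / (z - w))%C by (field; now apply Cminus_neq).
    rewrite Cmod_div by now apply Cminus_neq. apply Rmult_le_compat_l; auto.
    apply Rinv_le_contravar. lra. rewrite <- Hz. apply Cmod_triangle_rev. }
  replace (2 * PI * (Cmod w / (s - Cmod w))) with (2 * PI * Cmod w / (s - Cmod w)) by (field; lra).
  apply Rle_div_l. lra. unfold s.
  replace (eps * (r + 2 * PI * Cmod w / eps - Cmod w)) with (eps * (r - Cmod w) + 2 * PI * Cmod w) by (field; lra).
  nra.
Qed.

(** [z (f z - f w) / (z - w)] is differentiable off the circle of radius [|w|] and
    continuous across it, so its circle integrals all equal the one at radius 0. *)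
Lemma cauchy_formula (f : C -> C) b r w : holomorphic_in f b ->
  Cmod w < r < b -> circle_int (fun z => f z * (z / (z - w)))%C r = (RtoC (2 * PI) * f w)%C.
Proof.
  intros Hf Hw. assert (HPI := twoPI_pos). assert (Hw0 := Cmod_ge_0 w).
  assert (Hfc := holomorphic_in_continuous f b Hf).
  (* The main argument approaches the radius |w| from both sides, which requires |w| > 0; for w = 0
     the kernel is 1 and the mean value property is the claim. *)
  destruct (Ceq_dec w 0) as [->|Hnz].
  { rewrite <- (mean_value f b Hf r) by lra. apply circle_int_ext; [lra|]. intros z Hz.
    rewrite Cmod_0 in Hw. assert (z <> 0%C) by (apply Cmod_gt_0; lra).
    replace (z - 0)%C with z by ring. field. auto. }
  assert (Hwp := proj1 (Cmod_gt_0 w) Hnz).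
  destruct (Hf w) as [dw Hdw]; [lra|].
  (* The difference quotient with its removable singularity filled in by the derivative. The factor
     [z] in [g] makes g 0 = 0 and matches the kernel in the angle. *)
  set (q := fun z => if Ceq_dec z w then dw else ((f z - f w) / (z - w))%C).
  set (g := fun z => (z * q z)%C).
  assert (Hqw : ccontC q w).
  { apply ccont_eps. intros eps.
    destruct (proj1 (cderiv_eps f w dw) Hdw (pos_div_2 eps)) as [del Hdel].
    exists del. intros z Hz. unfold q. destruct (Ceq_dec w w) as [_|n]; [|now elim n].
    assert (He := cond_pos eps).
    destruct (Ceq_dec z w) as [->|Hzw].
    - replace (dw - dw)%C with (RtoC 0) by ring. rewrite Cmod_0. exact He.
    - specialize (Hdel z Hz). assert (Hn := Cminus_neq z w Hzw).
      replace ((f z - f w) / (z - w) - dw)%C with ((f z - f w - dw * (z - w)) / (z - w))%C by (field; auto).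
      rewrite Cmod_div by auto. assert (Hnp := proj1 (Cmod_gt_0 _) Hn).
      apply Rle_lt_trans with (eps / 2); [|lra]. apply Rle_div_l; [lra|]. exact Hdel. }
  assert (Hgw : ccontC g w) by (apply ccontC_mult; [apply ccontC_id|exact Hqw]).
  assert (Hgd : forall z, Cmod z < b -> z <> w -> exists d, cderiv g z d).
  { intros z Hz Hzw. destruct (Hf z Hz) as [d Hd].
    eexists. apply cderiv_ext_loc with (f := (fun z => z * ((f z - f w) / (z - w)))%C).
    - exists (mkposreal _ (proj1 (Cmod_gt_0 _) (Cminus_neq z w Hzw))). intros v Hv. simpl in Hv.
      unfold g, q. destruct (Ceq_dec v w) as [->|]; [|reflexivity].
      rewrite Cmod_minus_sym in Hv. lra.
    - apply cderiv_mult. apply cderiv_id. apply cderiv_div.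
      + apply cderiv_minus. exact Hd. apply cderiv_const.
      + apply cderiv_minus. apply cderiv_id. apply cderiv_const.
      + now apply Cminus_neq. }
  assert (Hgc : forall z, Cmod z < b -> ccontC g z).
  { intros z Hz. destruct (Ceq_dec z w) as [->|Hzw]; auto.
    destruct (Hgd z Hz Hzw) as [d Hd]. now apply cderiv_cont with d. }
  assert (Hcirc : ccont (circle_int g) (Cmod w)).
  { apply circle_int_continuous with (b - Cmod w); try lra. intros z Hz. apply Hgc.
    apply Rabs_def2 in Hz. lra. }
  (* From inside, the mean value property gives 2 pi g(0) = 0; from outside, the annulus gives the
     integral at [r]. Continuity at the radius |w| joins the two. *)
  assert (E1 : circle_int g (Cmod w) = 0%C).
  { apply (limit_left_const (circle_int g) (Cmod w) 0%C (Cmod w)); auto. intros x Hx.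
    rewrite (mean_value g (Cmod w)); try lra.
    - unfold g. ring.
    - intros z Hz. apply Hgd. lra. apply Cmod_neq. lra. }
  assert (E2 : circle_int g (Cmod w) = circle_int g r).
  { apply (limit_right_const (circle_int g) (Cmod w) _ (r - Cmod w)); auto; [lra|]. intros x Hx.
    apply circle_int_annulus with (Cmod w) b; try lra. intros z Hz. apply Hgd. lra. apply Cmod_neq. lra. }
  rewrite E1 in E2.
  assert (Hkc : forall z, Cmod z = r -> ccontC (fun z => z / (z - w))%C z).
  { intros z Hz. destruct (cderiv_kernel w z) as [d Hd]. apply Cmod_neq; lra. now apply cderiv_cont with d. }
  assert (Hfk : forall z, Cmod z = r -> ccontC (fun z => f z * (z / (z - w)))%C z).
  { intros z Hz. apply ccontC_mult; [apply Hfc; lra|now apply Hkc]. }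
  rewrite (circle_int_ext g (fun z => f z * (z / (z - w)) - f w * (z / (z - w)))%C) in E2; [|lra|].
  - rewrite circle_int_minus, circle_int_mult, circle_int_kernel in E2; auto; try lra.
    + symmetry in E2. replace (circle_int (fun z : C => f z * (z / (z - w)))%C r) with
       (circle_int (fun z : C => f z * (z / (z - w)))%C r - f w * RtoC (2 * PI) + f w * RtoC (2 * PI))%C by ring.
      rewrite E2. ring.
    + intros z Hz. apply ccontC_mult; [apply ccontC_const|now apply Hkc].
  - intros z Hz. unfold g, q. assert (z <> w) by (apply Cmod_neq; lra).
    destruct (Ceq_dec z w) as [|_]; [contradiction|]. field. now apply Cminus_neq.
Qed.

(** * Regularity of the derivative and the identity principle *)

(** Differentiation under the integral sign from a quadratic remainder bound uniform in the
    parameter, which the Cauchy kernels satisfy by explicit algebra. *)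
Lemma cderiv_CInt (G : C -> R -> C) (G' : R -> C) (w : C) (a b c M : R) : a <= b -> 0 < c -> 0 <= M ->
  (forall v, Cmod (v - w)%C < c -> ccont_on (G v) a b) -> ccont_on G' a b ->
  (forall v t, Cmod (v - w)%C < c -> a <= t <= b ->
     Cmod (G v t - G w t - G' t * (v - w))%C <= M * Cmod (v - w)%C ^ 2) ->
  cderiv (fun v => CInt (G v) a b) w (CInt G' a b).
Proof.
  intros Hab Hc HM HG HG' HB. apply cderiv_eps. intros eps.
  assert (Hp : 0 < Rmin c (eps / ((b - a) * M + 1))).
  { apply Rmin_pos; auto. apply Rdiv_lt_0_compat. apply cond_pos. assert (0 <= (b - a) * M) by (apply Rmult_le_pos; lra). lra. }
  exists (mkposreal _ Hp). intros v Hv. change (Cmod (v - w)%C < Rmin c (eps / ((b - a) * M + 1))) in Hv.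
  assert (H1 := Rlt_le_trans _ _ _ Hv (Rmin_l _ _)).
  assert (H2 := Rlt_le_trans _ _ _ Hv (Rmin_r _ _)).
  assert (Hw : Cmod (w - w)%C < c). { replace (w - w)%C with (RtoC 0) by ring. now rewrite Cmod_0. }
  assert (Hq : 0 <= (b - a) * M) by (apply Rmult_le_pos; lra).
  assert (Hv0 := Cmod_ge_0 (v - w)%C).
  replace (CInt (G v) a b - CInt (G w) a b - CInt G' a b * (v - w))%C with
    (CInt (fun t => G v t - G w t - (v - w) * G' t)%C a b).
  - eapply Rle_trans. apply CInt_bound with (M := M * Cmod (v - w)%C ^ 2); auto.
    + intros t Ht. apply ccont_minus; [apply ccont_minus|apply ccont_mult].
      now apply HG. now apply HG. apply ccont_const. now apply HG'.
    + intros t Ht. rewrite (Cmult_comm (v - w) (G' t)). now apply HB.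
    + replace ((b - a) * (M * Cmod (v - w)%C ^ 2)) with (((b - a) * M) * Cmod (v - w)%C * Cmod (v - w)%C) by ring.
      apply Rmult_le_compat_r; auto.
      assert (Cmod (v - w)%C * ((b - a) * M + 1) <= eps) by (apply Rle_div_r; lra). nra.
  - rewrite CInt_minus, CInt_minus, CInt_mult; auto; try ring.
    + intros t Ht. apply ccont_minus. now apply HG. now apply HG.
    + intros t Ht. apply ccont_mult. apply ccont_const. now apply HG'.
Qed.

Lemma continuity_pt_of_continuous (f : R -> R) x : continuous f x -> continuity_pt f x.
Proof. apply continuity_pt_filterlim. Qed.

Lemma cont_bounded (f : R -> C) a b : a <= b -> ccont_on f a b -> exists M, 0 < M /\ forall t, a <= t <= b -> Cmod (f t) <= M.
Proof.
  intros Hab Hf. destruct (continuity_ab_maj (fun t => Cmod (f t)) a b Hab) as [m [Hm Hmab]].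
  - intros t Ht. apply continuity_pt_of_continuous. now apply ccont_on_Cmod with a b.
  - exists (Cmod (f m) + 1). split. assert (H := Cmod_ge_0 (f m)). lra.
    intros t Ht. specialize (Hm t Ht). simpl in Hm. lra.
Qed.

Section CauchyTransform.
Variables (phi : R -> C) (r : R).
Hypothesis Hphi : forall t, ccont phi t.

(** For a suitable density the exponents 1 and 2 give [f] and its derivative, and twice the
    transform with exponent 3 gives the second derivative. *)
Definition cauchy_transform (k : nat) (w : C) : C :=
  CInt (fun t => phi t * Cpow (/ (RtoC r * cis t - w)) k)%C 0 (2 * PI).

Lemma cauchy_point (w : C) t : Cmod w < r ->
  (RtoC r * cis t - w)%C <> 0%C /\ Cmod (/ (RtoC r * cis t - w))%C <= / (r - Cmod w).
Proof.
  intros Hw. assert (H0 := Cmod_ge_0 w).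
  assert (E : r - Cmod w <= Cmod (RtoC r * cis t - w)%C).
  { eapply Rle_trans. 2: apply Cmod_triangle_rev. rewrite Cmod_polar; lra. }
  assert (N : (RtoC r * cis t - w)%C <> 0%C) by (apply Cmod_gt_0; lra).
  split; auto. rewrite Cmod_inv by auto. apply Rinv_le_contravar; lra.
Qed.

Lemma ccont_cauchy_inv (w : C) t : Cmod w < r -> ccont (fun t => / (RtoC r * cis t - w))%C t.
Proof.
  intros Hw. apply (ccont_comp Cinv (fun t => RtoC r * cis t - w)%C).
  - apply ccont_minus; [|apply ccont_const]. apply ccont_mult. apply ccont_const.
    apply ccont_cis. apply continuous_id.
  - apply cderiv_cont with (- / ((RtoC r * cis t - w) * (RtoC r * cis t - w)))%C.
    apply cderiv_inv. now apply cauchy_point.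
Qed.
Lemma ccont_cauchy_kernel (w : C) k t : Cmod w < r ->
  ccont (fun t => phi t * Cpow (/ (RtoC r * cis t - w)) k)%C t.
Proof.
  intros Hw. apply ccont_mult; auto.
  induction k; simpl. apply ccont_const. apply ccont_mult; auto. now apply ccont_cauchy_inv.
Qed.

Lemma near_in_disk (w v : C) c : c <= (r - Cmod w) / 2 -> Cmod (v - w)%C < c ->
  Cmod v < r /\ / (r - Cmod v) <= 2 / (r - Cmod w) /\ / (r - Cmod w) <= 2 / (r - Cmod w).
Proof.
  intros Hc Hv. assert (T := Cmod_triangle (v - w) w). assert (H0 := Cmod_ge_0 (v - w)%C).
  replace (v - w + w)%C with v in T by ring.
  assert (Hd : 0 < r - Cmod w) by lra.
  split; [lra|]. split.
  - replace (2 / (r - Cmod w)) with (/ ((r - Cmod w) / 2)) by (field; lra). apply Rinv_le_contravar; lra.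
  - replace (2 / (r - Cmod w)) with (/ ((r - Cmod w) / 2)) by (field; lra). apply Rinv_le_contravar; lra.
Qed.

(** With x on the circle, 1/(x - v) - 1/(x - w) - (v - w)/(x - w)^2 equals (v - w)^2 / ((x - v)(x -
    w)^2), and each inverse is at most [D] when v is within half the distance of w from the
    circle. *)
Lemma cderiv_cauchy_transform_1 (w : C) : Cmod w < r ->
  cderiv (cauchy_transform 1) w (cauchy_transform 2 w).
Proof.
  intros Hw. assert (HPI := twoPI_pos).
  destruct (cont_bounded phi 0 (2 * PI)) as [M [HM HMb]]; [lra|intros t _; apply Hphi|].
  assert (Hr : 0 < r - Cmod w) by lra.
  set (D := 2 / (r - Cmod w)). assert (HD : 0 < D) by (apply Rdiv_lt_0_compat; lra).
  apply (cderiv_CInt (fun w t => phi t * Cpow (/ (RtoC r * cis t - w)) 1)%C _ w 0 (2 * PI) ((r - Cmod w) / 2) (M * D ^ 3)); try lra.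
  - assert (0 < D ^ 3) by now apply pow_lt. nra.
  - intros v Hv t _. apply ccont_cauchy_kernel. apply (near_in_disk w v ((r - Cmod w) / 2)); lra.
  - intros t _. now apply ccont_cauchy_kernel.
  - intros v t Hv Ht. destruct (near_in_disk w v ((r - Cmod w) / 2)) as (Hvr & B1 & B2); [lra|lra|].
    destruct (cauchy_point v t Hvr) as [N1 C1]. destruct (cauchy_point w t Hw) as [N2 C2].
    assert (Hu := Rle_trans _ _ _ C1 B1). assert (Hv' := Rle_trans _ _ _ C2 B2). fold D in Hu, Hv'.
    replace (phi t * Cpow (/ (RtoC r * cis t - v)) 1 - phi t * Cpow (/ (RtoC r * cis t - w)) 1 - phi t * Cpow (/ (RtoC r * cis t - w)) 2 * (v - w))%C
      with (phi t * ((v - w) * (v - w)) * (/ (RtoC r * cis t - v) * (/ (RtoC r * cis t - w) * / (RtoC r * cis t - w))))%C.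
    2:{ simpl. field. auto. }
    rewrite !Cmod_mult.
    assert (G1 := Cmod_ge_0 (/ (RtoC r * cis t - v))%C). assert (G2 := Cmod_ge_0 (/ (RtoC r * cis t - w))%C).
    set (U := Cmod (/ (RtoC r * cis t - v))%C) in *. set (V := Cmod (/ (RtoC r * cis t - w))%C) in *.
    replace (M * D ^ 3 * Cmod (v - w)%C ^ 2) with (M * (Cmod (v - w)%C * Cmod (v - w)%C) * (D * (D * D))) by ring.
    assert (G3 := Cmod_ge_0 (v - w)%C). specialize (HMb t Ht). assert (G4 := Cmod_ge_0 (phi t)).
    repeat first [assumption | apply Rmult_le_compat | apply Rmult_le_pos | apply Rle_refl].
Qed.

Lemma cderiv_cauchy_transform_2 (w : C) : Cmod w < r ->
  cderiv (cauchy_transform 2) w (2 * cauchy_transform 3 w)%C.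
Proof.
  intros Hw. assert (HPI := twoPI_pos).
  destruct (cont_bounded phi 0 (2 * PI)) as [M [HM HMb]]; [lra|intros t _; apply Hphi|].
  assert (Hr : 0 < r - Cmod w) by lra.
  set (D := 2 / (r - Cmod w)). assert (HD : 0 < D) by (apply Rdiv_lt_0_compat; lra).
  unfold cauchy_transform at 2. rewrite <- CInt_mult; [|lra|intros t _; now apply ccont_cauchy_kernel].
  apply (cderiv_CInt (fun w t => phi t * Cpow (/ (RtoC r * cis t - w)) 2)%C _ w 0 (2 * PI) ((r - Cmod w) / 2) (M * (3 * D ^ 4))); try lra.
  - assert (0 < D ^ 4) by now apply pow_lt. nra.
  - intros v Hv t _. apply ccont_cauchy_kernel. apply (near_in_disk w v ((r - Cmod w) / 2)); lra.
  - intros t _. apply ccont_mult. apply ccont_const. now apply ccont_cauchy_kernel.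
  - intros v t Hv Ht. destruct (near_in_disk w v ((r - Cmod w) / 2)) as (Hvr & B1 & B2); [lra|lra|].
    destruct (cauchy_point v t Hvr) as [N1 C1]. destruct (cauchy_point w t Hw) as [N2 C2].
    assert (Hu := Rle_trans _ _ _ C1 B1). assert (Hv' := Rle_trans _ _ _ C2 B2). fold D in Hu, Hv'.
    (* The last factor is a sum of one inverse and twice another, at most 3 D; this is the source of
       the constant 3 D^4. *)
    replace (phi t * Cpow (/ (RtoC r * cis t - v)) 2 - phi t * Cpow (/ (RtoC r * cis t - w)) 2 - 2 * (phi t * Cpow (/ (RtoC r * cis t - w)) 3) * (v - w))%C
      with (phi t * ((v - w) * (v - w)) * (/ (RtoC r * cis t - w) * (/ (RtoC r * cis t - w) * (/ (RtoC r * cis t - v) * (/ (RtoC r * cis t - v) + 2 * / (RtoC r * cis t - w))))))%C.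
    2:{ simpl. field. auto. }
    rewrite !Cmod_mult.
    assert (G5 : Cmod (/ (RtoC r * cis t - v) + 2 * / (RtoC r * cis t - w))%C <= 3 * D).
    { eapply Rle_trans. apply Cmod_triangle. rewrite Cmod_mult, Cmod_R, Rabs_pos_eq; lra. }
    assert (G1 := Cmod_ge_0 (/ (RtoC r * cis t - v))%C). assert (G2 := Cmod_ge_0 (/ (RtoC r * cis t - w))%C).
    assert (G6 := Cmod_ge_0 (/ (RtoC r * cis t - v) + 2 * / (RtoC r * cis t - w))%C).
    set (U := Cmod (/ (RtoC r * cis t - v))%C) in *. set (V := Cmod (/ (RtoC r * cis t - w))%C) in *.
    replace (M * (3 * D ^ 4) * Cmod (v - w)%C ^ 2) with (M * (Cmod (v - w)%C * Cmod (v - w)%C) * (D * (D * (D * (3 * D))))) by ring.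
    assert (G3 := Cmod_ge_0 (v - w)%C). specialize (HMb t Ht). assert (G4 := Cmod_ge_0 (phi t)).
    repeat first [assumption | apply Rmult_le_compat | apply Rmult_le_pos | apply Rle_refl].
Qed.
End CauchyTransform.

Lemma C_derive_unique (f : C -> C) (z d : C) : cderiv f z d -> C_derive f z = d.
Proof. intros H. apply is_C_derive_unique. now apply is_derive_of_cderiv. Qed.

Lemma open_disk_near (z : C) r : Cmod z < r -> exists del : posreal, forall w, Cmod (w - z)%C < del -> Cmod w < r.
Proof.
  intros Hz. assert (Hp : 0 < r - Cmod z) by lra. exists (mkposreal _ Hp). intros w Hw. simpl in Hw.
  assert (T := Cmod_triangle (w - z) z). replace (w - z + z)%C with w in T by ring. lra.
Qed.

(** Near [z] the Cauchy formula writes [f] as a Cauchy transform, so its derivative is again a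
    Cauchy transform and can be differentiated once more. *)
Lemma holomorphic_derivative (f : C -> C) b : holomorphic_in f b ->
  holomorphic_in (C_derive f) b.
Proof.
  intros Hf z Hz. assert (Hz0 := Cmod_ge_0 z). assert (HPI := twoPI_pos).
  set (r := (Cmod z + b) / 2).
  assert (Hfc := holomorphic_in_continuous f b Hf).
  (* The numerator of the kernel z / (z - w) and the normalization 1 / (2 pi) are absorbed into the
     density. *)
  set (phi := fun t => (/ RtoC (2 * PI) * (f (RtoC r * cis t) * (RtoC r * cis t)))%C).
  assert (Hphi : forall t, ccont phi t).
  { intros t. apply ccont_mult. apply ccont_const. apply ccont_mult.
    apply ccont_on_circle. unfold r; lra. intros v Hv. apply Hfc. unfold r in Hv. lra.
    apply ccont_mult. apply ccont_const. apply ccont_cis, continuous_id. }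
  assert (E : forall w, Cmod w < r -> cauchy_transform phi r 1 w = f w).
  { intros w Hw. assert (HC := cauchy_formula f b r w Hf). unfold circle_int in HC.
    unfold cauchy_transform, phi.
    replace (f w) with (/ RtoC (2 * PI) * (RtoC (2 * PI) * f w))%C.
    2:{ field. apply Cmod_gt_0. rewrite Cmod_R, Rabs_pos_eq; lra. }
    rewrite <- HC by (unfold r in *; lra).
    rewrite <- CInt_mult; [|lra|].
    - apply CInt_ext; [lra|]. intros t _. simpl. unfold Cdiv. ring.
    - intros t _. apply ccont_mult. apply ccont_on_circle. unfold r; lra. intros v Hv. apply Hfc. unfold r in Hv. lra.
      apply ccont_mult. apply ccont_mult. apply ccont_const. apply ccont_cis, continuous_id.
      now apply ccont_cauchy_inv. }
  assert (E2 : forall w, Cmod w < r -> C_derive f w = cauchy_transform phi r 2 w).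
  { intros w Hw. apply C_derive_unique. destruct (open_disk_near w r Hw) as [del Hdel].
    apply cderiv_ext_loc with (cauchy_transform phi r 1).
    - exists del. intros v Hv. apply E. now apply Hdel.
    - now apply cderiv_cauchy_transform_1. }
  assert (Hzr : Cmod z < r) by (unfold r; lra).
  eexists. apply cderiv_ext_loc with (cauchy_transform phi r 2).
  - destruct (open_disk_near z r Hzr) as [del Hdel]. exists del. intros v Hv. symmetry. apply E2. now apply Hdel.
  - now apply cderiv_cauchy_transform_2.
Qed.

(** Expanding the Cauchy kernel geometrically leaves only the remainder, since
    all Fourier coefficients of [f - c] vanish on one circle, hence on all. *)
Lemma identity_principle (f : C -> C) (c : C) b r : 0 < r < b ->
  holomorphic_in f b ->
  (forall z, Cmod z = r -> f z = c) -> forall z, Cmod z < b -> f z = c.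
Proof.
  intros Hr Hf Hc z Hz. assert (Hz0 := Cmod_ge_0 z). assert (HPI := twoPI_pos).
  set (g := fun z => (f z - c)%C).
  assert (Hg : holomorphic_in g b).
  { intros v Hv. destruct (Hf v Hv) as [d Hd]. eexists. apply cderiv_minus. exact Hd. apply cderiv_const. }
  assert (Hpow : forall k (v : C), v <> RtoC 0 -> exists d, cderiv (fun v => Cpow (/ v) k) v d).
  { intros k v Hv. induction k as [|k [d IH]]; simpl.
    - exists 0%C. apply cderiv_const.
    - exists (- / (v * v) * Cpow (/ v) k + / v * d)%C. apply (cderiv_mult Cinv (fun v => Cpow (/ v) k)); [now apply cderiv_inv|exact IH]. }
  assert (Hgp : forall k v, 0 < Cmod v < b -> exists d, cderiv (fun v => g v * Cpow (/ v) k)%C v d).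
  { intros k v Hv. destruct (Hg v) as [d Hd]; [lra|]. destruct (Hpow k v) as [d' Hd']. apply Cmod_gt_0; lra.
    eexists. apply cderiv_mult. exact Hd. exact Hd'. }
  assert (Hgpc : forall k v, 0 < Cmod v < b -> ccontC (fun v => g v * Cpow (/ v) k)%C v).
  { intros k v Hv. destruct (Hgp k v Hv) as [d Hd]. now apply cderiv_cont with d. }
  assert (Hcoef : forall k s, 0 < s < b -> circle_int (fun v => g v * Cpow (/ v) k)%C s = 0%C).
  { intros k s Hs.
    assert (E : circle_int (fun v => g v * Cpow (/ v) k)%C r = 0%C).
    { rewrite (circle_int_ext _ (fun _ => 0%C)); [|lra|]. rewrite circle_int_const. ring.
      intros v Hv. unfold g. rewrite Hc by auto. ring. }
    rewrite <- E. destruct (Rle_or_lt s r) as [Hle|Hlt].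
    - apply circle_int_annulus with 0 b; try lra. intros v Hv. apply Hgp. lra.
    - symmetry. apply circle_int_annulus with 0 b; try lra. intros v Hv. apply Hgp. lra. }
  set (s := (Cmod z + b) / 2).
  assert (Hs : Cmod z < s < b) by (unfold s; lra).
  assert (Hkc : forall v, Cmod v = s -> ccontC (fun v => v / (v - z))%C v).
  { intros v Hv. destruct (cderiv_kernel z v) as [d Hd]. apply Cmod_neq; lra. now apply cderiv_cont with d. }
  (* One term is peeled off by v/(v - z) = 1 + (z/v) v/(v - z); the contribution of the 1 is a
     vanishing coefficient [Hcoef]. *)
  assert (Hrem : forall k, circle_int (fun v => g v * (v / (v - z)))%C s =
     (Cpow z k * circle_int (fun v => (g v * Cpow (/ v) k) * (v / (v - z)))%C s)%C).
  { induction k.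
    - simpl. rewrite Cmult_1_l. apply circle_int_ext; [lra|]. intros v Hv. simpl. ring.
    - rewrite IHk.
      rewrite (circle_int_ext _ (fun v => (g v * Cpow (/ v) k) + z * ((g v * Cpow (/ v) (S k)) * (v / (v - z))))%C); [|lra|].
      + rewrite circle_int_plus, circle_int_mult, Hcoef; try lra.
        * simpl. ring.
        * intros v Hv. apply ccontC_mult. apply Hgpc. lra. now apply Hkc.
        * intros v Hv. apply Hgpc. lra.
        * intros v Hv. apply ccontC_mult. apply ccontC_const. apply ccontC_mult. apply Hgpc. lra. now apply Hkc.
      + intros v Hv. assert (v <> 0%C) by (apply Cmod_gt_0; lra). assert ((v - z)%C <> 0%C) by (apply Cminus_neq, Cmod_neq; lra). simpl. field. auto. }
  assert (HF := cauchy_formula g b s z Hg Hs).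
  destruct (cont_bounded (fun t => g (RtoC s * cis t)%C) 0 (2 * PI)) as [M [HM HMb]]; [lra| |].
  { apply circle_ccont_on; [lra|]. intros v Hv. destruct (Hg v) as [d Hd]; [lra|]. now apply cderiv_cont with d. }
  (* |z|^k from the factor in front and s^(-k) from the integrand combine to a geometric decay with
     ratio below 1. *)
  set (q := Cmod z / s). assert (Hq : 0 <= q < 1).
  { unfold q. split. apply Rdiv_le_0_compat; lra. apply Rlt_div_l; lra. }
  assert (Hest : forall k, Cmod (circle_int (fun v => g v * (v / (v - z)))%C s) <= q ^ k * (2 * PI * (M * (s / (s - Cmod z))))).
  { intros k. rewrite (Hrem k), Cmod_mult, Cmod_pow. unfold q, Rdiv at 1. rewrite Rpow_mult_distr, Rmult_assoc.
    apply Rmult_le_compat_l. now apply pow_le.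
    unfold circle_int.
    replace ((/ s) ^ k * (2 * PI * (M * (s / (s - Cmod z))))) with ((2 * PI - 0) * (M * (/ s) ^ k * (s / (s - Cmod z)))) by ring.
    apply CInt_bound; [lra| |].
    - intros t _. apply (ccont_on_circle (fun v => g v * Cpow (/ v) k * (v / (v - z)))%C); [lra|].
      intros v Hv. apply ccontC_mult. apply Hgpc; lra. now apply Hkc.
    - intros t Ht. rewrite Cmod_mult, (Cmod_mult (g _)), Cmod_pow.
      assert (N : (RtoC s * cis t)%C <> 0%C). { apply Cmod_gt_0. rewrite Cmod_polar; lra. }
      rewrite Cmod_inv, Cmod_polar by (auto; lra).
      destruct (cauchy_point s z t) as [N1 N2]; [lra|].
      apply Rmult_le_compat; try apply Cmod_ge_0.
      + apply Rmult_le_pos. apply Cmod_ge_0. apply pow_le, Rlt_le, Rinv_0_lt_compat. lra.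
      + apply Rmult_le_compat_r. apply pow_le, Rlt_le, Rinv_0_lt_compat. lra. now apply HMb.
      + unfold Cdiv. rewrite Cmod_mult, Cmod_polar by lra. apply Rmult_le_compat_l; lra. }
  assert (Z : circle_int (fun v => g v * (v / (v - z)))%C s = 0%C).
  { apply Cmod_le_0. intros eps Heps. set (K := 2 * PI * (M * (s / (s - Cmod z)))) in *.
    assert (HK : 0 < K). { unfold K. apply Rmult_lt_0_compat; auto. apply Rmult_lt_0_compat; auto. apply Rdiv_lt_0_compat; lra. }
    destruct (pow_lt_1_zero q) with (y := eps / K) as [N HN].
    { rewrite Rabs_pos_eq; lra. } { now apply Rdiv_lt_0_compat. }
    specialize (HN N (Nat.le_refl _)). eapply Rle_trans. apply (Hest N).
    apply Rlt_le, Rlt_div_r; auto. eapply Rle_lt_trans. apply Rle_abs. exact HN. }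
  rewrite Z in HF. assert (G0 : g z = 0%C).
  { replace (g z) with (/ RtoC (2 * PI) * (RtoC (2 * PI) * g z))%C. rewrite <- HF. ring.
    field. apply Cmod_gt_0. rewrite Cmod_R, Rabs_pos_eq; lra. }
  unfold g in G0. replace (f z) with (f z - c + c)%C by ring. rewrite G0. ring.
Qed.

(** * Circle means of the modulus *)

Lemma polar_form (z : C) : exists t, 0 <= t <= 2 * PI /\ z = (RtoC (Cmod z) * cis t)%C.
Proof.
  assert (HPI := PI_RGT_0).
  destruct (Ceq_dec z 0) as [->|Hz].
  { exists 0. split; [lra|]. rewrite Cmod_0. ring. }
  assert (Hp := proj1 (Cmod_gt_0 z) Hz). set (m := Cmod z) in *.
  set (x := Re z / m). set (y := Im z / m).
  assert (Hxy : x ^ 2 + y ^ 2 = 1).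
  { unfold x, y. assert (E := Cmod2_alt z). fold m in E.
    replace ((Re z / m) ^ 2 + (Im z / m) ^ 2) with ((Re z ^ 2 + Im z ^ 2) / m ^ 2) by (field; lra).
    rewrite <- E. field. lra. }
  assert (Hx : -1 <= x <= 1) by nra.
  assert (Hb := acos_bound x).
  assert (Hs : sqrt (1 - Rsqr x) = Rabs y).
  { rewrite <- sqrt_Rsqr_abs. f_equal. unfold Rsqr. lra. }
  destruct (Rle_or_lt 0 y) as [Hy|Hy].
  - exists (acos x). split; [lra|]. unfold cis. rewrite cos_acos, sin_acos, Hs, Rabs_pos_eq by lra.
    apply injective_projections; simpl; unfold x, y, Re, Im; field; lra.
  - exists (2 * PI - acos x). split; [lra|]. unfold cis.
    rewrite cos_minus, sin_minus, cos_2PI, sin_2PI, cos_acos, sin_acos, Hs, Rabs_left by lra.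
    apply injective_projections; simpl; unfold x, y, Re, Im; field; lra.
Qed.

Lemma is_derive_C_R_eps (g : R -> C) (x : R) (l : C) :
  (forall eps, 0 < eps -> exists del, 0 < del /\ forall y, Rabs (y - x) < del ->
    Cmod (g y - g x - l * RtoC (y - x))%C <= eps * Rabs (y - x)) ->
  is_derive (K := R_AbsRing) (V := C_R_NormedModule) g x l.
Proof.
  intros H. split. apply is_linear_scal_l.
  intros x' Hx. assert (x = x') as <- by exact (is_filter_lim_locally_unique (K := R_AbsRing) (V := R_NormedModule) x x' Hx).
  intros eps. destruct (H eps (cond_pos eps)) as [del [Hdel Hd]].
  exists (mkposreal _ Hdel). intros y Hy. specialize (Hd y Hy).
  replace (g y - g x - l * RtoC (y - x))%C with
    (minus (G := C_R_NormedModule) (minus (G := C_R_NormedModule) (g y) (g x)) (scal (V := C_R_NormedModule) (minus y x) l)) in Hd.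
  - rewrite Cmod_norm in Hd. exact Hd.
  - apply injective_projections; unfold minus, scal, plus, opp; simpl; unfold prod_scal, prod_plus, prod_opp, scal, plus, opp; simpl; unfold mult; simpl; ring.
Qed.

(** The curve is the vertical line x = ln r in logarithmic polar coordinates, so its derivative is i
    times the complex derivative there. *)
Lemma circle_derive (f : C -> C) (r t : R) (d : C) : 0 < r -> cderiv f (RtoC r * cis t)%C d ->
  is_derive (K := R_AbsRing) (V := C_R_NormedModule) (fun t => f (RtoC r * cis t)%C) t (d * (Ci * (RtoC r * cis t)))%C.
Proof.
  intros Hr Hd. apply is_derive_C_R_eps. intros eps Heps.
  assert (Hd' : cderiv f (RtoC (exp (ln r)) * cis t)%C d) by now rewrite exp_ln.
  assert (H := cdiff2_comp f (fun x y => RtoC (exp x) * cis y)%C (ln r) t _ d (cdiff2_polar (ln r) t) Hd').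
  destruct (H eps Heps) as [del [Hdel H']]. exists del. split; auto.
  intros y Hy. specialize (H' (ln r) y). rewrite !Rminus_diag, Rabs_R0, !exp_ln in H' by auto.
  replace (f (RtoC r * cis y) - f (RtoC r * cis t) - d * (Ci * (RtoC r * cis t)) * RtoC (y - t))%C
   with (f (RtoC r * cis y) - f (RtoC r * cis t) - d * (RtoC r * cis t) * (RtoC 0 + Ci * RtoC (y - t)))%C by ring.
  eapply Rle_trans. apply H'; auto. apply Req_le. ring.
Qed.

Lemma RInt_nonneg_zero (f : R -> R) a b : a <= b -> (forall x, a <= x <= b -> continuous f x) ->
  (forall x, a <= x <= b -> 0 <= f x) -> RInt f a b <= 0 -> forall x, a < x < b -> f x = 0.
Proof.
  intros Hab Hc H0 HI x Hx. apply Rle_antisym; [|apply H0; lra]. apply Rnot_lt_le. intros Hp.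
  assert (Hp2 : 0 < f x / 2) by lra.
  assert (Hcx : continuous f x) by (apply Hc; lra).
  destruct (proj1 (filterlim_locally (U := R_UniformSpace) f (f x)) Hcx (mkposreal _ Hp2)) as [del Hdel].
  assert (Hd := cond_pos del).
  set (e := Rmin (del / 2) (Rmin ((x - a) / 2) ((b - x) / 2))).
  assert (He : 0 < e) by (unfold e; apply Rmin_pos; [lra|apply Rmin_pos; lra]).
  assert (E1 : e <= del / 2) by apply Rmin_l.
  assert (E2 : e <= (x - a) / 2). { eapply Rle_trans. apply Rmin_r. apply Rmin_l. }
  assert (E3 : e <= (b - x) / 2). { eapply Rle_trans. apply Rmin_r. apply Rmin_r. }
  assert (ex : forall u v, a <= u -> u <= v -> v <= b -> ex_RInt f u v).
  { intros u v Hu Huv Hv. apply ex_RInt_cont; auto. intros y Hy. apply Hc. lra. }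
  rewrite <- (RInt_Chasles f a (x - e) b) in HI by (apply ex; lra).
  rewrite <- (RInt_Chasles f (x - e) (x + e) b) in HI by (apply ex; lra).
  change (RInt f a (x - e) + (RInt f (x - e) (x + e) + RInt f (x + e) b) <= 0) in HI.
  assert (P1 : 0 <= RInt f a (x - e)). { apply RInt_ge_0; [lra|apply ex; lra|]. intros y Hy. apply H0. lra. }
  assert (P2 : 0 <= RInt f (x + e) b). { apply RInt_ge_0; [lra|apply ex; lra|]. intros y Hy. apply H0. lra. }
  assert (P3 : 0 < RInt f (x - e) (x + e)).
  { apply RInt_gt_0; [lra| |].
    - intros y Hy. assert (B : Rabs (f y - f x) < f x / 2). { apply (Hdel y). change (Rabs (y - x) < del). apply Rabs_def1; lra. }
      apply Rabs_def2 in B. lra.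
    - intros y Hy. apply Hc. lra. }
  lra.
Qed.

(** The endpoints matter: in the maximum principle the circle touches the larger radius exactly at
    the angle 0. *)
Lemma RInt_nonneg_zero_closed (f : R -> R) a b : a < b -> (forall x, a <= x <= b -> continuous f x) ->
  (forall x, a <= x <= b -> 0 <= f x) -> RInt f a b <= 0 -> forall x, a <= x <= b -> f x = 0.
Proof.
  intros Hab Hc H0 HI.
  assert (Hin := RInt_nonneg_zero f a b (Rlt_le _ _ Hab) Hc H0 HI).
  assert (Hcc : forall x, a <= x <= b -> ccont (fun t => RtoC (f t)) x) by (intros; apply ccont_RtoC; auto).
  intros x Hx. apply RtoC_inj.
  destruct (Req_dec x b) as [->|Hb]; [|destruct (Req_dec x a) as [->|Ha]].
  - apply (limit_left_const (fun t => RtoC (f t)) b (RtoC 0) (b - a)); [lra|apply Hcc; lra|].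
    intros y Hy. now rewrite Hin by lra.
  - apply (limit_right_const (fun t => RtoC (f t)) a (RtoC 0) (b - a)); [lra|apply Hcc; lra|].
    intros y Hy. now rewrite Hin by lra.
  - now rewrite Hin by lra.
Qed.

(** * Parameter integrals, Fubini and rotation invariance *)

Lemma continuous_RInt_param (F : R -> R -> R) c d x :  c <= d ->
  (forall x y, continuous (fun p : R * R => F (fst p) (snd p)) (x, y)) ->
  continuous (fun x => RInt (F x) c d) x.
Proof.
  intros Hcd HF.
  assert (H2 : forall x y, cont2 (fun x y => RtoC (F x y)) x y).
  { intros u v. apply (cont2_of_prod (fun x y => RtoC (F x y))). now apply ccont_RtoC. }
  apply continuous_ext with (fun x => Re (CInt (fun y => RtoC (F x y)) c d)).
  - intros u. rewrite CInt_Re; auto. intros v _. apply (cont2_ccont (fun x y => RtoC (F x y))). apply H2.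
  - apply ccont_Re. apply (CInt_param_cont (fun x y => RtoC (F x y))); auto.
    exists 1. split; [lra|]. auto.
Qed.

Lemma continuous_section1 (F : R -> R -> R) x y :
  continuous (fun p : R * R => F (fst p) (snd p)) (x, y) -> continuous (fun u => F u y) x.
Proof.
  intros H. apply (continuous_comp (fun u : R => (u, y)) (fun p : R * R => F (fst p) (snd p))); auto.
  apply filterlim_locally. intros eps. exists eps. intros u Hu. split; [exact Hu|apply ball_center].
Qed.
Lemma continuous_swap (F : R -> R -> R) x y :
  continuous (fun p : R * R => F (fst p) (snd p)) (x, y) -> continuous (fun p : R * R => F (snd p) (fst p)) (y, x).
Proof.
  intros H. apply (continuous_comp (fun p : R * R => (snd p, fst p)) (fun p : R * R => F (fst p) (snd p))); auto.
  apply filterlim_locally. intros eps. exists eps. intros u [Hu1 Hu2]. split; [exact Hu2|exact Hu1].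
Qed.

(** As functions of the upper limit [T], both iterated integrals vanish at [a] and have the same
    derivative. *)
Lemma RInt_fubini (F : R -> R -> R) a b c d : a <= b -> c <= d ->
  (forall x y, continuous (fun p : R * R => F (fst p) (snd p)) (x, y)) ->
  RInt (fun x => RInt (F x) c d) a b = RInt (fun y => RInt (fun x => F x y) a b) c d.
Proof.
  intros Hab Hcd HF.
  assert (ex1 : forall y u v, ex_RInt (fun x => F x y) u v).
  { intros y u v. apply (ex_RInt_continuous (V := R_CompleteNormedModule)). intros x _. now apply continuous_section1. }
  assert (HFs : forall x y, continuous (fun p : R * R => (fun y x => F x y) (fst p) (snd p)) (x, y)).
  { intros x y. now apply continuous_swap. }
  set (A := (fun T => RInt (fun x => RInt (F x) c d) a T) : R -> R).
  set (B := (fun T => RInt (fun y => RInt (fun x => F x y) a T) c d) : R -> R).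
  assert (HA : forall T, is_derive A T (RInt (F T) c d)).
  { intros T. apply (is_derive_RInt (fun x => RInt (F x) c d) A a T).
    - exists (mkposreal 1 Rlt_0_1). intros u _. apply (RInt_correct (V := R_CompleteNormedModule)).
      apply (ex_RInt_continuous (V := R_CompleteNormedModule)). intros x _. now apply continuous_RInt_param.
    - now apply continuous_RInt_param. }
  assert (Hd1 : forall u y, is_derive (fun u => RInt (fun x => F x y) a u) u (F u y)).
  { intros u y. apply (is_derive_RInt (fun x => F x y) _ a).
    - exists (mkposreal 1 Rlt_0_1). intros v _. apply (RInt_correct (V := R_CompleteNormedModule)). apply ex1.
    - now apply continuous_section1. }
  assert (HB : forall T, a <= T -> is_derive B T (RInt (F T) c d)).
  { intros T HT. replace (RInt (F T) c d) with (RInt (fun t => Derive (fun u => RInt (fun x => F x t) a u) T) c d).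
    - apply (is_derive_RInt_param (fun u y => RInt (fun x => F x y) a u) c d T).
      + exists (mkposreal 1 Rlt_0_1). intros u _ y _. eexists. apply Hd1.
      + intros t _. apply continuity_2d_pt_ext with F.
        * intros u v. symmetry. apply is_derive_unique. apply Hd1.
        * apply continuity_2d_pt_filterlim. apply HF.
      + exists (mkposreal 1 Rlt_0_1). intros u _.
        apply (ex_RInt_continuous (V := R_CompleteNormedModule)). intros y _.
        (* Differentiation under the integral asks for integrability in a full neighbourhood of [T],
           hence also for [u] left of [a]; there the orientation is reversed. *)
        destruct (Rle_or_lt a u) as [Hu|Hu].
        * now apply (continuous_RInt_param (fun y x => F x y)).
        * apply continuous_ext with (fun y => - RInt (fun x => F x y) u a).
          { intros v. apply (opp_RInt_swap (V := R_CompleteNormedModule)). apply ex1. }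
          apply (continuous_opp (V := R_NormedModule)). apply (continuous_RInt_param (fun y x => F x y)); auto. lra.
    - apply RInt_ext. intros t _. apply is_derive_unique. apply Hd1. }
  assert (A0 : A a = 0) by (unfold A; apply (RInt_point (V := R_CompleteNormedModule))).
  assert (B0 : B a = 0).
  { unfold B. rewrite (RInt_ext (V := R_CompleteNormedModule) (fun y => RInt (fun x => F x y) a a) (fun _ => 0)).
    2:{ intros y _. apply (RInt_point (V := R_CompleteNormedModule)). }
    rewrite RInt_const. unfold scal; simpl. unfold mult; simpl. ring. }
  change (A b = B b).
  destruct (Req_dec a b) as [E|Hne]; [rewrite <- E; lra|].
  assert (E : A a - B a = A b - B b).
  { apply (eq_is_derive (fun T => A T - B T) a b); [|lra].
    intros t Ht.
    assert (HD := is_derive_minus (V := R_NormedModule) A B t _ _ (HA t) (HB t (proj1 Ht))).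
    rewrite minus_eq_zero in HD. exact HD. }
  lra.
Qed.

Lemma RInt_cis_period (u : C -> R) (a : R) : (forall t, continuous (fun t => u (cis t)) t) ->
  RInt (fun t => u (cis (t + a))) 0 (2 * PI) = RInt (fun t => u (cis t)) 0 (2 * PI).
Proof.
  intros Hu. assert (HPI := twoPI_pos).
  set (f := fun t => RtoC (u (cis t))).
  assert (Hf : forall t, ccont f t) by (intros t; now apply ccont_RtoC).
  assert (E : CInt (fun t => f (t + a)) 0 (2 * PI) = CInt f 0 (2 * PI)).
  { rewrite CInt_shift; [|lra|intros t _; apply Hf].
    rewrite Rplus_0_l, (Rplus_comm (2 * PI) a). apply CInt_period; [lra|exact Hf|].
    intros t. unfold f. now rewrite cis_period. }
  assert (Hs : ccont_on (fun t => f (t + a)) 0 (2 * PI)).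
  { intros t _. apply (@continuous_comp R_UniformSpace R_UniformSpace CU (fun t => t + a) f); [|apply Hf].
    apply (continuous_plus (V := R_NormedModule)); [apply continuous_id|apply continuous_const]. }
  apply (f_equal Re) in E. rewrite !CInt_Re in E; try lra; auto.
  intros t _. apply Hf.
Qed.

(** A difference quotient in the direction [u] has real numerator apart from the factor s, so Im (d
    u) = 0 for every unit [u]; the directions 1 and i kill both parts of [d]. *)
Lemma real_near_deriv_zero (k : C -> C) (d : C) del : 0 < del -> cderiv k 0 d ->
  (forall z, Cmod z < del -> Im (k z) = 0) -> d = 0%C.
Proof.
  intros Hdel Hk Hre.
  assert (Him0 : Im (k 0%C) = 0) by (apply Hre; now rewrite Cmod_0).
  assert (Hpart : forall u : C, Cmod u = 1 -> Im (d * u) = 0).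
  { intros u Hu.
    assert (HR : Rabs (Im (d * u)%C) <= 0).
    { apply le_epsilon. intros e He. rewrite Rplus_0_l.
      destruct (proj1 (cderiv_eps k 0 d) Hk (mkposreal e He)) as [d1 H1].
      assert (Hd1 := cond_pos d1).
      set (s := Rmin del d1 / 2). assert (Hm := Rmin_pos _ _ Hdel Hd1).
      assert (L1 := Rmin_l del d1). assert (L2 := Rmin_r del d1).
      assert (Hs : 0 < s) by (unfold s; lra).
      assert (Hsu : Cmod (RtoC s * u)%C = s) by (rewrite Cmod_mult, Hu, Cmod_R, Rabs_pos_eq; lra).
      specialize (H1 (RtoC s * u)%C).
      replace (RtoC s * u - 0)%C with (RtoC s * u)%C in H1 by ring. rewrite Hsu in H1. simpl in H1.
      assert (H2 := H1 ltac:(unfold s; lra)). clear H1.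
      assert (H3 : Rabs (Im (k (RtoC s * u) - k 0 - d * (RtoC s * u))%C) <= e * s).
      { eapply Rle_trans. 2: exact H2. eapply Rle_trans. 2: apply Rmax_Cmod. apply Rmax_r. }
      replace (Im (k (RtoC s * u) - k 0 - d * (RtoC s * u))%C) with
        (Im (k (RtoC s * u)%C) - Im (k 0%C) - s * Im (d * u)%C) in H3.
      2:{ unfold Im, Cminus, Cmult, Cplus, Copp, RtoC; simpl. ring. }
      rewrite Him0, Hre in H3 by (rewrite Hsu; unfold s; lra).
      replace (0 - 0 - s * Im (d * u)%C) with (- (s * Im (d * u)%C)) in H3 by ring.
      rewrite Rabs_Ropp, Rabs_mult, (Rabs_pos_eq s) in H3 by lra. nra. }
    apply Rabs_le_between in HR. lra. }
  assert (I1 := Hpart 1%C Cmod_1). assert (I2 := Hpart Ci Cmod_Ci).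
  unfold Im, Cmult, RtoC, Ci in I1, I2; simpl in I1, I2.
  apply injective_projections; simpl; lra.
Qed.

(** Equality in the sub-mean value inequality on all small circles forces
    a constant argument, hence a vanishing derivative. *)
Lemma mean_modulus_eq_deriv_zero (k : C -> C) (d : C) del : 0 < del ->
  holomorphic_in k del ->
  (forall r, 0 < r < del -> RInt (fun t => Cmod (k (RtoC r * cis t)%C)) 0 (2 * PI) <= 2 * PI * Cmod (k 0%C)) ->
  cderiv k 0 d -> d = 0%C.
Proof.
  intros Hdel Hk Hm Hd. assert (HPI := twoPI_pos).
  assert (Hkc := holomorphic_in_continuous k del Hk).
  (* If the central value is 0, the integrals of the modulus are at most 0, so [k] vanishes nearby;
     otherwise one may divide by that value. *)
  destruct (Ceq_dec (k 0%C) 0) as [E0|Hne].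
  - apply (real_near_deriv_zero k d del Hdel Hd). intros z Hz.
    destruct (polar_form z) as [t [Ht Hzt]].
    destruct (Ceq_dec z 0) as [->|Hz0]. { now rewrite E0. }
    assert (Hzp := proj1 (Cmod_gt_0 z) Hz0). set (r := Cmod z) in *.
    assert (HF : Cmod (k (RtoC r * cis t)%C) = 0).
    { apply (RInt_nonneg_zero_closed (fun t => Cmod (k (RtoC r * cis t)%C)) 0 (2 * PI)); auto.
      - intros u _. apply ccont_Cmod. apply ccont_on_circle. lra. intros v Hv. apply Hkc. lra.
      - intros u _. apply Cmod_ge_0.
      - specialize (Hm r). rewrite E0, Cmod_0, Rmult_0_r in Hm. apply Hm. lra. }
    rewrite Hzt. apply Cmod_eq_0 in HF. now rewrite HF.
  - set (c := k 0%C) in *. assert (Hcp := proj1 (Cmod_gt_0 c) Hne).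
    set (k1 := fun z => (/ c * k z)%C).
    assert (Hd1 : cderiv k1 0 (/ c * d)%C).
    { apply cderiv_eq with (0 * k 0%C + / c * d)%C; [|ring].
      apply (cderiv_mult (fun _ => / c)%C k). apply cderiv_const. exact Hd. }
    assert (Hk1 : holomorphic_in k1 del).
    { intros z Hz. destruct (Hk z Hz) as [d' Hd']. eexists. apply (cderiv_mult (fun _ => / c)%C k). apply cderiv_const. exact Hd'. }
    assert (Hk1c := holomorphic_in_continuous k1 del Hk1).
    assert (K0 : k1 0%C = 1%C) by (unfold k1; fold c; field; auto).
    assert (Z : (/ c * d)%C = 0%C).
    { apply (real_near_deriv_zero k1 _ del Hdel Hd1). intros z Hz.
      destruct (polar_form z) as [t [Ht Hzt]].
      destruct (Ceq_dec z 0) as [->|Hz0]. { rewrite K0. reflexivity. }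
      assert (Hzp := proj1 (Cmod_gt_0 z) Hz0). set (r := Cmod z) in *.
      assert (Hkr : forall u, ccont (fun t => k1 (RtoC r * cis t)%C) u).
      { apply ccont_on_circle. lra. intros v Hv. apply Hk1c. lra. }
      assert (Hkr' : forall u, ccont (fun t => k (RtoC r * cis t)%C) u).
      { apply ccont_on_circle. lra. intros v Hv. apply Hkc. lra. }
      (* Nonnegative, with integral at most 2 pi - 2 pi Re (k1 0) = 0 by the hypothesis and the mean
         value property. Hence |k1| = Re k1 on the circle, so k1 is real there. *)
      set (F := fun t => Cmod (k1 (RtoC r * cis t)%C) - Re (k1 (RtoC r * cis t)%C)).
      assert (HF : F t = 0).
      { apply (RInt_nonneg_zero_closed F 0 (2 * PI)); auto.
        - intros u _. apply (continuous_minus (V := R_NormedModule)). now apply ccont_Cmod. now apply ccont_Re.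
        - intros u _. unfold F. assert (H := re_le_Cmod (k1 (RtoC r * cis u)%C)). apply Rabs_le_between in H. lra.
        - unfold F.
          change (RInt (fun t => minus (Cmod (k1 (RtoC r * cis t)%C)) (Re (k1 (RtoC r * cis t)%C))) 0 (2 * PI) <= 0).
          rewrite (RInt_minus (V := R_CompleteNormedModule)).
          2:{ apply ex_RInt_cont; [lra|]. intros u _. now apply ccont_Cmod. }
          2:{ apply ex_RInt_cont; [lra|]. intros u _. now apply ccont_Re. }
          rewrite <- (CInt_Re 0 (2 * PI)) by (auto; lra || (intros u _; apply Hkr)).
          change (CInt (fun t => k1 (RtoC r * cis t)%C) 0 (2 * PI)) with (circle_int k1 r).
          rewrite (mean_value k1 del) by (auto; lra). rewrite K0.
          replace (Re (RtoC (2 * PI) * 1)%C) with (2 * PI) by (unfold Re, RtoC; simpl; ring).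
          rewrite (RInt_ext _ (fun t => scal (/ Cmod c) (Cmod (k (RtoC r * cis t)%C)))).
          2:{ intros u _. unfold k1. now rewrite Cmod_mult, Cmod_inv. }
          rewrite (RInt_scal (V := R_CompleteNormedModule)).
          2:{ apply ex_RInt_cont; [lra|]. intros u _. now apply ccont_Cmod. }
          specialize (Hm r (conj Hzp Hz)).
          change (/ Cmod c * RInt (fun t => Cmod (k (RtoC r * cis t)%C)) 0 (2 * PI) - 2 * PI <= 0).
          assert (HI : / Cmod c * RInt (fun t => Cmod (k (RtoC r * cis t)%C)) 0 (2 * PI) <= / Cmod c * (2 * PI * Cmod c)).
          { apply Rmult_le_compat_l; auto. now apply Rlt_le, Rinv_0_lt_compat. }
          replace (/ Cmod c * (2 * PI * Cmod c)) with (2 * PI) in HI by (field; lra). lra. }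
      unfold F in HF. rewrite <- Hzt in HF.
      assert (H2 := Cmod2_alt (k1 z)). replace (Cmod (k1 z)) with (Re (k1 z)) in H2 by lra. nra. }
    replace d with (c * (/ c * d))%C by (field; auto). rewrite Z. ring.
Qed.

(** A vanishing derivative on one circle suffices: [g] is constant along that circle, and the
    identity principle spreads the value over the disk. *)
Lemma zero_derivative_constant (g : C -> C) r : 0 < r < 1 ->
  holomorphic_in g 1 ->
  (forall z, Cmod z = r -> cderiv g z 0) -> exists c, forall z, Cmod z < 1 -> g z = c.
Proof.
  intros Hr Hg Hd0.
  exists (g (RtoC r)). apply (identity_principle g _ 1 r); [lra|exact Hg|].
  intros z Hz. destruct (polar_form z) as [a [Ha Hza]]. rewrite Hz in Hza. rewrite Hza.
  destruct (Req_dec a 0) as [->|Ha0]. { now rewrite cis_0, Cmult_1_r. }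
  replace (RtoC r) with (RtoC r * cis 0)%C at 2 by (rewrite cis_0; ring).
  symmetry. apply (eq_is_derive (V := C_R_NormedModule) (fun a => g (RtoC r * cis a)%C) 0 a); [|lra].
  intros t Ht. replace (zero : C_R_NormedModule) with (0 * (Ci * (RtoC r * cis t)))%C.
  - apply circle_derive; [lra|]. apply Hd0. apply Cmod_polar. lra.
  - transitivity (RtoC 0); [ring|reflexivity].
Qed.

Section ModulusMean.
Variable g : C -> C.
Hypothesis Hg : holomorphic_in g 1.

Definition modulus_mean (t : R) : R := RInt (fun a => Cmod (g (RtoC t * cis a)%C)) 0 (2 * PI).

Let Hgc : forall z, Cmod z < 1 -> ccontC g z.
Proof. exact (holomorphic_in_continuous g 1 Hg). Qed.

Lemma modulus_mean_continuous t : Rabs t < 1 -> continuous modulus_mean t.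
Proof.
  intros Ht. assert (HPI := twoPI_pos).
  assert (C2 : forall x y, Rabs x < 1 -> cont2 (fun t a => RtoC (Cmod (g (RtoC t * cis a)%C))) x y).
  { intros x y Hx. apply (cont2_of_prod (fun t a => RtoC (Cmod (g (RtoC t * cis a)%C)))).
    apply ccont_RtoC, ccont_Cmod. apply (ccont_comp g (fun p : R * R => RtoC (fst p) * cis (snd p))%C).
    apply ccont_polar. apply continuous_fst. apply continuous_snd.
    apply Hgc. simpl. now rewrite Cmod_mult, Cmod_cis, Cmod_R, Rmult_1_r. }
  assert (Hloc : locally t (fun u => Rabs u < 1)).
  { assert (Hp : 0 < 1 - Rabs t) by lra. exists (mkposreal _ Hp).
    assert (Hin : forall u : R, Rabs (u - t) < 1 - Rabs t -> Rabs u < 1).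
    { intros u Hu. assert (H := Rabs_triang (u - t) t). replace (u - t + t) with u in H by ring. lra. }
    exact Hin. }
  apply continuous_ext_loc with (fun t => Re (CInt (fun a => RtoC (Cmod (g (RtoC t * cis a)%C))) 0 (2 * PI))).
  - generalize Hloc. apply filter_imp. intros u Hu. rewrite CInt_Re; [reflexivity|lra|].
    intros a _. apply (cont2_ccont (fun t a => RtoC (Cmod (g (RtoC t * cis a)%C)))). now apply C2.
  - apply ccont_Re. apply (CInt_param_cont (fun t a => RtoC (Cmod (g (RtoC t * cis a)%C)))). lra.
    destruct Hloc as [del Hdel]. exists del. split. apply cond_pos. intros x Hx y _. apply C2. apply Hdel. exact Hx.
Qed.

Lemma modulus_mean_rotate (z : C) : Cmod z < 1 ->
  RInt (fun a => Cmod (g (z * cis a)%C)) 0 (2 * PI) = modulus_mean (Cmod z).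
Proof.
  intros Hz. destruct (polar_form z) as [t [_ Ht]]. set (r := Cmod z) in *.
  unfold modulus_mean. rewrite <- (RInt_cis_period (fun u => Cmod (g (RtoC r * u)%C)) t).
  - apply RInt_ext. intros a _. rewrite Ht, cis_plus. do 2 f_equal. ring.
  - intros a. apply ccont_Cmod. apply ccont_on_circle. apply Cmod_ge_0. intros v Hv. apply Hgc. lra.
Qed.

(** For fixed [a] the points run over the circle of radius [r] about t e^(ia); for fixed [p] they
    run over a circle about 0. Integrating first in one angle or in the other gives the two sides of
    the comparison. *)
Let kernel (t r : R) (p a : R) : R := Cmod (g ((RtoC t + RtoC r * cis p) * cis a)%C).

Let kernel_continuous t r x y : 0 <= t -> 0 <= r -> t + r < 1 ->
  continuous (fun p : R * R => kernel t r (fst p) (snd p)) (x, y).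
Proof.
  intros Ht Hr Htr. apply ccont_Cmod.
  apply (ccont_comp g (fun p : R * R => (RtoC t + RtoC r * cis (fst p)) * cis (snd p))%C).
  - apply ccont_mult; [apply ccont_plus; [apply ccont_const|apply ccont_mult; [apply ccont_const|]]|];
      apply ccont_cis; [apply continuous_fst|apply continuous_snd].
  - apply Hgc. rewrite Cmod_mult, Cmod_cis, Rmult_1_r.
    eapply Rle_lt_trans. apply Cmod_triangle. rewrite Cmod_polar, Cmod_R, Rabs_pos_eq; lra.
Qed.

Let holomorphic_shift t r a : 0 <= t -> t + r <= 1 -> forall z, Cmod z < r ->
  exists d, cderiv (fun z => g ((RtoC t + z) * cis a))%C z d.
Proof.
  intros Ht Htr z Hz.
  destruct (Hg ((RtoC t + z) * cis a)%C) as [d Hd].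
  { rewrite Cmod_mult, Cmod_cis, Rmult_1_r. eapply Rle_lt_trans. apply Cmod_triangle. rewrite Cmod_R, Rabs_pos_eq; lra. }
  eexists. apply (cderiv_comp g (fun z => (RtoC t + z) * cis a)%C). exact Hd.
  apply cderiv_mult. apply cderiv_plus. apply cderiv_const. apply cderiv_id. apply cderiv_const.
Qed.

Let point_submean t r a : 0 <= t -> 0 <= r -> t + r < 1 ->
  2 * PI * Cmod (g (RtoC t * cis a)%C) <= RInt (fun p => kernel t r p a) 0 (2 * PI).
Proof.
  intros Ht Hr Htr. assert (HPI := twoPI_pos).
  assert (HM := mean_value (fun z => g ((RtoC t + z) * cis a))%C (1 - t)).
  specialize (HM ltac:(intros z Hz; apply (holomorphic_shift t (1 - t)); lra) r ltac:(lra)).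
  replace (2 * PI * Cmod (g (RtoC t * cis a)%C)) with (Cmod (circle_int (fun z => g ((RtoC t + z) * cis a))%C r)).
  - unfold circle_int. apply CInt_norm; [lra|].
    intros p _. apply (ccont_on_circle (fun z => g ((RtoC t + z) * cis a)%C)); auto. intros v Hv.
    destruct (holomorphic_shift t (1 - t) a Ht ltac:(lra) v ltac:(lra)) as [d Hd]. now apply cderiv_cont with d.
  - rewrite HM, Cmod_mult, Cmod_R, Rabs_pos_eq by lra. now rewrite Cplus_0_r.
Qed.

(** Together with [point_submean] integrated over [a], this is the sub-mean value property of the
    radial function z -> [modulus_mean] |z|. *)
Let modulus_swap t r : 0 <= t -> 0 <= r -> t + r < 1 ->
  RInt (fun a => RInt (fun p => kernel t r p a) 0 (2 * PI)) 0 (2 * PI) =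
  RInt (fun p => modulus_mean (Cmod (RtoC t + RtoC r * cis p)%C)) 0 (2 * PI).
Proof.
  intros Ht Hr Htr. assert (HPI := twoPI_pos).
  rewrite <- (RInt_fubini (kernel t r)); try lra. 2:{ intros x y. now apply kernel_continuous. }
  apply RInt_ext. intros p _. apply modulus_mean_rotate.
  eapply Rle_lt_trans. apply Cmod_triangle. rewrite Cmod_polar, Cmod_R, Rabs_pos_eq; lra.
Qed.

Let kernel_int_continuous t r a : 0 <= t -> 0 <= r -> t + r < 1 ->
  continuous (fun a => RInt (fun p => kernel t r p a) 0 (2 * PI)) a.
Proof.
  intros Ht Hr Htr. assert (HPI := twoPI_pos).
  apply (continuous_RInt_param (fun a p => kernel t r p a)). lra.
  intros x y. apply (continuous_swap (kernel t r)). now apply kernel_continuous.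
Qed.
Let modulus_circle_continuous t r p : 0 <= t -> 0 <= r -> t + r < 1 ->
  continuous (fun p => modulus_mean (Cmod (RtoC t + RtoC r * cis p)%C)) p.
Proof.
  intros Ht Hr Htr.
  apply (continuous_comp (fun p => Cmod (RtoC t + RtoC r * cis p)%C) modulus_mean).
  - apply ccont_Cmod. apply ccont_plus; [apply ccont_const|apply ccont_mult; [apply ccont_const|apply ccont_cis, continuous_id]].
  - apply modulus_mean_continuous. rewrite Rabs_pos_eq by apply Cmod_ge_0.
    eapply Rle_lt_trans. apply Cmod_triangle. rewrite Cmod_polar, Cmod_R, Rabs_pos_eq; lra.
Qed.
Let modulus_point_continuous t a : 0 <= t < 1 ->
  continuous (fun a => 2 * PI * Cmod (g (RtoC t * cis a)%C)) a.
Proof.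
  intros Ht. apply (continuous_scal_r (V := R_NormedModule) (2 * PI) (fun a => Cmod (g (RtoC t * cis a)%C))).
  apply ccont_Cmod, ccont_on_circle. lra. intros v Hv. apply Hgc. lra.
Qed.
Let modulus_point_int t : 0 <= t < 1 ->
  RInt (fun a => 2 * PI * Cmod (g (RtoC t * cis a)%C)) 0 (2 * PI) = 2 * PI * modulus_mean t.
Proof.
  intros Ht. assert (HPI := twoPI_pos).
  apply (RInt_scal (V := R_CompleteNormedModule) (fun a => Cmod (g (RtoC t * cis a)%C)) 0 (2 * PI) (2 * PI)).
  apply ex_RInt_cont. lra. intros a _. apply ccont_Cmod, ccont_on_circle. lra. intros v Hv. apply Hgc. lra.
Qed.

(** A maximum point of the radial mean below [s] propagates along the circle
    about it that touches the radius [s]. *)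
Lemma modulus_mean_max s : 0 <= s < 1 -> forall t, 0 <= t <= s -> modulus_mean t <= modulus_mean s.
Proof.
  intros Hs. assert (HPI := twoPI_pos).
  destruct (continuity_ab_maj modulus_mean 0 s) as [m [Hm Hms]]; [lra| |].
  { intros t Ht. apply continuity_pt_of_continuous, modulus_mean_continuous. apply Rabs_def1; lra. }
  enough (E : modulus_mean m = modulus_mean s) by (intros t Ht; rewrite <- E; now apply Hm).
  set (r := s - m).
  assert (Hr : 0 <= r) by (unfold r; lra). assert (Hmr : m + r < 1) by (unfold r; lra).
  (* Nonnegative by maximality, while its integral over the circle is at most 0 by the sub-mean
     value property; so it vanishes at every angle, in particular at 0. *)
  assert (Z : modulus_mean m - modulus_mean (Cmod (RtoC m + RtoC r * cis 0)%C) = 0).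
  { apply (RInt_nonneg_zero_closed (fun p => modulus_mean m - modulus_mean (Cmod (RtoC m + RtoC r * cis p)%C)) 0 (2 * PI)); try lra.
    - intros p _. apply (continuous_minus (V := R_NormedModule)). apply continuous_const.
      apply modulus_circle_continuous; lra.
    - intros p _. assert (H := Hm (Cmod (RtoC m + RtoC r * cis p)%C)).
      assert (Cmod (RtoC m + RtoC r * cis p)%C <= s).
      { eapply Rle_trans. apply Cmod_triangle. rewrite Cmod_polar, Cmod_R, Rabs_pos_eq; unfold r; lra. }
      assert (Hge := Cmod_ge_0 (RtoC m + RtoC r * cis p)%C). lra.
    - change (RInt (fun p => minus (modulus_mean m) (modulus_mean (Cmod (RtoC m + RtoC r * cis p)%C))) 0 (2 * PI) <= 0).
      rewrite (RInt_minus (V := R_CompleteNormedModule)).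
      2: apply ex_RInt_const.
      2:{ apply ex_RInt_cont. lra. intros p _. apply modulus_circle_continuous; lra. }
      rewrite RInt_const, <- modulus_swap by lra.
      change ((2 * PI - 0) * modulus_mean m - RInt (fun a : R => RInt (fun p : R => kernel m r p a) 0 (2 * PI)) 0 (2 * PI) <= 0).
      rewrite Rminus_0_r, <- modulus_point_int by lra. apply Rle_minus. apply RInt_le. lra.
      + apply ex_RInt_cont. lra. intros a _. apply modulus_point_continuous. lra.
      + apply ex_RInt_cont. lra. intros a _. apply kernel_int_continuous; lra.
      + intros a _. apply point_submean; lra. }
  rewrite cis_0, Cmult_1_r, <- RtoC_plus, Cmod_R, Rabs_pos_eq in Z by lra.
  replace (m + r) with s in Z by (unfold r; ring). lra.
Qed.

(** Small circles about a point of modulus [r] stay within radius [s], where the radial mean is at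
    most its value at [r]. This forces equality in the integrated sub-mean inequality, hence at each
    angle, so the derivative of [g] vanishes on the circle of radius [r]. *)
Lemma modulus_mean_strict r s : 0 < r < s -> s < 1 -> modulus_mean r = modulus_mean s ->
  exists c, forall z, Cmod z < 1 -> g z = c.
Proof.
  intros Hr Hs E. assert (HPI := twoPI_pos).
  assert (Heq : forall q a, 0 < q < s - r -> 0 <= a <= 2 * PI ->
     RInt (fun p => kernel r q p a) 0 (2 * PI) = 2 * PI * Cmod (g (RtoC r * cis a)%C)).
  { intros q a Hq Ha. apply Rminus_diag_uniq.
    apply (RInt_nonneg_zero_closed (fun a => RInt (fun p => kernel r q p a) 0 (2 * PI) - 2 * PI * Cmod (g (RtoC r * cis a)%C)) 0 (2 * PI)); try lra.
    - intros b _. apply (continuous_minus (V := R_NormedModule)). apply kernel_int_continuous; lra.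
      apply modulus_point_continuous. lra.
    - intros b _. assert (H := point_submean r q b). lra.
    - change (RInt (fun a => minus (RInt (fun p => kernel r q p a) 0 (2 * PI)) (2 * PI * Cmod (g (RtoC r * cis a)%C))) 0 (2 * PI) <= 0).
      rewrite (RInt_minus (V := R_CompleteNormedModule)).
      2:{ apply ex_RInt_cont. lra. intros b _. apply kernel_int_continuous; lra. }
      2:{ apply ex_RInt_cont. lra. intros b _. apply modulus_point_continuous; lra. }
      rewrite modulus_swap, modulus_point_int by lra. apply Rle_minus.
      apply Rle_trans with (RInt (fun _ => modulus_mean s) 0 (2 * PI)).
      + apply RInt_le. lra.
        * apply ex_RInt_cont. lra. intros b _. apply modulus_circle_continuous; lra.
        * apply ex_RInt_const.
        * intros p _. apply modulus_mean_max. lra. split. apply Cmod_ge_0.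
          eapply Rle_trans. apply Cmod_triangle. rewrite Cmod_polar, Cmod_R, Rabs_pos_eq; lra.
      + rewrite RInt_const. rewrite E. apply Req_le. unfold scal; simpl. unfold mult; simpl. ring. }
  (* The function is translated to put the point r e^(ia) at 0; the nonzero factor [cis a] from the
     rotation is divided out at the end. *)
  assert (Hd0 : forall a, 0 <= a <= 2 * PI -> cderiv g (RtoC r * cis a)%C 0%C).
  { intros a Ha. destruct (Hg (RtoC r * cis a)%C) as [d Hd]. { rewrite Cmod_polar; lra. }
    assert (Hcomp : cderiv (fun z => g ((RtoC r + z) * cis a))%C 0 (d * cis a)%C).
    { apply (cderiv_comp g (fun z => (RtoC r + z) * cis a)%C).
      - now rewrite Cplus_0_r.
      - apply cderiv_eq with ((0 + 1) * cis a + (RtoC r + 0) * 0)%C; [|ring].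
        apply cderiv_mult. apply cderiv_plus. apply cderiv_const. apply cderiv_id. apply cderiv_const. }
    assert (Z : (d * cis a)%C = 0%C).
    { apply (mean_modulus_eq_deriv_zero (fun z => g ((RtoC r + z) * cis a))%C _ (s - r)); auto; [lra| |].
      - intros z Hz. apply (holomorphic_shift r (s - r)); lra.
      - intros q Hq. rewrite Cplus_0_r. apply Req_le. apply (Heq q a Hq Ha). }
    apply cderiv_eq with d; [exact Hd|].
    replace d with (d * cis a * / cis a)%C. rewrite Z. ring. field. apply cis_neq_0. }
  apply (zero_derivative_constant g r); [lra|exact Hg|].
  intros z Hz. destruct (polar_form z) as [a [Ha Hza]]. rewrite Hza, Hz. now apply Hd0.
Qed.

Lemma modulus_mean_0 : modulus_mean 0 = 2 * PI * Cmod (g 0%C).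
Proof.
  unfold modulus_mean. rewrite (RInt_ext _ (fun _ => Cmod (g 0%C))).
  - rewrite RInt_const, Rminus_0_r. reflexivity.
  - intros a _. now rewrite Cmult_0_l.
Qed.
End ModulusMean.

(** * Hausdorff measure of curves *)

Lemma diameter_ge_0 A : Rbar_le 0 (diameter A).
Proof. apply (proj1 (Lub_Rbar_correct _)). now left. Qed.
Lemma diameter_ub A z w : A z -> A w -> Rbar_le (Cmod (z - w)%C) (diameter A).
Proof. intros Hz Hw. apply (proj1 (Lub_Rbar_correct _)). right. now exists z, w. Qed.
Lemma diameter_le A d : 0 <= d -> (forall z w, A z -> A w -> Cmod (z - w)%C <= d) -> Rbar_le (diameter A) d.
Proof.
  intros Hd H. apply (proj2 (Lub_Rbar_correct _)). intros x [->|(z & w & Hz & Hw & ->)]; simpl; auto.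
Qed.
Lemma diameter_finite A delta : Rbar_le (diameter A) (Finite delta) ->
  0 <= real (diameter A) <= delta /\ forall z w, A z -> A w -> Cmod (z - w)%C <= real (diameter A).
Proof.
  intros H. assert (H0 := diameter_ge_0 A). assert (H1 := diameter_ub A).
  destruct (diameter A) as [d| |]; simpl in *; try contradiction. split; auto.
Qed.

Lemma hausdorff1_pre_le (delta s : R) A (U : nat -> C -> Prop) :
  (forall z, A z -> exists i, U i z) -> (forall i, Rbar_le (diameter (U i)) delta) ->
  is_series (fun i => real (diameter (U i))) s -> Rbar_le (hausdorff1_pre delta A) s.
Proof. intros H1 H2 H3. apply (proj1 (Glb_Rbar_correct _)). now exists U. Qed.
Lemma hausdorff1_pre_ge (delta : R) A (l : Rbar) :
  (forall (U : nat -> C -> Prop) s, (forall z, A z -> exists i, U i z) -> (forall i, Rbar_le (diameter (U i)) delta) ->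
    is_series (fun i => real (diameter (U i))) s -> Rbar_le l s) -> Rbar_le l (hausdorff1_pre delta A).
Proof. intros H. apply (proj2 (Glb_Rbar_correct _)). intros s (U & H1 & H2 & H3). now apply (H U). Qed.
Lemma hausdorff1_le A (l : Rbar) : (forall delta, 0 < delta -> Rbar_le (hausdorff1_pre delta A) l) ->
  Rbar_le (hausdorff1 A) l.
Proof.
  intros H. unfold hausdorff1, Rbar_lub.
  match goal with |- Rbar_le (proj1_sig ?e) _ => apply (proj2 (proj2_sig e)) end.
  intros x (d & Hd & ->). now apply H.
Qed.
Lemma hausdorff1_ge A delta : 0 < delta -> Rbar_le (hausdorff1_pre delta A) (hausdorff1 A).
Proof.
  intros Hd. unfold hausdorff1, Rbar_lub.
  match goal with |- Rbar_le _ (proj1_sig ?e) => apply (proj1 (proj2_sig e)) end.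
  now exists delta.
Qed.

Lemma is_series_nonneg_partial (a : nat -> R) s : (forall i, 0 <= a i) -> is_series a s ->
  forall n, sum_f_R0 a n <= s.
Proof.
  intros Ha Hs n. rewrite <- sum_n_Reals.
  apply (is_lim_seq_incr_compare (sum_n a) s Hs). intros k. rewrite sum_Sn.
  specialize (Ha (S k)). change (sum_n a k <= sum_n a k + a (S k)). lra.
Qed.

Lemma hausdorff1_ge_0 A : Rbar_le 0 (hausdorff1 A).
Proof.
  eapply Rbar_le_trans. 2: apply (hausdorff1_ge A 1); lra.
  apply hausdorff1_pre_ge. intros U s _ H2 H3. simpl.
  assert (P : forall i, 0 <= real (diameter (U i))) by (intros i; apply (diameter_finite _ _ (H2 i))).
  apply Rle_trans with (sum_f_R0 (fun i => real (diameter (U i))) 0). simpl. apply P.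
  now apply is_series_nonneg_partial.
Qed.

(** [F] plays the role of arc length. The arcs of a fine uniform partition have diameters at most
    the increments of [F], which telescope, and the Lipschitz constant [K] makes them at most
    [delta]. *)
Lemma hausdorff1_le_curve (gam : R -> C) (F : R -> R) (K a b : R) (A : C -> Prop) :
  a <= b -> 0 <= K ->
  (forall u v, a <= u <= v -> v <= b -> Cmod (gam u - gam v)%C <= F v - F u <= K * (v - u)) ->
  (forall z, A z -> exists t, a <= t <= b /\ z = gam t) ->
  Rbar_le (hausdorff1 A) (F b - F a).
Proof.
  intros Hab HK HF HA. apply hausdorff1_le. intros delta Hdelta.
  assert (Hmono : forall u v, a <= u <= v -> v <= b -> F u <= F v).
  { intros u v H1 H2. assert (H := HF u v H1 H2). assert (H0 := Cmod_ge_0 (gam u - gam v)%C). lra. }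
  destruct (nfloor_ex (K * (b - a) / delta)) as [n0 [_ Hn0]].
  { apply Rdiv_le_0_compat; auto. apply Rmult_le_pos; lra. }
  set (n := S n0). assert (Hn : K * (b - a) / delta < INR n) by (unfold n; rewrite S_INR; lra).
  assert (Hnp : 0 < INR n) by (apply lt_0_INR; unfold n; lia).
  (* Clamping at [b] turns the finite partition into a sequence whose pieces from index [n] on are
     the single point gam b, with zero increment of [F]. *)
  set (tau := fun i => Rmin (a + (b - a) * (INR i / INR n)) b).
  assert (Htau0 : tau O = a).
  { unfold tau. simpl. rewrite Rmin_left; unfold Rdiv; rewrite ?Rmult_0_l, ?Rmult_0_r; lra. }
  assert (Hstep : forall i, INR (S i) / INR n = INR i / INR n + / INR n) by (intros i; rewrite S_INR; field; lra).
  assert (Hip : 0 < / INR n) by now apply Rinv_0_lt_compat.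
  assert (Hin : forall i, 0 <= INR i / INR n).
  { intros i. apply Rdiv_le_0_compat; auto. apply pos_INR. }
  assert (Htr : forall i, a <= tau i <= tau (S i) /\ tau (S i) <= b /\ tau (S i) - tau i <= (b - a) * / INR n).
  { intros i. unfold tau. rewrite Hstep. specialize (Hin i).
    set (x := INR i / INR n) in *. set (e := / INR n) in *.
    assert (0 <= (b - a) * x) by (apply Rmult_le_pos; lra).
    assert (0 <= (b - a) * e) by (apply Rmult_le_pos; lra).
    unfold Rmin. repeat destruct Rle_dec; lra. }
  assert (Htn : forall i, (n <= i)%nat -> tau i = b).
  { intros i Hi. unfold tau. apply Rmin_right.
    assert (1 <= INR i / INR n). { apply Rle_div_r; auto. rewrite Rmult_1_l. now apply le_INR. }
    nra. }
  set (U := fun i z => exists t, tau i <= t <= tau (S i) /\ z = gam t).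
  set (c := fun i => F (tau (S i)) - F (tau i)).
  assert (Hc0 : forall i, 0 <= c i). { intros i. unfold c. destruct (Htr i) as (H1 & H2 & _). specialize (Hmono _ _ H1 H2). lra. }
  assert (HUc : forall i, Rbar_le (diameter (U i)) (c i)).
  { intros i. apply diameter_le; auto. destruct (Htr i) as (H1 & H2 & _).
    assert (Haux : forall t t', tau i <= t <= t' -> t' <= tau (S i) -> Cmod (gam t - gam t')%C <= c i).
    { intros t t' Ht Ht'. destruct (HF t t') as [Q1 _]; try lra.
      assert (F (tau i) <= F t) by (apply Hmono; lra). assert (F t' <= F (tau (S i))) by (apply Hmono; lra).
      unfold c. lra. }
    intros z w (t & Ht & ->) (t' & Ht' & ->). destruct (Rle_or_lt t t') as [Hle|Hlt].
    - apply Haux; lra.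
    - rewrite Cmod_minus_sym. apply Haux; lra. }
  assert (Hcd : forall i, c i <= delta).
  { intros i. destruct (Htr i) as (H1 & H2 & H3). unfold c. destruct (HF (tau i) (tau (S i))) as [_ Q]; auto.
    apply Rle_trans with (K * ((b - a) * / INR n)).
    - eapply Rle_trans. exact Q. now apply Rmult_le_compat_l.
    - apply Rlt_le in Hn. apply Rle_div_l in Hn; [|lra]. apply (Rmult_le_reg_r (INR n)); auto.
      replace (K * ((b - a) * / INR n) * INR n) with (K * (b - a)) by (field; lra). lra. }
  assert (Hsum : is_series c (F b - F a)).
  { apply (is_lim_seq_ext_loc (fun _ => F b - F a) (sum_n c) (F b - F a)); [|apply is_lim_seq_const].
    exists n. intros k Hk. rewrite sum_n_Reals.
    assert (E : forall k, sum_f_R0 c k = F (tau (S k)) - F (tau O)).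
    { induction k0; simpl; [reflexivity|]. rewrite IHk0. unfold c. lra. }
    rewrite E, Htau0, Htn by lia. reflexivity. }
  assert (Hdiam : forall i, 0 <= real (diameter (U i)) <= c i) by (intros i; apply (diameter_finite _ _ (HUc i))).
  assert (Hex : ex_series (fun i => real (diameter (U i)))).
  { apply (ex_series_le (V := R_CompleteNormedModule) _ c).
    - intros i. change (Rabs (real (diameter (U i))) <= c i). rewrite Rabs_pos_eq; apply Hdiam.
    - eexists. exact Hsum. }
  apply Rbar_le_trans with (Series (fun i => real (diameter (U i)))).
  - apply hausdorff1_pre_le with U.
    + intros z Hz. destruct (HA z Hz) as (t & Ht & ->).
      assert (Hfind : forall k, t <= tau k -> exists i, tau i <= t <= tau (S i)).
      { induction k; intros Hk. exists O. rewrite Htau0 in *. destruct (Htr O) as ((H1 & H2) & _). rewrite Htau0 in H2. lra.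
        destruct (Rle_or_lt t (tau k)). now apply IHk. exists k. lra. }
      destruct (Hfind n) as [i Hi]. rewrite Htn; [lra|lia]. exists i. now exists t.
    + intros i. apply Rbar_le_trans with (c i). apply HUc. apply Hcd.
    + now apply Series_correct.
  - simpl. rewrite <- (is_series_unique c (F b - F a) Hsum). apply Series_le; auto. now exists (F b - F a).
Qed.

(** * Covering estimates and moduli on a segment *)

Lemma sum_f_R0_gap (x y : nat -> R) c i0 N : (forall i, x i <= y i) -> (i0 <= N)%nat -> x i0 + c <= y i0 ->
  sum_f_R0 x N + c <= sum_f_R0 y N.
Proof.
  intros Hxy Hi Hc. induction N.
  - replace i0 with O in Hc by lia. exact Hc.
  - simpl. destruct (Nat.eq_dec i0 (S N)) as [->|Hne].
    + assert (H := sum_Rle x y N (fun n _ => Hxy n)). lra.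
    + assert (H := IHN ltac:(lia)). specialize (Hxy (S N)). lra.
Qed.
Lemma sum_f_R0_incr (x : nat -> R) N M : (forall i, 0 <= x i) -> (N <= M)%nat -> sum_f_R0 x N <= sum_f_R0 x M.
Proof.
  intros Hx H. induction H; [lra|]. simpl. specialize (Hx (S m)). lra.
Qed.

Lemma open_interval_cover (p q : nat -> R) A B : A <= B -> (forall i, p i <= q i) ->
  (forall x, A <= x <= B -> exists i, p i < x < q i) ->
  exists N, B - A <= sum_f_R0 (fun i => q i - p i) N.
Proof.
  intros HAB Hpq Hcov.
  (* The length of the part of the [i]-th interval inside [A, x], which grows with x and lets the
     estimate creep from [A] to [B]. *)
  set (len := fun x i => Rmax 0 (Rmin (q i) x - Rmax (p i) A)).
  assert (Hl0 : forall x i, 0 <= len x i) by (intros; apply Rmax_l).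
  assert (Hlm : forall x y i, x <= y -> len x i <= len y i).
  { intros x y i Hxy. unfold len, Rmax, Rmin. repeat destruct Rle_dec; lra. }
  assert (Hlq : forall x i, len x i <= q i - p i).
  { intros x i. specialize (Hpq i). unfold len, Rmax, Rmin. repeat destruct Rle_dec; lra. }
  set (E := fun t => A <= t <= B /\ exists N, t - A <= sum_f_R0 (len t) N).
  enough (HE : E B).
  { destruct HE as [_ [N HN]]. exists N. eapply Rle_trans. exact HN. apply sum_Rle. intros; apply Hlq. }
  assert (HA : E A). { split; [lra|]. exists O. simpl. rewrite Rminus_diag. apply Hl0. }
  destruct (completeness E) as [m [Hub Hlub]].
  { exists B. intros t [Ht _]. lra. } { now exists A. }
  assert (HAm : A <= m) by now apply Hub.
  assert (HmB : m <= B) by (apply Hlub; intros t [Ht _]; lra).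
  destruct (Hcov m) as [i0 Hi0]; [lra|].
  assert (Hex : exists t, E t /\ p i0 < t).
  { apply NNPP. intros Hn. assert (m <= p i0); [|lra]. apply Hlub. intros t Et.
    apply Rnot_lt_le. intros Hlt. apply Hn. now exists t. }
  destruct Hex as [t [[Ht [N HN]] Htp]].
  assert (Htm : t <= m). { apply Hub. split; auto. now exists N. }
  (* Moving from [t] to [y] inside the interval [i0] increases its own clipped length by the full y
     - t, and no other term decreases. *)
  assert (Hgo : forall y, t <= y < q i0 -> y <= B -> E y).
  { intros y Hy HyB. split; [lra|]. exists (Nat.max N i0).
    assert (H1 := sum_f_R0_incr (len t) N (Nat.max N i0) (Hl0 t) (Nat.le_max_l _ _)).
    assert (H2 := sum_f_R0_gap (len t) (len y) (y - t) i0 (Nat.max N i0)).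
    assert (H3 := H2 (fun i => Hlm t y i (proj1 Hy)) (Nat.le_max_r _ _)).
    assert (H4 : len t i0 + (y - t) <= len y i0).
    { unfold len, Rmax, Rmin. repeat destruct Rle_dec; lra. }
    specialize (H3 H4). lra. }
  destruct (Rlt_or_le B (q i0)) as [Hlt|Hge].
  - apply Hgo; lra.
  - exfalso. assert (E ((m + q i0) / 2)) by (apply Hgo; lra). assert ((m + q i0) / 2 <= m) by now apply Hub. lra.
Qed.

Lemma is_series_half_pow e : is_series (fun i => e * (1 / 2) ^ i) (2 * e).
Proof.
  replace (2 * e) with (scal e (/ (1 - 1 / 2))) by (unfold scal; simpl; unfold mult; simpl; field).
  apply (is_series_scal (V := R_NormedModule) e (fun i => (1 / 2) ^ i)). apply is_series_geom. rewrite Rabs_pos_eq; lra.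
Qed.

(** Countable subadditivity of length for arbitrary sets: each is enclosed in an interval of length
    d i, slightly enlarged to an open one. *)
Lemma set_cover_length (W : nat -> R -> Prop) (d : nat -> R) (A B S : R) : A <= B ->
  (forall i x y, W i x -> W i y -> y - x <= d i) -> (forall i, 0 <= d i) ->
  (forall x, A <= x <= B -> exists i, W i x) -> is_series d S -> B - A <= S.
Proof.
  intros HAB HW Hd Hcov HS.
  assert (Hl : forall i, exists l, forall x, W i x -> l <= x <= l + d i).
  { intros i. destruct (classic (exists x, W i x)) as [[x0 Hx0]|Hno].
    (* The infimum of the set, as minus the supremum of its reflection. *)
    - destruct (completeness (fun y => W i (- y))) as [m [Hub Hlub]].
      + exists (d i - x0). intros y Hy. specialize (HW i _ _ Hy Hx0). lra.
      + exists (- x0). now rewrite Ropp_involutive.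
      + exists (- m). intros x Hx. split.
        * assert (- x <= m) by (apply Hub; now rewrite Ropp_involutive). lra.
        * assert (m <= d i - x); [|lra]. apply Hlub. intros y Hy. specialize (HW i _ _ Hy Hx). lra.
    - exists 0. intros x Hx. elim Hno. now exists x. }
  destruct (choice _ Hl) as [l Hl']. clear Hl.
  apply le_epsilon. intros e He.
  (* The enlargements on both sides sum to 2 * 2 * (e / 4) = e. *)
  set (ei := fun i => (e / 4) * (1 / 2) ^ i).
  assert (Hei : forall i, 0 < ei i). { intros i. apply Rmult_lt_0_compat; [lra|]. apply pow_lt. lra. }
  destruct (open_interval_cover (fun i => l i - ei i) (fun i => l i + d i + ei i) A B) as [N HN]; auto.
  { intros i. specialize (Hd i). specialize (Hei i). lra. }
  { intros x Hx. destruct (Hcov x Hx) as [i Hi]. exists i. specialize (Hl' i x Hi). specialize (Hei i). lra. }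
  eapply Rle_trans. exact HN.
  assert (HS2 : is_series (fun i => l i + d i + ei i - (l i - ei i)) (S + e)).
  { apply is_series_ext with (fun i => plus (d i) (scal 2 (ei i))).
    { intros i. change (d i + 2 * ei i = l i + d i + ei i - (l i - ei i)). ring. }
    replace (S + e) with (plus S (scal 2 (2 * (e / 4)))).
    2:{ change (S + 2 * (2 * (e / 4)) = S + e). field. }
    apply (is_series_plus (V := R_NormedModule) d (fun i => scal 2 (ei i))); auto. apply (is_series_scal (V := R_NormedModule) 2 ei). apply is_series_half_pow. }
  apply (is_series_nonneg_partial (fun i => l i + d i + ei i - (l i - ei i))); auto.
  intros i. specialize (Hd i). specialize (Hei i). lra.
Qed.

Lemma ccont_delta (f : R -> C) x : ccont f x -> forall eps, 0 < eps -> exists d, 0 < d /\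
  forall y, Rabs (y - x) < d -> Cmod (f y - f x)%C < eps.
Proof.
  intros H eps He. destruct (proj1 (ccont_eps f x) H (mkposreal eps He)) as [d Hd].
  exists d. split. apply cond_pos. exact Hd.
Qed.

Lemma uniform_continuity_segment (f : R -> C) a b eps : (forall t, ccont f t) -> 0 < eps ->
  exists eta, 0 < eta /\ forall u, a <= u <= b -> forall x, Rabs (x - u) < eta -> Cmod (f x - f u)%C < eps.
Proof.
  intros Hf He.
  apply (segment_compactness (fun eta u => forall x, Rabs (x - u) < eta -> Cmod (f x - f u)%C < eps)).
  - intros d d' y Hd H x Hx. apply H. lra.
  - intros u _. destruct (ccont_delta f u (Hf u) (eps / 2)) as [d [Hd H]]; [lra|].
    exists (d / 2). split; [lra|]. intros u' _ Hu' x Hx.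
    replace (f x - f u')%C with ((f x - f u) - (f u' - f u))%C by ring.
    eapply Rle_lt_trans. apply Cmod_triangle. rewrite Cmod_opp.
    assert (H1 : Cmod (f u' - f u)%C < eps / 2) by (apply H; lra).
    assert (H2 : Cmod (f x - f u)%C < eps / 2).
    { apply H. replace (x - u) with ((x - u') + (u' - u)) by ring.
      eapply Rle_lt_trans. apply Rabs_triang. lra. }
    lra.
Qed.

(** Uniform continuity of the inverse of an injective curve. Compactness is used twice: in [t] for a
    neighbourhood of a fixed [s], then in [s]. *)
Lemma injectivity_modulus (f : R -> C) a b eta : (forall t, ccont f t) ->
  (forall s t, a <= s <= b -> a <= t <= b -> f s = f t -> s = t) -> 0 < eta ->
  exists d, 0 < d /\ forall s, a <= s <= b -> forall t, a <= t <= b -> Cmod (f s - f t)%C <= d -> Rabs (s - t) < eta.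
Proof.
  intros Hf Hinj Heta.
  apply (segment_compactness (fun d s => forall t, a <= t <= b -> Cmod (f s - f t)%C <= d -> Rabs (s - t) < eta)).
  - intros d d' s Hd H t Ht Hst. apply H; auto. lra.
  - intros s Hs.
    destruct (segment_compactness (fun d t => forall s', Rabs (s' - s) < d -> Cmod (f s' - f t)%C <= d -> Rabs (s' - t) < eta) a b) as [d [Hd H]].
    + intros d d' t Hd H s' H1 H2. apply H; lra.
    + intros t Ht. destruct (Rlt_or_le (Rabs (s - t)) eta) as [Hlt|Hge].
      * exists ((eta - Rabs (s - t)) / 2). split; [lra|]. intros t' _ Ht' s' Hs' _.
        replace (s' - t') with ((s' - s) + ((s - t) - (t' - t))) by ring.
        eapply Rle_lt_trans. apply Rabs_triang.
        assert (H1 := Rabs_triang (s - t) (- (t' - t))). rewrite Rabs_Ropp in H1.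
        change ((s - t) + - (t' - t)) with ((s - t) - (t' - t)) in H1. lra.
      * assert (Hne : (f s - f t)%C <> 0%C).
        { apply Cminus_neq. intros E. apply Hinj in E; auto. subst t. rewrite Rminus_diag, Rabs_R0 in Hge. lra. }
        assert (Hm := proj1 (Cmod_gt_0 _) Hne). set (m := Cmod (f s - f t)%C) in *.
        (* Two distinct values at distance [m] stay apart: moving each by less than m/3 cannot bring
           them within m/4, since 1/3 + 1/4 + 1/3 < 1. *)
        destruct (ccont_delta f s (Hf s) (m / 3)) as [d1 [Hd1 H1]]; [lra|].
        destruct (ccont_delta f t (Hf t) (m / 3)) as [d2 [Hd2 H2]]; [lra|].
        assert (Hmin : 0 < Rmin (m / 4) (Rmin d1 d2)) by (apply Rmin_pos; [lra|now apply Rmin_pos]).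
        assert (L1 := Rmin_l (m / 4) (Rmin d1 d2)). assert (L2 := Rmin_r (m / 4) (Rmin d1 d2)).
        assert (L3 := Rmin_l d1 d2). assert (L4 := Rmin_r d1 d2).
        exists (Rmin (m / 4) (Rmin d1 d2)). split; auto. intros t' _ Ht' s' Hs' Hc. exfalso.
        specialize (H1 s' ltac:(lra)). specialize (H2 t' ltac:(lra)).
        assert (T : m <= Cmod (f s' - f s)%C + Cmod (f s' - f t')%C + Cmod (f t' - f t)%C).
        { unfold m. replace (f s - f t)%C with (- (f s' - f s) + (f s' - f t') + (f t' - f t))%C by ring.
          eapply Rle_trans. apply Cmod_triangle. apply Rplus_le_compat_r.
          eapply Rle_trans. apply Cmod_triangle. rewrite Cmod_opp. lra. }
        lra.
    + exists d. split; [exact Hd|]. intros s' _ Hs' t Ht Hst. now apply (H t Ht s').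
Qed.

Section CurveLength.
Variables (gam dgam : R -> C).
Hypothesis Hder : forall t, is_derive (K := R_AbsRing) (V := C_R_NormedModule) gam t (dgam t).
Hypothesis Hcont : forall t, ccont dgam t.

Lemma curve_continuous t : ccont gam t.
Proof.
  apply ccont_C_UniformSpace. apply (ex_derive_continuous (V := C_R_NormedModule)). now exists (dgam t).
Qed.
Lemma curve_increment u v : u <= v -> CInt dgam u v = (gam v - gam u)%C.
Proof.
  intros Huv. apply (is_RInt_unique (V := CRN)). apply (is_RInt_derive (V := CRN)).
  - intros t _. apply Hder.
  - intros t _. apply ccont_C_UniformSpace, Hcont.
Qed.

Definition speed_int (a t : R) : R := RInt (fun t => Cmod (dgam t)) a t.

Lemma ex_speed u v : ex_RInt (fun t => Cmod (dgam t)) u v.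
Proof.
  apply (ex_RInt_continuous (V := R_CompleteNormedModule)). intros t _. now apply ccont_Cmod.
Qed.

Lemma hausdorff1_curve_upper a b (A : C -> Prop) : a <= b ->
  (forall z, A z -> exists t, a <= t <= b /\ z = gam t) -> Rbar_le (hausdorff1 A) (speed_int a b).
Proof.
  intros Hab HA.
  destruct (cont_bounded dgam a b) as [K [HK HKb]]; auto. { intros t _. apply Hcont. }
  replace (speed_int a b) with (speed_int a b - speed_int a a).
  2:{ replace (speed_int a a) with 0. ring. symmetry. apply (RInt_point (V := R_CompleteNormedModule)). }
  apply hausdorff1_le_curve with gam K; auto; [lra|].
  intros u v Hu Hv.
  assert (E : speed_int a v - speed_int a u = RInt (fun t => Cmod (dgam t)) u v).
  { unfold speed_int. rewrite <- (RInt_Chasles (fun t => Cmod (dgam t)) a u v) by apply ex_speed.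
    change (RInt (fun t => Cmod (dgam t)) a u + RInt (fun t => Cmod (dgam t)) u v - RInt (fun t => Cmod (dgam t)) a u
       = RInt (fun t => Cmod (dgam t)) u v). ring. }
  rewrite E. split.
  - rewrite Cmod_minus_sym, <- curve_increment by lra. apply CInt_norm. lra. intros t _. apply Hcont.
  - rewrite Rmult_comm.
    rewrite <- (RInt_const (V := R_CompleteNormedModule) u v K : RInt (fun _ => K) u v = (v - u) * K).
    apply RInt_le; [lra|apply ex_speed|apply ex_RInt_const|]. intros t Ht. apply HKb. lra.
Qed.

(** With [G] the integral of [max (|gam'| - eps, 0)], the increments of [gam] dominate
    those of [G] on short parameter intervals, and by injectivity the members of a
    fine cover have short parameter sets, whose [G]-images cover 0 to [G b]. *)
Lemma hausdorff1_curve_lower a b (A : C -> Prop) : a <= b ->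
  (forall s t, a <= s <= b -> a <= t <= b -> gam s = gam t -> s = t) ->
  (forall t, a <= t <= b -> A (gam t)) -> Rbar_le (speed_int a b) (hausdorff1 A).
Proof.
  intros Hab Hinj HA.
  assert (Hmain : forall eps, 0 < eps -> Rbar_le (speed_int a b - eps * (b - a)) (hausdorff1 A)).
  { intros eps Heps.
    destruct (uniform_continuity_segment dgam a b (eps / 2) Hcont) as [eta [Heta Hunif]]; [lra|].
    destruct (injectivity_modulus gam a b eta curve_continuous Hinj Heta) as [delta [Hdelta Hmod]].
    (* The loss [eps] absorbs the variation of the velocity on intervals shorter than [eta]; the
       truncation at 0 keeps [G] nondecreasing. *)
    set (sg := fun t => Rmax (Cmod (dgam t) - eps) 0).
    assert (Hsg : forall t, continuous sg t).
    { intros t. unfold sg. apply continuous_ext with (fun t => (Cmod (dgam t) - eps + Rabs (Cmod (dgam t) - eps)) / 2).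
      - intros x. unfold Rmax, Rabs. destruct Rle_dec; destruct Rcase_abs; lra.
      - assert (Hc : continuous (fun t => Cmod (dgam t) - eps) t).
        { apply (continuous_minus (V := R_NormedModule)). now apply ccont_Cmod. apply continuous_const. }
        apply (continuous_scal_l (K := R_AbsRing) (V := R_NormedModule) (fun t => Cmod (dgam t) - eps + Rabs (Cmod (dgam t) - eps)) (/ 2)).
        apply (continuous_plus (V := R_NormedModule)); auto. now apply continuous_Rabs_comp. }
    assert (Hex : forall u v, ex_RInt sg u v).
    { intros u v. apply (ex_RInt_continuous (V := R_CompleteNormedModule)). auto. }
    set (G := (fun t => RInt sg a t) : R -> R).
    assert (HG : forall u v, G v - G u = RInt sg u v).
    { intros u v. unfold G. rewrite <- (RInt_Chasles sg a u v) by auto.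
      change (RInt sg a u + RInt sg u v - RInt sg a u = RInt sg u v). ring. }
    assert (HGc : continuity G).
    { intros t. apply continuity_pt_of_continuous. apply (ex_derive_continuous (V := R_NormedModule)).
      exists (sg t). apply (is_derive_RInt sg G a t); auto.
      exists (mkposreal 1 Rlt_0_1). intros y _. apply (RInt_correct (V := R_CompleteNormedModule)); auto. }
    assert (HGm : forall u v, u <= v -> 0 <= G v - G u).
    { intros u v Huv. rewrite HG. apply RInt_ge_0; auto. intros x _. apply Rmax_r. }
    (* On a short interval the velocity is within eps/2 of its value at [u]. So the chord is at
       least (v - u)(|gam' u| - eps/2), while the truncated speed is at most the positive part of
       |gam' u| - eps/2. *)
    assert (Hshort : forall u v, a <= u <= v -> v <= b -> v - u < eta -> G v - G u <= Cmod (gam u - gam v)%C).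
    { intros u v Hu Hv Huv. rewrite HG.
      assert (Hclose : forall x, u <= x <= v -> Cmod (dgam x - dgam u)%C < eps / 2).
      { intros x Hx. apply Hunif; [lra|]. rewrite Rabs_pos_eq; lra. }
      assert (B1 : RInt sg u v <= (v - u) * Rmax (Cmod (dgam u) - eps / 2) 0).
      { rewrite <- (RInt_const (V := R_CompleteNormedModule) u v (Rmax (Cmod (dgam u) - eps / 2) 0) : RInt (fun _ => _) u v = (v - u) * _).
        apply RInt_le; [lra|auto|apply ex_RInt_const|]. intros x Hx. unfold sg.
        assert (H1 := Hclose x ltac:(lra)). assert (H2 := Cmod_triangle_rev (dgam x) (dgam u)).
        unfold Rmax. repeat destruct Rle_dec; lra. }
      assert (B2 : Cmod (gam v - gam u - RtoC (v - u) * dgam u)%C <= (v - u) * (eps / 2)).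
      { rewrite <- curve_increment by lra. rewrite <- (CInt_const u v (dgam u)).
        rewrite <- CInt_minus; [|lra|intros t _; apply Hcont|intros t _; apply ccont_const].
        apply CInt_bound; [lra| |].
        - intros t _. apply ccont_minus. apply Hcont. apply ccont_const.
        - intros t Ht. apply Rlt_le, Hclose. lra. }
      assert (B3 := Cmod_triangle_rev (RtoC (v - u) * dgam u) (gam v - gam u)).
      rewrite (Cmod_minus_sym (RtoC (v - u) * dgam u)), Cmod_mult, Cmod_R, Rabs_pos_eq in B3 by lra.
      rewrite (Cmod_minus_sym (gam u)). assert (B4 := Cmod_ge_0 (gam v - gam u)%C).
      unfold Rmax in B1. destruct Rle_dec; nra. }
    apply Rbar_le_trans with (G b).
    { assert (Ga : G a = 0) by apply (RInt_point (V := R_CompleteNormedModule)).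
      replace (G b) with (G b - G a) by lra. rewrite HG. simpl.
      replace (eps * (b - a)) with ((b - a) * eps) by ring.
      rewrite <- (RInt_const (V := R_CompleteNormedModule) a b eps : RInt (fun _ => eps) a b = (b - a) * eps).
      unfold speed_int.
      assert (E := RInt_minus (V := R_CompleteNormedModule) (fun t => Cmod (dgam t)) (fun _ => eps) a b (ex_speed a b) (ex_RInt_const a b eps)).
      change (RInt (fun x => Cmod (dgam x) - eps) a b = RInt (fun t => Cmod (dgam t)) a b - RInt (fun _ => eps) a b) in E.
      rewrite <- E. apply RInt_le; auto.
      - apply (ex_RInt_minus (V := R_NormedModule)). apply ex_speed. apply ex_RInt_const.
      - intros x _. apply Rmax_l. }
    eapply Rbar_le_trans. 2: apply (hausdorff1_ge A delta Hdelta).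
    apply hausdorff1_pre_ge. intros U S HU HUd HS. simpl.
    assert (Ga : G a = 0) by apply (RInt_point (V := R_CompleteNormedModule)).
    replace (G b) with (G b - G a) by lra.
    (* The [i]-th set consists of the values of [G] at parameters whose curve point lies in U i; the
       intermediate value theorem makes these sets cover [G a, G b]. *)
    apply (set_cover_length (fun i x => exists t, a <= t <= b /\ U i (gam t) /\ x = G t) (fun i => real (diameter (U i)))); auto.
    - specialize (HGm a b Hab). lra.
    - intros i x y (u & Hu & HUu & ->) (v & Hv & HUv & ->).
      destruct (diameter_finite (U i) delta (HUd i)) as [H1 H2].
      destruct (Rle_or_lt v u) as [Hle|Hlt].
      + specialize (HGm v u Hle). lra.
      + specialize (H2 (gam u) (gam v) HUu HUv). eapply Rle_trans. 2: exact H2.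
        apply Hshort; try lra. rewrite <- (Rabs_pos_eq (v - u)), Rabs_minus_sym by lra. apply Hmod; auto. lra.
    - intros i. apply (diameter_finite (U i) delta (HUd i)).
    - intros x Hx. destruct (IVT_gen G a b x HGc) as [t [Ht Hxt]].
      + rewrite Rmin_left, Rmax_right; lra.
      + rewrite Rmin_left, Rmax_right in Ht by lra.
        destruct (HU (gam t)) as [i Hi]. now apply HA. exists i, t. auto. }
  assert (H0 := hausdorff1_ge_0 A). destruct (hausdorff1 A) as [h| |]; simpl in *; try contradiction; auto.
  apply le_epsilon. intros e He. specialize (Hmain (e / (b - a + 1))).
  assert (Hp : 0 < e / (b - a + 1)) by (apply Rdiv_lt_0_compat; lra). specialize (Hmain Hp).
  assert (e / (b - a + 1) * (b - a) <= e); [|lra].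
  replace (e / (b - a + 1) * (b - a)) with (e * ((b - a) / (b - a + 1))) by (field; lra).
  rewrite <- (Rmult_1_r e) at 2. apply Rmult_le_compat_l; [lra|]. apply Rle_div_l; lra.
Qed.
End CurveLength.

(** * The boundary of a univalent image *)

Lemma locally_Cmod (z : C) (V : C -> Prop) :
  locally (T := C_UniformSpace) z V <-> exists d, 0 < d /\ forall w, Cmod (w - z)%C < d -> V w.
Proof.
  split.
  - intros H. apply locally_C in H. destruct H as [d Hd]. exists d. split. apply cond_pos. exact Hd.
  - intros [d [Hd H]]. apply locally_C. exists (mkposreal d Hd). exact H.
Qed.

(** In polar coordinates this serves both a closed disk and, with a degenerate first interval, a
    single circle. *)
Lemma lower_bound2 (F : R -> R -> C) a b c d :
  (forall x y, a <= x <= b -> c <= y <= d -> cont2 F x y /\ F x y <> 0%C) ->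
  exists m, 0 < m /\ forall x, a <= x <= b -> forall y, c <= y <= d -> m <= Cmod (F x y).
Proof.
  intros H.
  apply (segment_compactness (fun m x => forall y, c <= y <= d -> m <= Cmod (F x y))).
  - intros e e' x He Hx y Hy. specialize (Hx y Hy). lra.
  - intros x Hx.
    destruct (segment_compactness (fun m y => forall x', Rabs (x' - x) < m -> m <= Cmod (F x' y)) c d) as [m [Hm Hm']].
    + intros e e' y He Hy x' Hx'. specialize (Hy x' ltac:(lra)). lra.
    + intros y Hy. destruct (H x y Hx Hy) as [Hc Hn].
      assert (Hp := proj1 (Cmod_gt_0 _) Hn).
      destruct (Hc (Cmod (F x y) / 2)) as [e [He He']]; [lra|].
      exists (Rmin e (Cmod (F x y) / 2)). split. apply Rmin_pos; lra.
      assert (L1 := Rmin_l e (Cmod (F x y) / 2)). assert (L2 := Rmin_r e (Cmod (F x y) / 2)).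
      intros y' _ Hy' x' Hx'. specialize (He' x' y' ltac:(lra) ltac:(lra)).
      assert (T := Cmod_triangle_rev (F x y) (F x y - F x' y')).
      replace (F x y - (F x y - F x' y'))%C with (F x' y') in T by ring.
      rewrite (Cmod_minus_sym (F x y)) in T. lra.
    + exists m. split; [exact Hm|]. intros x' _ Hx' y Hy. now apply Hm'.
Qed.

Lemma cis_inj s t : 0 <= s < 2 * PI -> 0 <= t < 2 * PI -> cis s = cis t -> s = t.
Proof.
  assert (HPI := PI_RGT_0).
  assert (Haux : forall s t, 0 <= s -> s < t -> t < 2 * PI -> cis s <> cis t).
  { intros u v Hu Huv Hv E. injection E as E1 E2.
    assert (Hc : cos (v - u) = 1).
    { rewrite cos_minus, E1, E2. assert (H := sin2_cos2 v). unfold Rsqr in H. lra. }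
    replace (v - u) with (2 * ((v - u) / 2)) in Hc by field. rewrite cos_2a_sin in Hc.
    assert (0 < sin ((v - u) / 2)) by (apply sin_gt_0; lra). nra. }
  intros Hs Ht E. destruct (Rtotal_order s t) as [H|[H|H]]; auto; exfalso.
  - apply (Haux s t); auto; lra.
  - apply (Haux t s); auto; lra.
Qed.

Section Univalent.
Variable f : C -> C.
Hypothesis Hf : holomorphic_in f 1.
Hypothesis Hinj : forall z w : C, Cmod z < 1 -> Cmod w < 1 -> f z = f w -> z = w.

Let Hfc : forall z, Cmod z < 1 -> ccontC f z.
Proof. exact (holomorphic_in_continuous f 1 Hf). Qed.

(** If [w] near [f z0] were omitted, [1 / (f - w)] would violate the mean value
    property on a circle about [z0]. *)
Lemma univalent_open (z0 : C) r : Cmod z0 < r -> r <= 1 ->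
  locally (T := C_UniformSpace) (f z0) (image f (disk r)).
Proof.
  intros Hz Hr. assert (HPI := twoPI_pos). set (rho := (r - Cmod z0) / 2).
  assert (Hin : forall x : C, Cmod x < r - Cmod z0 -> Cmod (z0 + x)%C < r).
  { intros x Hx. eapply Rle_lt_trans. apply Cmod_triangle. lra. }
  (* By injectivity f does not take the value f z0 on the circle of radius rho about z0, so the
     distance has a positive minimum. *)
  destruct (lower_bound2 (fun x t => f (z0 + RtoC x * cis t) - f z0)%C rho rho 0 (2 * PI)) as [m [Hm Hmb]].
  { intros x t Hx Ht. assert (Hxr : x = rho) by lra. subst x.
    assert (Hp : Cmod (RtoC rho * cis t)%C = rho) by (apply Cmod_polar; unfold rho; lra).
    split.
    - apply (cont2_of_prod (fun x t => f (z0 + RtoC x * cis t) - f z0)%C).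
      apply ccont_minus; [|apply ccont_const].
      apply (ccont_comp f (fun p : R * R => z0 + RtoC (fst p) * cis (snd p))%C).
      + apply ccont_plus. apply ccont_const. apply ccont_polar. apply continuous_fst. apply continuous_snd.
      + apply Hfc. eapply Rlt_le_trans. apply Hin. simpl. rewrite Hp. unfold rho; lra. lra.
    - apply Cminus_neq. intros E. apply Hinj in E.
      + assert (Z : (RtoC rho * cis t)%C = 0%C) by (replace (RtoC rho * cis t)%C with (z0 + RtoC rho * cis t - z0)%C by ring; rewrite E; ring).
        rewrite Z, Cmod_0 in Hp. unfold rho in Hp. lra.
      + eapply Rlt_le_trans. apply Hin. rewrite Hp. unfold rho; lra. lra.
      + lra. }
  specialize (Hmb rho (conj (Rle_refl _) (Rle_refl _))).
  (* For |w - f z0| < m/2 one has |f - w| >= m/2 on the circle. So 1/(f - w) is at most 2/m there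
     but larger than 2/m at the centre. *)
  apply locally_Cmod. exists (m / 2). split; [lra|]. intros w Hw.
  apply NNPP. intros Hno.
  assert (Hne : forall z, Cmod z < r -> (f z - w)%C <> 0%C).
  { intros z Hzr. apply Cminus_neq. intros E. apply Hno. now exists z. }
  set (k := fun x => (/ (f (z0 + x) - w))%C).
  assert (Hk : holomorphic_in k (r - Cmod z0)).
  { intros x Hx. assert (Hx1 := Hin x Hx). destruct (Hf (z0 + x)%C) as [d Hd]; [lra|].
    eexists. apply (cderiv_comp Cinv (fun x => f (z0 + x) - w)%C).
    - apply cderiv_inv. now apply Hne.
    - apply cderiv_minus; [|apply cderiv_const]. apply (cderiv_comp f (fun x => z0 + x)%C). exact Hd.
      apply cderiv_plus. apply cderiv_const. apply cderiv_id. }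
  assert (HM := mean_value k (r - Cmod z0) Hk rho ltac:(unfold rho; lra)).
  assert (HB : Cmod (circle_int k rho) <= 2 * PI * (2 / m)).
  { unfold circle_int. rewrite <- (Rminus_0_r (2 * PI)) at 2. apply CInt_bound; [lra| |].
    - apply circle_ccont_on. unfold rho; lra. intros v Hv. destruct (Hk v) as [d Hd]. rewrite Hv; unfold rho; lra. now apply cderiv_cont with d.
    - intros t Ht. unfold k. specialize (Hmb t Ht).
      rewrite Cmod_inv. 2:{ apply Hne, Hin. rewrite Cmod_polar; unfold rho; lra. }
      replace (2 / m) with (/ (m / 2)) by (field; lra). apply Rinv_le_contravar; [lra|].
      assert (T := Cmod_triangle_rev (f (z0 + RtoC rho * cis t) - f z0) (w - f z0)).
      replace (f (z0 + RtoC rho * cis t) - f z0 - (w - f z0))%C with (f (z0 + RtoC rho * cis t) - w)%C in T by ring. lra. }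
  rewrite HM, Cmod_mult, Cmod_R, Rabs_pos_eq in HB by lra.
  apply Rmult_le_reg_l in HB; [|lra]. unfold k in HB. rewrite Cplus_0_r in HB.
  assert (Hn0 := Hne z0 Hz). rewrite Cmod_inv in HB by auto.
  assert (Hp := proj1 (Cmod_gt_0 _) Hn0). rewrite Cmod_minus_sym in Hw.
  replace (2 / m) with (/ (m / 2)) in HB by (field; lra).
  apply (Rinv_lt_contravar (Cmod (f z0 - w)%C) (m / 2)) in Hw; [lra|]. apply Rmult_lt_0_compat; lra.
Qed.

(** Compactness puts the closure of the image inside the image of the closed disk, and openness
    removes the values from the open disk. Conversely, values on the circle are limits from inside
    and by injectivity are not in the image. *)
Lemma boundary_image_disk r w : 0 < r < 1 ->
  (boundary (image f (disk r)) w <-> exists t, 0 <= t <= 2 * PI /\ w = f (RtoC r * cis t)%C).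
Proof.
  intros Hr. assert (HPI := twoPI_pos). split.
  - intros [Hcl Hint].
    assert (Hex : exists z, Cmod z <= r /\ w = f z).
    { apply NNPP. intros Hno.
      destruct (lower_bound2 (fun x t => f (RtoC x * cis t) - w)%C 0 r 0 (2 * PI)) as [m [Hm Hmb]].
      { intros x t Hx Ht. assert (Hp : Cmod (RtoC x * cis t)%C = x) by (apply Cmod_polar; lra). split.
        - apply (cont2_of_prod (fun x t => f (RtoC x * cis t) - w)%C).
          apply ccont_minus; [|apply ccont_const].
          apply (ccont_comp f (fun p : R * R => RtoC (fst p) * cis (snd p))%C).
          apply ccont_polar. apply continuous_fst. apply continuous_snd.
          apply Hfc. simpl. lra.
        - apply Cminus_neq. intros E. apply Hno. exists (RtoC x * cis t)%C. split; [lra|now symmetry]. }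
      destruct (Hcl (fun v => Cmod (v - w)%C < m)) as [v [Hv [z [Hz Hzv]]]].
      { apply locally_Cmod. now exists m. }
      destruct (polar_form z) as [t [Ht Hzt]]. unfold disk in Hz.
      assert (H := Hmb (Cmod z) (conj (Cmod_ge_0 z) (Rlt_le _ _ Hz)) t Ht). rewrite <- Hzt, Hzv in H. lra. }
    destruct Hex as [z [Hz Hw]].
    destruct (Rle_lt_or_eq_dec _ _ Hz) as [Hlt|Heq].
    + exfalso. apply Hint. rewrite Hw. now apply univalent_open; [|lra].
    + destruct (polar_form z) as [t [Ht Hzt]]. exists t. split; auto. rewrite Hw, Hzt, Heq. reflexivity.
  - intros [t [Ht Hw]]. assert (Hp : Cmod (RtoC r * cis t)%C = r) by (apply Cmod_polar; lra). split.
    + intros V HV. apply locally_Cmod in HV. destruct HV as [d [Hd HV]].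
      assert (Hfz : ccontC f (RtoC r * cis t)%C) by (apply Hfc; lra).
      destruct (proj1 (ccont_eps _ _) Hfz (mkposreal d Hd)) as [e He]. assert (Hep := cond_pos e).
      (* A radius strictly between 0 and [r] at distance less than [e] from [r], even when [e]
         exceeds [r]. *)
      set (s := Rmax (r / 2) (r - e / 2)).
      assert (Hs : 0 < s < r /\ r - s < e). { unfold s, Rmax. destruct Rle_dec; lra. }
      exists (f (RtoC s * cis t)%C). split.
      * apply HV. rewrite Hw. apply He. change (Cmod (RtoC s * cis t - RtoC r * cis t)%C < e).
        replace (RtoC s * cis t - RtoC r * cis t)%C with (- (RtoC (r - s) * cis t))%C by (rewrite RtoC_minus; ring).
        rewrite Cmod_opp, Cmod_polar; lra.
      * exists (RtoC s * cis t)%C. split; auto. unfold disk. rewrite Cmod_polar; lra.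
    + intros HV. apply locally_Cmod in HV. destruct HV as [d [Hd HV]].
      destruct (HV w) as [z [Hz Hzw]]. { replace (w - w)%C with (RtoC 0) by ring. now rewrite Cmod_0. }
      unfold disk in Hz. rewrite Hw in Hzw. apply Hinj in Hzw; try lra. rewrite Hzw in Hz. lra.
Qed.

Lemma L_univalent r : 0 < r < 1 -> L f r = r * modulus_mean (C_derive f) r.
Proof.
  intros Hr. assert (HPI := twoPI_pos).
  set (gam := fun t => f (RtoC r * cis t)%C).
  set (dgam := fun t => (C_derive f (RtoC r * cis t) * (Ci * (RtoC r * cis t)))%C).
  assert (Hp : forall t, Cmod (RtoC r * cis t)%C = r) by (intros; apply Cmod_polar; lra).
  assert (Hder : forall t, is_derive (K := R_AbsRing) (V := C_R_NormedModule) gam t (dgam t)).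
  { intros t. apply circle_derive; [lra|]. destruct (Hf (RtoC r * cis t)%C) as [d Hd]. rewrite Hp; lra.
    now rewrite (C_derive_unique _ _ _ Hd). }
  assert (Hcont : forall t, ccont dgam t).
  { intros t. apply ccont_mult.
    - apply ccont_on_circle. lra. intros v Hv. apply (holomorphic_in_continuous _ 1 (holomorphic_derivative f 1 Hf)). lra.
    - apply ccont_mult. apply ccont_const. apply ccont_mult. apply ccont_const. apply ccont_cis, continuous_id. }
  set (B := boundary (image f (disk r))).
  assert (Hup : Rbar_le (hausdorff1 B) (speed_int dgam 0 (2 * PI))).
  { apply (hausdorff1_curve_upper gam dgam Hder Hcont). lra. intros z Hz. now apply boundary_image_disk. }
  assert (Hlow : Rbar_le (speed_int dgam 0 (2 * PI)) (hausdorff1 B)).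
  (* The closed curve repeats its starting point at 2 pi, so the lower bound applies only to the arc
     on [0, 2 pi - k]; afterwards k tends to 0. *)
  { assert (Hk : forall k, 0 < k < 2 * PI -> Rbar_le (speed_int dgam 0 (2 * PI - k)) (hausdorff1 B)).
    { intros k Hk. apply (hausdorff1_curve_lower gam dgam Hder Hcont); [lra| |].
      - intros s t Hs Ht E. apply cis_inj; try lra. apply Hinj in E; try (rewrite Hp; lra).
        replace (cis s) with (/ RtoC r * (RtoC r * cis s))%C. rewrite E. field. apply Cmod_gt_0; rewrite Cmod_R, Rabs_pos_eq; lra.
        field. apply Cmod_gt_0; rewrite Cmod_R, Rabs_pos_eq; lra.
      - intros t Ht. apply boundary_image_disk; auto. exists t. split; [lra|reflexivity]. }
    assert (H0 := hausdorff1_ge_0 B). destruct (hausdorff1 B) as [h| |]; simpl in *; try contradiction; auto.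
    destruct (cont_bounded dgam 0 (2 * PI)) as [K [HK HKb]]; [lra|intros t _; apply Hcont|].
    apply le_epsilon. intros e He.
    (* The speed is at most [K], so the omitted arc has length at most k K <= e; the cap at pi keeps
       k below 2 pi. *)
    set (k := Rmin PI (e / K)). assert (Hkp : 0 < k). { apply Rmin_pos. lra. now apply Rdiv_lt_0_compat. }
    assert (Hk1 : k <= PI) by apply Rmin_l. assert (Hk2 : k * K <= e). { apply Rle_div_r; auto. apply Rmin_r. }
    specialize (Hk k ltac:(lra)).
    unfold speed_int in *. rewrite <- (RInt_Chasles (fun t => Cmod (dgam t)) 0 (2 * PI - k) (2 * PI)) by (apply ex_speed; auto).
    change (RInt (fun t => Cmod (dgam t)) 0 (2 * PI - k) + RInt (fun t => Cmod (dgam t)) (2 * PI - k) (2 * PI) <= h + e).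
    assert (HI : RInt (fun t => Cmod (dgam t)) (2 * PI - k) (2 * PI) <= k * K).
    { replace (k * K) with ((2 * PI - (2 * PI - k)) * K) by ring.
      rewrite <- (RInt_const (V := R_CompleteNormedModule) (2 * PI - k) (2 * PI) K : RInt (fun _ => K) _ _ = (2 * PI - (2 * PI - k)) * K).
      apply RInt_le; [lra|apply ex_speed; auto|apply ex_RInt_const|]. intros t Ht. apply HKb. lra. }
    lra. }
  assert (E : hausdorff1 B = speed_int dgam 0 (2 * PI)) by now apply Rbar_le_antisym.
  unfold L. fold B. rewrite E. simpl. unfold speed_int, modulus_mean.
  rewrite (RInt_ext _ (fun a => scal r (Cmod (C_derive f (RtoC r * cis a)%C)))).
  - apply (RInt_scal (V := R_CompleteNormedModule)).
    apply ex_RInt_cont; [lra|]. intros t _. apply ccont_Cmod. apply ccont_on_circle. lra.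
    intros v Hv. apply (holomorphic_in_continuous _ 1 (holomorphic_derivative f 1 Hf)). lra.
  - intros t _. unfold dgam. rewrite !Cmod_mult, Cmod_Ci, Cmod_cis, Cmod_R, Rabs_pos_eq by lra.
    change (Cmod (C_derive f (RtoC r * cis t)%C) * (1 * (r * 1)) = r * Cmod (C_derive f (RtoC r * cis t)%C)). ring.
Qed.
End Univalent.

(** * The length function *)

Lemma cderiv_linear (f : C -> C) (a0 a1 z : C) : (forall z, Cmod z < 1 -> f z = (a0 + a1 * z)%C) ->
  Cmod z < 1 -> cderiv f z a1.
Proof.
  intros Hf Hz. apply cderiv_ext_loc with (fun z => a0 + a1 * z)%C.
  - destruct (open_disk_near z 1 Hz) as [del Hdel]. exists del. intros w Hw. symmetry. apply Hf. now apply Hdel.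
  - apply cderiv_affine.
Qed.

Lemma modulus_mean_const (g : C -> C) (c : C) t : 0 <= t < 1 -> (forall z, Cmod z < 1 -> g z = c) ->
  modulus_mean g t = 2 * PI * Cmod c.
Proof.
  intros Ht Hg. unfold modulus_mean. rewrite (RInt_ext _ (fun _ => Cmod c)).
  - rewrite RInt_const, Rminus_0_r. reflexivity.
  - intros a _. rewrite Hg; [reflexivity|]. rewrite Cmod_polar; lra.
Qed.

(** For univalent [f] the function [m] is the mean of [|f'|] over circles; for
    [a0 + a z^(k+1)] it is [|a| t^k], without the factor [k + 1], because [L]
    does not count multiplicity. *)
Definition length_profile (f : C -> C) (m : R -> R) : Prop :=
  (forall t, 0 < t < 1 -> L f t = 2 * PI * t * m t) /\
  (forall t, 0 <= t < 1 -> continuous m t) /\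
  (forall r s, 0 <= r <= s -> s < 1 -> m r <= m s) /\
  m 0 = Cmod (C_derive f 0%C) /\
  (linear_map f -> forall t, 0 <= t < 1 -> m t = m 0) /\
  (~ linear_map f -> forall r s, 0 < r < s -> s < 1 -> m r < m s) /\
  (constant_map f -> forall t, 0 <= t < 1 -> m t = 0) /\
  (~ constant_map f -> forall t, 0 < t < 1 -> 0 < m t).

Lemma constant_is_linear f : constant_map f -> linear_map f.
Proof. intros [a Ha]. exists a, 0%C. intros z Hz. rewrite Ha by auto. ring. Qed.

Lemma length_profile_univalent f : univalent f -> exists m, length_profile f m.
Proof.
  intros [Hhol Hinj]. assert (HPI := twoPI_pos).
  assert (Hf : holomorphic_in f 1).
  { intros z Hz. destruct (Hhol z Hz) as [d Hd]. exists d. now apply cderiv_of_is_derive. }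
  assert (Hg := holomorphic_derivative f 1 Hf).
  assert (Hfd : forall z, Cmod z < 1 -> cderiv f z (C_derive f z)).
  { intros z Hz. destruct (Hf z Hz) as [d Hd]. now rewrite (C_derive_unique _ _ _ Hd). }
  set (M := modulus_mean (C_derive f)).
  assert (Hlin : linear_map f -> exists a1, forall t, 0 <= t < 1 -> M t = 2 * PI * Cmod a1).
  { intros [a0 [a1 Ha]]. exists a1. intros t Ht. apply modulus_mean_const; auto.
    intros z Hz. apply C_derive_unique. now apply cderiv_linear with a0. }
  assert (Hstr : ~ linear_map f -> forall r s, 0 < r < s -> s < 1 -> M r < M s).
  { intros Hnl r s Hr Hs. destruct (modulus_mean_max (C_derive f) Hg s ltac:(lra) r ltac:(lra)) as [Hlt|Heq]; auto.
    exfalso. apply Hnl. destruct (modulus_mean_strict (C_derive f) Hg r s Hr Hs Heq) as [c Hc].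
    (* Equal means make f' a constant [c]; then f - c z has zero derivative, on the circle of radius
       1/2 in particular, so [f] is linear. *)
    destruct (zero_derivative_constant (fun z => f z - c * z)%C (1 / 2)) as [a Ha]; [lra| | |].
    - intros z Hz. eexists. apply cderiv_minus. now apply Hfd. apply cderiv_mult. apply cderiv_const. apply cderiv_id.
    - intros z Hz. apply cderiv_eq with (C_derive f z - (0 * z + c * 1))%C.
      + apply cderiv_minus. apply Hfd; lra. apply cderiv_mult. apply cderiv_const. apply cderiv_id.
      + rewrite Hc by lra. ring.
    - exists a, c. intros z Hz. rewrite <- (Ha z) by auto. ring. }
  assert (Hnc : ~ constant_map f).
  { intros [a Ha]. assert (E : RtoC 0 = RtoC (1 / 2)).
    { apply Hinj; unfold disk; rewrite ?Cmod_0, ?Cmod_R, ?Rabs_pos_eq; try lra.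
      rewrite !Ha; auto; unfold disk; rewrite ?Cmod_0, ?Cmod_R, ?Rabs_pos_eq; lra. }
    apply RtoC_inj in E. lra. }
  assert (HM0 : forall t, 0 <= t < 1 -> 0 <= M t).
  { intros t Ht. apply RInt_ge_0; [lra| |intros; apply Cmod_ge_0]. apply ex_RInt_cont; [lra|].
    intros a _. apply ccont_Cmod, ccont_on_circle. lra. intros v Hv. apply (holomorphic_in_continuous _ 1 Hg). lra. }
  assert (Hpos : forall t, 0 < t < 1 -> 0 < M t).
  (* A linear [f] has constant mean, nonzero because [f] is not constant; for any other [f], strict
     growth from t/2 to t gives positivity. *)
  { intros t Ht. destruct (classic (linear_map f)) as [Hl|Hl].
    - destruct (HM0 t) as [H|H]; auto; [lra|]. exfalso. apply Hnc.
      destruct Hl as [a0 [a1 Ha]].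
      assert (E : M t = 2 * PI * Cmod a1).
      { apply modulus_mean_const; [lra|]. intros z Hz. apply C_derive_unique. now apply cderiv_linear with a0. }
      assert (Z : Cmod a1 = 0) by nra. apply Cmod_eq_0 in Z. exists a0. intros z Hz. rewrite Ha by auto. rewrite Z. ring.
    - apply Rle_lt_trans with (M (t / 2)). apply HM0; lra. apply Hstr; auto; lra. }
  assert (Hdiv : forall a b, a <= b -> a / (2 * PI) <= b / (2 * PI)).
  { intros a b Hab. apply Rmult_le_compat_r; auto. now apply Rlt_le, Rinv_0_lt_compat. }
  exists (fun t => M t / (2 * PI)). repeat split.
  - intros t Ht. rewrite (L_univalent f Hf Hinj t Ht). fold M. field. lra.
  - intros t Ht. apply (continuous_scal_l (K := R_AbsRing) (V := R_NormedModule) M (/ (2 * PI))).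
    apply modulus_mean_continuous; auto. rewrite Rabs_pos_eq; lra.
  - intros r s Hr Hs. apply Hdiv. apply modulus_mean_max; auto; lra.
  - unfold M. rewrite modulus_mean_0. field. lra.
  - intros Hl t Ht. destruct (Hlin Hl) as [a1 H1]. rewrite !H1; auto. lra.
  - intros Hl r s Hr Hs. apply Rmult_lt_compat_r. now apply Rinv_0_lt_compat. now apply Hstr.
  - intros Hcm. now elim Hnc.
  - intros _ t Ht. apply Rdiv_lt_0_compat; auto.
Qed.

Lemma real_root (n : nat) x : (1 <= n)%nat -> 0 <= x -> exists y, 0 <= y /\ y ^ n = x.
Proof.
  intros Hn Hx. destruct Hx as [Hx|<-].
  - exists (Rpower x (/ INR n)). assert (Hp : 0 < Rpower x (/ INR n)) by apply exp_pos. split; [lra|].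
    rewrite <- Rpower_pow by auto. rewrite Rpower_mult, Rinv_l, Rpower_1; auto. apply not_0_INR. lia.
  - exists 0. split; [lra|]. now apply pow_i.
Qed.
Lemma cis_pow t n : Cpow (cis t) n = cis (INR n * t).
Proof.
  induction n.
  - simpl. now rewrite Rmult_0_l, cis_0.
  - rewrite S_INR, Rmult_plus_distr_r, Rmult_1_l, Rplus_comm, cis_plus, <- IHn. reflexivity.
Qed.

(** Both maps have the disk of radius [|a| t^(k+1)] about [a0] as image, so the
    monomial case reduces to a univalent map. *)
Lemma image_monomial (f : C -> C) (a0 a : C) k t : 0 < t < 1 ->
  (forall z, Cmod z < 1 -> f z = (a0 + a * Cpow z (S k))%C) ->
  image f (disk t) = image (fun z => a0 + (a * RtoC (t ^ k)) * z)%C (disk t).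
Proof.
  intros Ht Hf. apply functional_extensionality. intros w. apply propositional_extensionality.
  assert (Htk : 0 < t ^ k) by (apply pow_lt; lra).
  unfold image, disk. split.
  - intros [z [Hz Hw]]. exists (Cpow z (S k) / RtoC (t ^ k))%C.
    assert (Hne : RtoC (t ^ k) <> 0%C) by (intros E; apply RtoC_inj in E; lra).
    split.
    + rewrite Cmod_div, Cmod_pow, Cmod_R, Rabs_pos_eq by (auto; lra).
      apply Rlt_div_l; auto. simpl. assert (H0 := Cmod_ge_0 z).
      assert (Cmod z ^ k <= t ^ k) by (apply pow_incr; lra). nra.
    + rewrite <- Hw, Hf by lra. field. auto.
  - intros [z [Hz Hw]]. destruct (polar_form z) as [th [_ Hth]].
    assert (H0 := Cmod_ge_0 z).
    (* A preimage under the power map is built in polar form: the (k+1)-th root of the modulus t^k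
       |z|, with the angle divided by k + 1. *)
    destruct (real_root (S k) (t ^ k * Cmod z)) as [y [Hy Hyk]]; [lia|nra|].
    assert (Hyt : y < t).
    { apply Rnot_le_lt. intros Hle. assert (H : t ^ S k <= y ^ S k) by (apply pow_incr; lra).
      rewrite Hyk in H. change (t ^ S k) with (t * t ^ k) in H. nra. }
    exists (RtoC y * cis (th / INR (S k)))%C. split. { rewrite Cmod_polar; lra. }
    rewrite Hf by (rewrite Cmod_polar; lra). rewrite Cpow_mult_l, cis_pow, <- RtoC_pow, Hyk.
    replace (INR (S k) * (th / INR (S k))) with th by (field; apply not_0_INR; lia).
    rewrite RtoC_mult. transitivity (a0 + (a * RtoC (t ^ k)) * (RtoC (Cmod z) * cis th))%C; [ring|].
    rewrite <- Hth. exact Hw.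
Qed.

(** The boundary lies in the closure of a single point, covered by a constant curve with [F] = 0. *)
Lemma L_point (f : C -> C) (a0 : C) t : 0 < t < 1 -> (forall z, Cmod z < 1 -> f z = a0) -> L f t = 0.
Proof.
  intros Ht Hf. set (B := boundary (image f (disk t))).
  assert (Hup : Rbar_le (hausdorff1 B) (0 - 0)).
  { apply (hausdorff1_le_curve (fun _ => a0) (fun _ => 0) 0 0 0); try lra.
    - intros u v _ _. replace (a0 - a0)%C with (RtoC 0) by ring. rewrite Cmod_0. lra.
    - intros z [Hz _]. exists 0. split; [lra|]. apply NNPP. intros Hne.
      assert (Hp := proj1 (Cmod_gt_0 _) (Cminus_neq z a0 Hne)).
      destruct (Hz (fun v => Cmod (v - z)%C < Cmod (z - a0)%C)) as [v [Hv [x [Hx Hxv]]]].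
      { apply locally_Cmod. now exists (Cmod (z - a0)%C). }
      unfold disk in Hx. rewrite Hf in Hxv by lra. subst v. rewrite Cmod_minus_sym in Hv. lra. }
  assert (H0 := hausdorff1_ge_0 B). unfold L. fold B.
  destruct (hausdorff1 B) as [h| |]; simpl in *; try contradiction; lra.
Qed.

Lemma pow_lt_strict r s k : 0 <= r < s -> r ^ S k < s ^ S k.
Proof.
  intros H. induction k; [simpl; lra|]. change (r * r ^ S k < s * s ^ S k).
  assert (0 <= r ^ S k) by (apply pow_le; lra). nra.
Qed.

Lemma cderiv_pow k (z : C) : exists d, cderiv (fun z => Cpow z k) z d.
Proof.
  induction k as [|k [d IH]]; simpl.
  - exists 0%C. apply cderiv_const.
  - eexists. apply (cderiv_mult (fun z => z)). apply cderiv_id. exact IH.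
Qed.

Lemma length_profile_monomial f : monomial_map f -> exists m, length_profile f m.
Proof.
  intros (a0 & a & n & Hn & Hf). destruct n as [|k]; [lia|].
  change (forall z : C, Cmod z < 1 -> f z = (a0 + a * Cpow z (S k))%C) in Hf.
  assert (HPI := twoPI_pos).
  (* Writing z^(k+1) as z^k z avoids a formula for the derivative of powers: at 0 only z^k survives.
     The value is [a] for k = 0 and 0 otherwise, in agreement with |a| t^k at t = 0. *)
  assert (HD : C_derive f 0 = (a * Cpow 0 k)%C).
  { apply C_derive_unique. apply cderiv_ext_loc with (fun z => a0 + (a * Cpow z k) * z)%C.
    - exists (mkposreal 1 Rlt_0_1). intros w Hw. change (Cmod (w - 0)%C < 1) in Hw.
      replace (w - 0)%C with w in Hw by ring. rewrite Hf by auto. simpl. ring.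
    - destruct (cderiv_pow k 0) as [d Hd].
      apply cderiv_eq with (0 + ((0 * Cpow 0 k + a * d) * 0 + (a * Cpow 0 k) * 1))%C; [|ring].
      apply (cderiv_plus (fun _ => a0) (fun z => (a * Cpow z k) * z)%C). apply cderiv_const.
      apply (cderiv_mult (fun z => a * Cpow z k)%C (fun z => z)); [|apply cderiv_id].
      apply (cderiv_mult (fun _ => a) (fun z => Cpow z k)). apply cderiv_const. exact Hd. }
  assert (Hconst : constant_map f -> a = 0%C).
  { intros [b Hb]. assert (E1 := Hb 0%C). assert (E2 := Hb (RtoC (1 / 2))). unfold disk in E1, E2.
    rewrite Cmod_0 in E1. rewrite Cmod_R, Rabs_pos_eq in E2 by lra.
    specialize (E1 Rlt_0_1). specialize (E2 ltac:(lra)).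
    rewrite Hf in E1 by (rewrite Cmod_0; lra). rewrite Hf in E2 by (rewrite Cmod_R, Rabs_pos_eq; lra).
    assert (Hh : Cpow (RtoC (1 / 2)) (S k) <> 0%C).
    { rewrite <- RtoC_pow. intros E. apply RtoC_inj in E. assert (0 < (1 / 2) ^ S k) by (apply pow_lt; lra). lra. }
    assert (Z : (a * Cpow (RtoC (1 / 2)) (S k))%C = 0%C).
    { replace (a * Cpow (RtoC (1 / 2)) (S k))%C with ((a0 + a * Cpow (RtoC (1 / 2)) (S k)) - (a0 + a * Cpow 0 (S k)))%C by (simpl; ring).
      rewrite E1, E2. ring. }
    replace a with (a * Cpow (RtoC (1 / 2)) (S k) * / Cpow (RtoC (1 / 2)) (S k))%C by (field; auto). rewrite Z. ring. }
  assert (Hlin : linear_map f -> a = 0%C \/ k = O).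
  { intros [b0 [b1 Hb]]. destruct k as [|k]; [now right|left].
    assert (E : forall x, 0 <= x < 1 -> (a0 + a * RtoC (x ^ S (S k)))%C = (b0 + b1 * RtoC x)%C).
    { intros x Hx. rewrite RtoC_pow, <- Hf, Hb; auto; unfold disk; rewrite Cmod_R, Rabs_pos_eq; lra. }
    (* The value at 0 gives a0 = b0. With x = (1/2)^(k+2), the values at 1/2 and 1/4 give a x = b1/2
       and a x^2 = b1/4, so a (x - 2 x^2) = 0, and x <= 1/4 makes the factor positive. *)
    assert (E0 := E 0 ltac:(lra)). assert (E1 := E (1 / 2) ltac:(lra)). assert (E2 := E (1 / 4) ltac:(lra)).
    rewrite pow_i in E0 by lia.
    set (x := (1 / 2) ^ S (S k)) in *.
    assert (Ex : (1 / 4) ^ S (S k) = x * x). { unfold x. rewrite <- Rpow_mult_distr. f_equal. field. }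
    rewrite Ex in E2.
    assert (Hx : 0 < x <= 1 / 4).
    { unfold x. split. apply pow_lt; lra. simpl. assert (H : 0 < (1 / 2) ^ k) by (apply pow_lt; lra).
      assert ((1 / 2) ^ k <= 1 ^ k) by (apply pow_incr; lra). rewrite pow1 in H0. nra. }
    assert (Z : (a * RtoC (x - 2 * (x * x)))%C = 0%C).
    { assert (Ea : a0 = b0). { replace a0 with (a0 + a * RtoC 0)%C by ring. rewrite E0. ring. }
      subst b0. assert (F1 : (a * RtoC x)%C = (b1 * RtoC (1 / 2))%C).
      { replace (a * RtoC x)%C with (a0 + a * RtoC x - a0)%C by ring. rewrite E1. ring. }
      assert (F2 : (a * RtoC (x * x))%C = (b1 * RtoC (1 / 4))%C).
      { replace (a * RtoC (x * x))%C with (a0 + a * RtoC (x * x) - a0)%C by ring. rewrite E2. ring. }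
      replace (a * RtoC (x - 2 * (x * x)))%C with (a * RtoC x - 2 * (a * RtoC (x * x)))%C by (rewrite !RtoC_minus, !RtoC_mult; ring).
      rewrite F1, F2. replace (1 / 2) with (2 * (1 / 4)) by field. rewrite RtoC_mult. ring. }
    assert (Hne : RtoC (x - 2 * (x * x)) <> 0%C) by (intros Hz; apply RtoC_inj in Hz; nra).
    replace a with (a * RtoC (x - 2 * (x * x)) * / RtoC (x - 2 * (x * x)))%C by (field; auto). rewrite Z. ring. }
  assert (Ha0 : a = 0%C -> constant_map f).
  { intros ->. exists a0. intros z Hz. rewrite Hf by auto. ring. }
  assert (Hk0 : k = O -> linear_map f).
  { intros ->. exists a0, a. intros z Hz. rewrite Hf by auto. simpl. ring. }
  assert (Hapos : a <> 0%C -> 0 < Cmod a) by apply Cmod_gt_0.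
  assert (Ham := Cmod_ge_0 a).
  exists (fun t => Cmod a * t ^ k). repeat split.
  (* For a = 0 the comparison map would be constant, not injective, so that case is computed
     directly. Otherwise [L] sees [f] only through its image and may be evaluated on the linear
     map. *)
  - intros t Ht. destruct (Ceq_dec a 0) as [->|Hne].
    + rewrite (L_point f a0 t Ht). rewrite Cmod_0. ring. intros z Hz. rewrite Hf by auto. ring.
    + unfold L. rewrite (image_monomial f a0 a k t Ht Hf).
      assert (Htk : 0 < t ^ k) by (apply pow_lt; lra).
      set (b := (a * RtoC (t ^ k))%C).
      assert (Hb : Cmod b = Cmod a * t ^ k) by (unfold b; rewrite Cmod_mult, Cmod_R, Rabs_pos_eq; lra).
      assert (Hbn : b <> 0%C). { apply Cmod_gt_0. rewrite Hb. apply Rmult_lt_0_compat; auto. }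
      change (L (fun z => a0 + b * z)%C t = 2 * PI * t * (Cmod a * t ^ k)).
      rewrite L_univalent; auto.
      * rewrite (modulus_mean_const _ b t); [rewrite Hb; ring|lra|].
        intros z _. apply C_derive_unique, cderiv_affine.
      * intros z _. exists b. apply cderiv_affine.
      * intros z w _ _ E. replace z with (((a0 + b * z) - a0) * / b)%C by (field; auto). rewrite E. field. auto.
  - intros t Ht. apply (continuous_scal_r (V := R_NormedModule) (Cmod a) (fun t => t ^ k)).
    apply continuity_pt_filterlim. apply derivable_continuous_pt. apply derivable_pt_pow.
  - intros r s Hr Hs. apply Rmult_le_compat_l; auto. apply pow_incr. lra.
  - rewrite HD, Cmod_mult, Cmod_pow, Cmod_0. reflexivity.
  - intros Hl t Ht. destruct (Hlin Hl) as [->| ->]. rewrite Cmod_0; ring. simpl. ring.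
  - intros Hl r s Hr Hs. destruct k as [|k]. now elim Hl; apply Hk0.
    assert (a <> 0%C). { intros E. apply Hl, constant_is_linear, Ha0, E. }
    apply Rmult_lt_compat_l; auto. apply pow_lt_strict. lra.
  - intros Hc t Ht. rewrite (Hconst Hc), Cmod_0. ring.
  - intros Hc t Ht. apply Rmult_lt_0_compat. apply Hapos. intros E. now apply Hc, Ha0. apply pow_lt; lra.
Qed.

(** * Weighted means of monotone functions *)

Section WeightedMean.
Variables psi w : R -> R.
Hypothesis Hpsi : forall t, t < 1 -> continuous psi t.
Hypothesis Hw : forall t, -1 < t < 1 -> continuous w t.
Hypothesis Hw0 : forall t, 0 < t < 1 -> 0 < w t.
Hypothesis Hmono : forall r s, 0 <= r <= s -> s < 1 -> psi r <= psi s.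

(** For [w] the density this is [nu]. Continuity of [psi] and [w] is assumed across 0, so that the
    integrands are two-sidedly continuous at the endpoint 0. *)
Definition weight_int (r : R) : R := RInt w 0 r.
Definition weighted_int (r : R) : R := RInt (fun t => psi t * w t) 0 r.
Definition weighted_mean (r : R) : R := weighted_int r / weight_int r.

Let Hpw t : -1 < t < 1 -> continuous (fun t => psi t * w t) t.
Proof. intros Ht. apply (continuous_mult (K := R_AbsRing) psi w). apply Hpsi; lra. now apply Hw. Qed.
Let exw u v : 0 <= u <= v -> v < 1 -> ex_RInt w u v.
Proof. intros H1 H2. apply ex_RInt_cont. lra. intros t Ht. apply Hw. lra. Qed.
Let expw u v : 0 <= u <= v -> v < 1 -> ex_RInt (fun t => psi t * w t) u v.
Proof. intros H1 H2. apply ex_RInt_cont. lra. intros t Ht. apply Hpw. lra. Qed.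

Lemma weight_int_lt r s : 0 <= r < s -> s < 1 -> weight_int r < weight_int s.
Proof.
  intros Hr Hs. unfold weight_int. rewrite <- (RInt_Chasles w 0 r s) by (apply exw; lra).
  change (RInt w 0 r < RInt w 0 r + RInt w r s).
  assert (0 < RInt w r s); [|lra]. apply RInt_gt_0. lra.
  intros t Ht. apply Hw0. lra. intros t Ht. apply Hw. lra.
Qed.
Lemma weight_int_0 : weight_int 0 = 0.
Proof. apply (RInt_point (V := R_CompleteNormedModule)). Qed.
Lemma weight_int_pos r : 0 < r < 1 -> 0 < weight_int r.
Proof. intros Hr. rewrite <- weight_int_0. apply weight_int_lt; lra. Qed.

Let const_int c r : 0 <= r < 1 -> RInt (fun t => c * w t) 0 r = c * weight_int r.
Proof. intros Hr. apply (RInt_scal (V := R_CompleteNormedModule)). apply exw; lra. Qed.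
Let ex_const c r : 0 <= r < 1 -> ex_RInt (fun t => c * w t) 0 r.
Proof. intros Hr. apply (ex_RInt_scal (V := R_NormedModule)). apply exw; lra. Qed.
Let cont_const c t : -1 < t < 1 -> continuous (fun t => c * w t) t.
Proof. intros Ht. apply (continuous_scal_r (V := R_NormedModule) c w). now apply Hw. Qed.

Lemma weighted_mean_bounds r : 0 < r < 1 -> psi 0 <= weighted_mean r <= psi r.
Proof.
  intros Hr. assert (Hn := weight_int_pos r Hr). unfold weighted_mean. split.
  - apply Rle_div_r; auto. rewrite <- const_int by lra. apply RInt_le; [lra|apply ex_const; lra|apply expw; lra|].
    intros t Ht. apply Rmult_le_compat_r. apply Rlt_le, Hw0; lra. apply Hmono; lra.
  - apply Rle_div_l; auto. rewrite <- const_int by lra. apply RInt_le; [lra|apply expw; lra|apply ex_const; lra|].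
    intros t Ht. apply Rmult_le_compat_r. apply Rlt_le, Hw0; lra. apply Hmono; lra.
Qed.
Lemma weighted_mean_bounds_strict r : 0 < r < 1 -> (forall r s, 0 <= r < s -> s < 1 -> psi r < psi s) ->
  psi 0 < weighted_mean r < psi r.
Proof.
  intros Hr Hstrict. assert (Hn := weight_int_pos r Hr). unfold weighted_mean. split.
  - apply Rlt_div_r; auto. rewrite <- const_int by lra. apply RInt_lt; [lra| | |].
    intros t Ht. apply Hpw; lra. intros t Ht. apply cont_const; lra.
    intros t Ht. apply Rmult_lt_compat_r. apply Hw0; lra. apply Hstrict; lra.
  - apply Rlt_div_l; auto. rewrite <- const_int by lra. apply RInt_lt; [lra| | |].
    intros t Ht. apply cont_const; lra. intros t Ht. apply Hpw; lra.
    intros t Ht. apply Rmult_lt_compat_r. apply Hw0; lra. apply Hstrict; lra.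
Qed.

Let near_unit x : 0 < x < 1 -> locally x (fun u : R => 0 < u < 1).
Proof.
  intros Hx. assert (Hp : 0 < Rmin x (1 - x)) by (apply Rmin_pos; lra).
  exists (mkposreal _ Hp). intros u Hu. change (Rabs (u - x) < Rmin x (1 - x)) in Hu.
  assert (L1 := Rmin_l x (1 - x)). assert (L2 := Rmin_r x (1 - x)). apply Rabs_def2 in Hu. lra.
Qed.
Lemma weight_int_derive x : 0 < x < 1 -> is_derive weight_int x (w x).
Proof.
  intros Hx. apply (is_derive_RInt w weight_int 0 x).
  - generalize (near_unit x Hx). apply filter_imp. intros u Hu.
    apply (RInt_correct (V := R_CompleteNormedModule)). apply exw; lra.
  - apply Hw. lra.
Qed.
Lemma weighted_int_derive x : 0 < x < 1 -> is_derive weighted_int x (psi x * w x).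
Proof.
  intros Hx. apply (is_derive_RInt (fun t => psi t * w t) weighted_int 0 x).
  - generalize (near_unit x Hx). apply filter_imp. intros u Hu.
    apply (RInt_correct (V := R_CompleteNormedModule)). apply expw; lra.
  - apply Hpw. lra.
Qed.

(** With respect to [log weight_int] the mean has derivative [psi - weighted_mean]. *)
Lemma weighted_mean_quotient r s : 0 < r < s -> s < 1 -> exists c, r <= c <= s /\
  (weighted_mean s - weighted_mean r) / (ln (weight_int s) - ln (weight_int r)) = psi c - weighted_mean c.
Proof.
  intros Hr Hs.
  set (p := weighted_mean s - weighted_mean r). set (q := ln (weight_int s) - ln (weight_int r)).
  assert (Hq : 0 < q).
  { unfold q. assert (ln (weight_int r) < ln (weight_int s)); [|lra].
    apply ln_increasing. apply weight_int_pos; lra. apply weight_int_lt; lra. }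
  (* The auxiliary function of Cauchy's mean value theorem: it takes equal values at [r] and [s],
     and its derivative has the positive factor w / weight_int, so the other factor vanishes
     somewhere. *)
  assert (Hd : forall x, r <= x <= s -> is_derive (fun x => p * ln (weight_int x) - q * weighted_mean x) x
     ((p - q * (psi x - weighted_mean x)) * (w x / weight_int x))).
  { intros x Hx. assert (Hn := weight_int_pos x ltac:(lra)).
    assert (D1 := weight_int_derive x ltac:(lra)). assert (D2 := weighted_int_derive x ltac:(lra)).
    assert (E1 : ex_derive weight_int x) by now exists (w x).
    assert (E2 : ex_derive weighted_int x) by now exists (psi x * w x).
    apply is_derive_unique in D1. apply is_derive_unique in D2.
    unfold weighted_mean. auto_derive.
    - repeat split; auto. lra.
    - change (Derive (fun x => weight_int x) x) with (Derive weight_int x).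
      change (Derive (fun x => weighted_int x) x) with (Derive weighted_int x).
      rewrite D1, D2. field. lra. }
  destruct (MVT_gen (fun x => p * ln (weight_int x) - q * weighted_mean x) r s
    (fun x => (p - q * (psi x - weighted_mean x)) * (w x / weight_int x))) as [c [Hc Ec]].
  - rewrite Rmin_left, Rmax_right by lra. intros x Hx. apply Hd. lra.
  - rewrite Rmin_left, Rmax_right by lra. intros x Hx. apply continuity_pt_of_continuous.
    apply (ex_derive_continuous (V := R_NormedModule)). eexists. apply Hd. exact Hx.
  - rewrite Rmin_left, Rmax_right in Hc by lra. exists c. split; auto.
    assert (Hnz : 0 < w c / weight_int c) by (apply Rdiv_lt_0_compat; [apply Hw0|apply weight_int_pos]; lra).
    replace (p * ln (weight_int s) - q * weighted_mean s - (p * ln (weight_int r) - q * weighted_mean r)) with 0 in Ec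
      by (unfold p, q; ring).
    symmetry in Ec. apply Rmult_integral in Ec. destruct Ec as [Ec|Ec]; [|lra].
    apply Rmult_integral in Ec. destruct Ec as [Ec|Ec]; [|lra].
    clearbody p q. apply (Rmult_eq_reg_l q); [|lra]. replace (q * (p / q)) with p by (field; lra).
    exact (Rminus_diag_uniq _ _ Ec).
Qed.

(** The mean is squeezed between psi 0 and psi r. *)
Lemma weighted_mean_at_0 : filterlim weighted_mean (at_right 0) (locally (psi 0)).
Proof.
  apply (filterlim_locally (U := R_UniformSpace)). intros eps.
  destruct (proj1 (filterlim_locally (U := R_UniformSpace) psi (psi 0)) (Hpsi 0 Rlt_0_1) eps) as [del Hdel].
  assert (Hp : 0 < Rmin del 1) by (apply Rmin_pos; [apply cond_pos|lra]).
  assert (L1 := Rmin_l del 1). assert (L2 := Rmin_r del 1).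
  assert (H : forall r : R, Rabs (r - 0) < Rmin del 1 -> 0 < r -> Rabs (weighted_mean r - psi 0) < eps).
  { intros r Hr Hr0. rewrite Rminus_0_r, Rabs_pos_eq in Hr by lra.
    assert (Hr1 : 0 < r < 1) by lra. assert (Hb := weighted_mean_bounds r Hr1).
    assert (Hc : Rabs (psi r - psi 0) < eps).
    { apply Hdel. change (Rabs (r - 0) < del). rewrite Rminus_0_r, Rabs_pos_eq; lra. }
    apply Rabs_def2 in Hc. apply Rabs_def1; lra. }
  exists (mkposreal _ Hp). exact H.
Qed.
End WeightedMean.

(** The limit is the supremum in the extended reals: it exists before its finiteness is assumed, and
    as an upper bound of [psi] it later supplies the Lipschitz constant. *)
Lemma monotone_limit_at_1 (psi : R -> R) : (forall r s, 0 <= r <= s -> s < 1 -> psi r <= psi s) ->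
  exists l : Rbar, filterlim psi (at_left 1) (Rbar_locally l) /\ forall t, 0 <= t < 1 -> Rbar_le (psi t) l.
Proof.
  intros Hmono. set (E := fun x => exists t, 0 <= t < 1 /\ x = psi t).
  destruct (Lub_Rbar_correct E) as [Hub Hlub]. exists (Lub_Rbar E).
  assert (Hle : forall t, 0 <= t < 1 -> Rbar_le (psi t) (Lub_Rbar E)).
  { intros t Ht. apply Hub. now exists t. }
  split; [|exact Hle].
  assert (Happ : forall y : R, Rbar_lt y (Lub_Rbar E) -> exists t, 0 <= t < 1 /\ y < psi t).
  { intros y Hy. apply NNPP. intros Hno. apply (Rbar_lt_not_le _ _ Hy). apply Hlub.
    intros x (t & Ht & ->). simpl. apply Rnot_lt_le. intros Hlt. apply Hno. now exists t. }
  assert (Hev : forall t, 0 <= t < 1 -> at_left 1 (fun s => t < s /\ 0 <= s < 1)).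
  { intros t Ht. assert (Hp : 0 < 1 - t) by lra. exists (mkposreal _ Hp).
    intros s Hs Hs1. change (Rabs (s - 1) < 1 - t) in Hs. apply Rabs_def2 in Hs. lra. }
  destruct (Lub_Rbar E) as [l| |].
  - apply (filterlim_locally (U := R_UniformSpace) psi l). intros eps.
    assert (He := cond_pos eps). destruct (Happ (l - eps)) as [t [Ht Hlt]]. simpl; lra.
    generalize (Hev t Ht). apply filter_imp. intros s [Hs1 Hs2].
    assert (H1 := Hmono t s ltac:(lra) ltac:(lra)). assert (H2 := Hle s Hs2). simpl in H2.
    change (Rabs (psi s - l) < eps). apply Rabs_def1; lra.
  - intros P [M HM]. destruct (Happ M I) as [t [Ht Hlt]].
    change (at_left 1 (fun s => P (psi s))). generalize (Hev t Ht). apply filter_imp. intros s [Hs1 Hs2]. apply HM.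
    assert (H1 := Hmono t s ltac:(lra) ltac:(lra)). lra.
  - specialize (Hle 0 ltac:(lra)). contradiction.
Qed.

(** * The density and the continuation of [Phi_L] to 0 *)

Lemma mu_density_continuous alpha t : -1 < t < 1 -> continuous (mu_density alpha) t.
Proof.
  intros Ht. assert (Hp : 0 < 1 - t ^ 2) by nra.
  apply (ex_derive_continuous (V := R_NormedModule)). unfold mu_density, Rpower.
  auto_derive. simpl in *. lra.
Qed.
Lemma mu_density_pos alpha t : 0 < t < 1 -> 0 < mu_density alpha t.
Proof. intros Ht. apply Rmult_lt_0_compat. apply exp_pos. lra. Qed.

Lemma Rpower_small g eps : 0 < g -> 0 < eps -> exists d, 0 < d /\ forall x, 0 < x < d -> Rpower x g < eps.
Proof.
  intros Hg He. exists (Rpower eps (/ g)). split. apply exp_pos. intros x Hx.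
  replace eps with (Rpower (Rpower eps (/ g)) g).
  - apply Rlt_Rpower_l; lra.
  - rewrite Rpower_mult, Rinv_l, Rpower_1; lra.
Qed.

(** [Phi_L beta f] on (0, 1), continued to [t <= 0] by its limit at 0. *)
Definition Phi_ext (beta : R) (m : R -> R) (t : R) : R :=
  if Rle_dec t 0 then (if Req_dec_T beta 1 then m 0 else 0) else Rpower (2 * PI * t) (1 - beta) * m t.

Section Profile.
Variables (beta : R) (f : C -> C) (m : R -> R).
Hypothesis Hbeta : 0 <= beta <= 1.
Hypothesis Hm : length_profile f m.

Let psi := Phi_ext beta m.

Lemma Phi_ext_spec t : 0 < t < 1 -> Phi_L beta f t = psi t.
Proof.
  intros Ht. assert (HPI := PI_RGT_0). assert (Hx : 0 < 2 * PI * t) by nra.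
  unfold psi, Phi_ext, Phi_L. destruct (Rle_dec t 0) as [|_]; [lra|].
  rewrite (proj1 Hm t Ht). unfold Rminus. rewrite Rpower_plus, Rpower_Ropp, Rpower_1 by auto.
  field. apply Rgt_not_eq, exp_pos.
Qed.

Let m_nonneg t : 0 <= t < 1 -> 0 <= m t.
Proof.
  intros Ht. destruct Hm as (_ & _ & Hmono & H0 & _). apply Rle_trans with (m 0).
  rewrite H0. apply Cmod_ge_0. apply Hmono; lra.
Qed.

Lemma Phi_ext_continuous t : t < 1 -> continuous psi t.
Proof.
  intros Ht. assert (HPI := PI_RGT_0). destruct Hm as (_ & Hc & Hmono & _).
  destruct (Rtotal_order t 0) as [Hlt|[->|Hgt]].
  - apply continuous_ext_loc with (fun _ => psi 0); [|apply continuous_const].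
    assert (Hp : 0 < - t) by lra. exists (mkposreal _ Hp). intros u Hu. change (Rabs (u - t) < - t) in Hu.
    apply Rabs_def2 in Hu. unfold psi, Phi_ext.
    destruct (Rle_dec 0 0) as [_|]; [|lra]. destruct (Rle_dec u 0) as [_|]; [reflexivity|lra].
  - apply (filterlim_locally (U := R_UniformSpace)). intros eps. assert (He := cond_pos eps).
    assert (P0 : psi 0 = if Req_dec_T beta 1 then m 0 else 0).
    { unfold psi, Phi_ext. destruct (Rle_dec 0 0) as [_|]; [reflexivity|lra]. }
    enough (H : exists d, 0 < d /\ forall u, 0 < u < d -> Rabs (Rpower (2 * PI * u) (1 - beta) * m u - (if Req_dec_T beta 1 then m 0 else 0)) < eps).
    { destruct H as [d [Hd H]].
      assert (H' : forall u : R, Rabs (u - 0) < d -> Rabs (psi u - psi 0) < eps).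
      { intros u Hu. rewrite Rminus_0_r in Hu. rewrite P0. unfold psi, Phi_ext. destruct (Rle_dec u 0) as [Hle|Hgt].
        - rewrite Rminus_diag, Rabs_R0. exact He.
        - apply H. rewrite Rabs_pos_eq in Hu; lra. }
      exists (mkposreal d Hd). exact H'. }
    destruct (Req_dec_T beta 1) as [Hb|Hb].
    + destruct (proj1 (filterlim_locally (U := R_UniformSpace) m (m 0)) (Hc 0 (conj (Rle_refl 0) Rlt_0_1)) eps) as [d Hd].
      exists d. split. apply cond_pos. intros u Hu. rewrite Hb, Rminus_diag, Rpower_O, Rmult_1_l by nra.
      apply Hd. change (Rabs (u - 0) < d). rewrite Rminus_0_r, Rabs_pos_eq; lra.
    (* Monotonicity bounds m u by [M] for u <= 1/2, so the power with positive exponent 1 - beta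
       drives the product to 0. *)
    + set (M := m (1 / 2)). assert (HM : 0 <= M) by (apply m_nonneg; lra).
      destruct (Rpower_small (1 - beta) (eps / (M + 1))) as [d [Hd H]]; [lra|apply Rdiv_lt_0_compat; lra|].
      exists (Rmin (1 / 2) (d / (2 * PI))). split. { apply Rmin_pos. lra. apply Rdiv_lt_0_compat; lra. }
      intros u Hu. assert (L1 := Rmin_l (1 / 2) (d / (2 * PI))). assert (L2 := Rmin_r (1 / 2) (d / (2 * PI))).
      assert (Hu2 : u * (2 * PI) < d) by (apply Rlt_div_r; lra).
      specialize (H (2 * PI * u) ltac:(nra)).
      assert (Hx : 0 < Rpower (2 * PI * u) (1 - beta)) by apply exp_pos.
      assert (Hmu : 0 <= m u <= M) by (split; [apply m_nonneg|apply Hmono]; lra).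
      rewrite Rminus_0_r, Rabs_pos_eq by nra.
      apply Rlt_div_r in H; [|lra]. nra.
  - apply continuous_ext_loc with (fun t => Rpower (2 * PI * t) (1 - beta) * m t).
    + exists (mkposreal t Hgt). intros u Hu. change (Rabs (u - t) < t) in Hu. apply Rabs_def2 in Hu.
      unfold psi, Phi_ext. destruct (Rle_dec u 0); [lra|reflexivity].
    + apply (continuous_mult (K := R_AbsRing) (fun t => Rpower (2 * PI * t) (1 - beta)) m).
      * apply (ex_derive_continuous (V := R_NormedModule)). unfold Rpower. auto_derive. nra.
      * apply Hc. lra.
Qed.

(** For beta = 1 the function is [m], strict only at positive radii, so s/2 is inserted when r = 0.
    For beta < 1 a strictly increasing power multiplies a nondecreasing [m] that is positive on (0,
    1). *)
Lemma Phi_ext_strict : ~ exceptional beta f -> forall r s, 0 <= r < s -> s < 1 -> psi r < psi s.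
Proof.
  intros Hex r s Hr Hs. assert (HPI := PI_RGT_0).
  destruct Hm as (_ & _ & Hmono & _ & _ & Hstr & _ & Hpos).
  unfold psi, Phi_ext. destruct (Rle_dec s 0) as [|_]; [lra|].
  destruct (Req_dec_T beta 1) as [Hb|Hb].
  - assert (Hnl : ~ linear_map f) by (intros Hl; apply Hex; now right).
    rewrite Hb, Rminus_diag, (Rpower_O (2 * PI * s)), Rmult_1_l by nra.
    destruct (Rle_dec r 0) as [Hr0|Hr0].
    + apply Rle_lt_trans with (m (s / 2)). apply Hmono; lra. apply Hstr; auto; lra.
    + rewrite Rpower_O, Rmult_1_l by nra. apply Hstr; auto; lra.
  - assert (Hnc : ~ constant_map f) by (intros Hl; apply Hex; left; split; [lra|auto]).
    assert (Hps := Hpos Hnc s ltac:(lra)).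
    assert (Hx : 0 < Rpower (2 * PI * s) (1 - beta)) by apply exp_pos.
    destruct (Rle_dec r 0) as [Hr0|Hr0].
    + now apply Rmult_lt_0_compat.
    + assert (Hpr := Hpos Hnc r ltac:(lra)).
      assert (Hrs : Rpower (2 * PI * r) (1 - beta) < Rpower (2 * PI * s) (1 - beta)) by (apply Rlt_Rpower_l; nra).
      assert (Hms := Hmono r s ltac:(lra) Hs).
      assert (Hxr : 0 < Rpower (2 * PI * r) (1 - beta)) by apply exp_pos. nra.
Qed.

Lemma Phi_ext_constant : exceptional beta f -> forall t, 0 <= t < 1 -> psi t = psi 0.
Proof.
  intros Hex t Ht. assert (HPI := PI_RGT_0). destruct Hm as (_ & _ & _ & _ & Hlin & _ & Hcst & _).
  unfold psi, Phi_ext. destruct (Rle_dec 0 0) as [_|]; [|lra].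
  destruct (Rle_dec t 0) as [_|Ht0]; [reflexivity|].
  destruct Hex as [[Hb Hc]|[Hb Hl]]; destruct (Req_dec_T beta 1); try lra.
  - rewrite (Hcst Hc t Ht). ring.
  - rewrite Hb, Rminus_diag, Rpower_O, Rmult_1_l by nra. now apply Hlin.
Qed.

Lemma Phi_ext_mono r s : 0 <= r <= s -> s < 1 -> psi r <= psi s.
Proof.
  intros Hr Hs. destruct (classic (exceptional beta f)) as [Hex|Hex].
  - rewrite (Phi_ext_constant Hex r), (Phi_ext_constant Hex s); lra.
  - destruct (proj2 Hr) as [Hlt| ->]; [|lra]. apply Rlt_le, Phi_ext_strict; auto. lra.
Qed.
End Profile.

Theorem theorem2 (alpha beta : R) (f : C -> C)
  (hbeta : 0 <= beta <= 1)
  (hf : univalent f \/ monomial_map f) :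
  ((forall r s : R, 0 < r -> r < s -> s < 1 ->
      L_mean alpha beta f r < L_mean alpha beta f s)
   <-> ~ exceptional beta f)
  /\
  (beta < 1 -> filterlim (L_mean alpha beta f) (at_right 0) (locally 0))
  /\
  (beta = 1 ->
     filterlim (L_mean alpha beta f) (at_right 0)
       (locally (Cmod (C_derive f 0%C))))
  /\
  (exists (Phi0 : R) (Phi1 : Rbar),
     filterlim (Phi_L beta f) (at_right 0) (locally Phi0) /\
     filterlim (Phi_L beta f) (at_left 1) (Rbar_locally Phi1) /\
     (Rbar_lt Phi1 p_infty ->
        (forall r s : R, 0 < r -> r < s -> s < 1 ->
           let q := (L_mean alpha beta f s - L_mean alpha beta f r)
                    / (ln (nu alpha s) - ln (nu alpha r)) in
           0 <= q /\
           q <= Phi_L beta f s - Phi0 /\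
           (0 = q <-> exceptional beta f) /\
           (q = Phi_L beta f s - Phi0 <-> exceptional beta f))
        /\
        (exists K : R, forall r s : R, 0 < r < 1 -> 0 < s < 1 ->
           Rabs (L_mean alpha beta f s - L_mean alpha beta f r)
           <= K * Rabs (ln (nu alpha s) - ln (nu alpha r))))).
Proof.
  assert (Hprof : exists m, length_profile f m).
  { destruct hf; [now apply length_profile_univalent|now apply length_profile_monomial]. }
  destruct Hprof as [m Hm].
  set (psi := Phi_ext beta m). set (w := mu_density alpha).
  assert (Hspec : forall t, 0 < t < 1 -> Phi_L beta f t = psi t) by (intros; now apply Phi_ext_spec).
  assert (Hpsi : forall t, t < 1 -> continuous psi t) by (intros; now apply Phi_ext_continuous with f).
  assert (Hmono : forall r s, 0 <= r <= s -> s < 1 -> psi r <= psi s) by (intros; now apply Phi_ext_mono with f).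
  assert (Hstrict := Phi_ext_strict beta f m hbeta Hm : ~ exceptional beta f -> forall r s, 0 <= r < s -> s < 1 -> psi r < psi s).
  assert (Hconst := Phi_ext_constant beta f m hbeta Hm : exceptional beta f -> forall t, 0 <= t < 1 -> psi t = psi 0).
  assert (Hw : forall t, -1 < t < 1 -> continuous w t) by (intros; now apply mu_density_continuous).
  assert (Hw0 : forall t, 0 < t < 1 -> 0 < w t) by (intros; now apply mu_density_pos).
  (* The integrands need to agree only on the open interval, so the value of [Phi_L] at 0 is
     immaterial. *)
  assert (HA : forall r, 0 < r < 1 -> L_mean alpha beta f r = weighted_mean psi w r).
  { intros r Hr. unfold L_mean, weighted_mean. f_equal. apply RInt_ext.
    rewrite Rmin_left, Rmax_right by lra. intros t Ht. rewrite Hspec by lra. reflexivity. }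
  assert (Hquot := weighted_mean_quotient psi w Hpsi Hw Hw0).
  change (weight_int w) with (nu alpha) in Hquot.
  assert (Hbd := weighted_mean_bounds psi w Hpsi Hw Hw0 Hmono).
  assert (Hbds := weighted_mean_bounds_strict psi w Hpsi Hw Hw0).
  assert (Hlog : forall r s, 0 < r -> r < s -> s < 1 -> 0 < ln (nu alpha s) - ln (nu alpha r)).
  { intros r s Hr Hrs Hs. apply Rlt_Rminus. apply ln_increasing.
    apply (weight_int_pos w Hw Hw0). lra. apply (weight_int_lt w Hw Hw0); lra. }
  set (q := fun r s => (L_mean alpha beta f s - L_mean alpha beta f r) / (ln (nu alpha s) - ln (nu alpha r))).
  assert (Hincr : forall r s, 0 < r -> r < s -> s < 1 ->
    L_mean alpha beta f s - L_mean alpha beta f r = q r s * (ln (nu alpha s) - ln (nu alpha r))).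
  { intros r s Hr Hrs Hs. unfold q. field. specialize (Hlog r s Hr Hrs Hs). lra. }
  (* At the intermediate point c <= s one has psi 0 < mean c < psi c <= psi s, so psi c - mean c
     lies strictly between 0 and psi s - psi 0. *)
  assert (Hqs : ~ exceptional beta f -> forall r s, 0 < r -> r < s -> s < 1 -> 0 < q r s < psi s - psi 0).
  { intros Hex r s Hr Hrs Hs. destruct (Hquot r s) as [c [Hc Ec]]; [lra|lra|].
    unfold q. rewrite !HA, Ec by lra. assert (Hb := Hbds c ltac:(lra) (Hstrict Hex)).
    assert (Hcs := Hmono c s ltac:(lra) Hs). lra. }
  (* Here [psi] is constant on [0, 1), so the bounds on the mean collapse and both sides are 0. *)
  assert (Hqc : exceptional beta f -> forall r s, 0 < r -> r < s -> s < 1 -> q r s = 0 /\ psi s - psi 0 = 0).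
  { intros Hex r s Hr Hrs Hs. destruct (Hquot r s) as [c [Hc Ec]]; [lra|lra|].
    unfold q. rewrite !HA, Ec by lra. assert (Hb := Hbd c ltac:(lra)).
    rewrite (Hconst Hex c) in * by lra. rewrite (Hconst Hex s) by lra. lra. }
  assert (Hlim : filterlim (L_mean alpha beta f) (at_right 0) (locally (psi 0))).
  { apply filterlim_ext_loc with (weighted_mean psi w).
    - exists (mkposreal 1 Rlt_0_1). intros r Hr Hr0. change (Rabs (r - 0) < 1) in Hr.
      symmetry. apply HA. apply Rabs_def2 in Hr. lra.
    - now apply weighted_mean_at_0. }
  assert (Hpsi0 : psi 0 = if Req_dec_T beta 1 then Cmod (C_derive f 0%C) else 0).
  { unfold psi, Phi_ext. destruct (Rle_dec 0 0) as [_|]; [|lra].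
    destruct (Req_dec_T beta 1); [|reflexivity]. apply Hm. }
  split; [|split; [|split]].
  - split.
    (* Any pair of radii would do: in the exceptional case the increment is 0, contradicting strict
       growth. *)
    + intros Hinc Hex. specialize (Hinc (1 / 3) (1 / 2) ltac:(lra) ltac:(lra) ltac:(lra)).
      assert (E := Hincr (1 / 3) (1 / 2) ltac:(lra) ltac:(lra) ltac:(lra)).
      destruct (Hqc Hex (1 / 3) (1 / 2)) as [Z _]; try lra. rewrite Z, Rmult_0_l in E. lra.
    + intros Hex r s Hr Hrs Hs. assert (E := Hincr r s Hr Hrs Hs).
      assert (Hp := Rmult_lt_0_compat _ _ (proj1 (Hqs Hex r s Hr Hrs Hs)) (Hlog r s Hr Hrs Hs)). lra.
  - intros Hb. destruct (Req_dec_T beta 1); [lra|]. now rewrite Hpsi0 in Hlim.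
  - intros Hb. destruct (Req_dec_T beta 1); [|lra]. now rewrite Hpsi0 in Hlim.
  - destruct (monotone_limit_at_1 psi Hmono) as [l [Hl Hle]].
    exists (psi 0), l. split; [|split].
    + apply filterlim_ext_loc with psi.
      * exists (mkposreal 1 Rlt_0_1). intros r Hr Hr0. change (Rabs (r - 0) < 1) in Hr.
        symmetry. apply Hspec. apply Rabs_def2 in Hr. lra.
      (* [psi] is continuous at 0 from both sides by construction, which restricts to the right-hand
         limit. *)
      * exact (filterlim_filter_le_1 psi (filter_le_within (fun u => 0 < u)) (Hpsi 0 Rlt_0_1)).
    + apply filterlim_ext_loc with psi; [|exact Hl].
      exists (mkposreal 1 Rlt_0_1). intros r Hr Hr0. change (Rabs (r - 1) < 1) in Hr.
      symmetry. apply Hspec. apply Rabs_def2 in Hr. lra.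
    + intros Hfin. split.
      * intros r s Hr Hrs Hs. change (let q := q r s in 0 <= q /\ q <= Phi_L beta f s - psi 0 /\
          (0 = q <-> exceptional beta f) /\ (q = Phi_L beta f s - psi 0 <-> exceptional beta f)).
        intros q'. rewrite Hspec by lra. unfold q'.
        destruct (classic (exceptional beta f)) as [Hex|Hex].
        -- destruct (Hqc Hex r s Hr Hrs Hs) as [Z1 Z2]. rewrite Z1, Z2. repeat split; auto; lra.
        -- assert (Hb := Hqs Hex r s Hr Hrs Hs). repeat split; try lra; intros; try lra; contradiction.
      * assert (Hl0 := Hle 0 ltac:(lra)). destruct l as [l| |]; simpl in *; try contradiction.
        (* The quotient is at most psi s - psi 0, and [l] bounds [psi] on [0, 1). *)
        exists (l - psi 0).
        assert (Hone : forall r s, 0 < r -> r < s -> s < 1 ->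
          Rabs (L_mean alpha beta f s - L_mean alpha beta f r) <= (l - psi 0) * Rabs (ln (nu alpha s) - ln (nu alpha r))).
        { intros r s Hr Hrs Hs. assert (Hlg := Hlog r s Hr Hrs Hs).
          rewrite (Hincr r s Hr Hrs Hs), Rabs_mult. apply Rmult_le_compat_r. apply Rabs_pos.
          assert (Hsl := Hle s ltac:(lra)). simpl in Hsl.
          destruct (classic (exceptional beta f)) as [Hex|Hex].
          - destruct (Hqc Hex r s Hr Hrs Hs) as [Z1 Z2]. rewrite Z1, Rabs_R0. lra.
          - assert (Hb := Hqs Hex r s Hr Hrs Hs). rewrite Rabs_pos_eq; lra. }
        intros r s Hr Hs. destruct (Rtotal_order r s) as [H|[->|H]].
        -- apply Hone; lra.
        -- rewrite !Rminus_diag, Rabs_R0. lra.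
        -- rewrite Rabs_minus_sym, (Rabs_minus_sym (ln (nu alpha s))). apply Hone; lra.
Qed.
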